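(* For the two-user IM/DD interference channel, the capacity region satisfies $\mathcal{G}'_{\rm HK}\subseteq\mathcal{G}$, where $$\mathcal{G}'_{\rm HK}={\rm Conv}\Big(\bigcup\mathcal{R}'_{\rm HK}(\boldsymbol{\kappa},\boldsymbol{\eta},\boldsymbol{\theta},\boldsymbol{\phi})\Big),$$ the union being over $\boldsymbol{\kappa}=(\kappa_1,\kappa_2)$, $\boldsymbol{\eta}=(\eta_1,\eta_2)$, $\boldsymbol{\theta}=(\theta_1,\theta_2)$, $\boldsymbol{\phi}=(\phi_1,\phi_2)$ with $\theta_i,\phi_i\in(0,1]$ and, for $i=1,2$, $\kappa_i,\eta_i\in[0,\mathsf{A}]$, $\kappa_i+\eta_i\le\mathsf{A}$, $\theta_i\kappa_i+\phi_i\eta_i\le\alpha_i\mathsf{A}$; and $\mathcal{R}'_{\rm HK}(\boldsymbol{\kappa},\boldsymbol{\eta},\boldsymbol{\theta},\boldsymbol{\phi})$ is the set of $(\mathsf{R}_1,\mathsf{R}_2)\in\mathbb{R}_+^2$ such that, for $i,j\in\{1,2\}$, $i\neq j$, $$\mathsf{R}_i\le\mathsf{F}(0,h_{ii}\kappa_i,h_{ji}\kappa_j,1,\theta_i,\theta_j)+\min_{k\in\{1,2\}}\mathsf{F}(0,h_{ik}\eta_i,h_{ik}\kappa_i+h_{jk}\kappa_j,1,\phi_i,\theta'_k),$$ $$\mathsf{R}_1+\mathsf{R}_2\le\sum_{\substack{i,j\in\{1,2\}\\ i\neq j}}\mathsf{F}(0,h_{ii}\kappa_i,h_{ji}\kappa_j,1,\theta_i,\theta_j)+\min_{\substack{i,j\in\{1,2\}\\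 i\neq j}}\mathsf{F}(h_{ii}\eta_i,h_{ji}\eta_j,h_{ii}\kappa_i+h_{ji}\kappa_j,\phi_i,\phi_j,\theta'_i),$$ where, for $i\neq j$, $\theta'_i=\frac{h_{ii}\theta_i\kappa_i+h_{ji}\theta_j\kappa_j}{h_{ii}\kappa_i+h_{ji}\kappa_j}$ if $h_{ii}\kappa_i+h_{ji}\kappa_j>0$ and $\theta'_i=0$ otherwise.
   Context: Two-user IM/DD interference channel: for $i,j\in\{1,2\}$, $i\neq j$, $Y_i=h_{ii}X_i+h_{ji}X_j+Z_i$, with channel gains $h_{kl}\ge0$, noises $Z_1,Z_2\sim\mathcal{N}(0,\sigma^2)$ ($\sigma>0$) i.i.d. over time and independent of inputs; inputs satisfy $X_i\in[0,\mathsf{A}]$ ($\mathsf{A}>0$) and $\mathbb{E}[X_i]\le\alpha_i\mathsf{A}$, $\alpha_i\in(0,1]$. Transmitter $i$ encodes $m_i\in\{1,\dots,\lceil2^{n\mathsf{R}_i}\rceil\}$ into a length-$n$ codeword satisfying these constraints; receiver $i$ decodes $m_i$ from $Y_i^n$; $(\mathsf{R}_1,\mathsf{R}_2)$ is achievable if both average error probabilities tend to $0$; $\mathcal{G}$ is the closure of achievable pairs. ${\rm Conv}$ is the convex hull. Logs base 2, $\mathcal{Q}(x)=\int_x^\infty\frac{1}{\sqrt{2\pi}}e^{-t^2/2}dt$. $\rho(\alpha)$: for $\alpha\in(0,\frac12)$, $\rho(\alpha)=\frac{e^{2\alpha\mu^*-1}}{2\pi}\big(\frac{1-e^{-\mu^*}}{\mu^*}\big)^2$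 with $\mu^*$ the unique positive solution of $\alpha=\frac{1}{\mu^*}-\frac{e^{-\mu^*}}{1-e^{-\mu^*}}$; for $\alpha\in[\frac12,1]$, $\rho(\alpha)=\frac{1}{2\pi e}$. $\overline{\mathsf{C}}(\mathsf{A},\alpha)=c_1$ if $\alpha\in(0,\frac12)$, $=c_2$ if $\alpha\in[\frac12,1]$, where $$c_1=\min_{\mu,\xi>0}\Big[1-\mathcal{Q}\big(\tfrac{\xi+\alpha\mathsf{A}}{\sigma}\big)-\mathcal{Q}\big(\tfrac{\xi+(1-\alpha)\mathsf{A}}{\sigma}\big)\Big]\log\Big(\frac{\mathsf{A}}{\sigma}\frac{e^{\mu\xi/\mathsf{A}}-e^{-\mu(1+\xi/\mathsf{A})}}{\sqrt{2\pi}\mu(1-2\mathcal{Q}(\xi/\sigma))}\Big)+\log(e)\Big[-\tfrac12+\mathcal{Q}\big(\tfrac{\xi}{\sigma}\big)+\tfrac{\xi}{\sqrt{2\pi}\sigma}e^{-\frac{\xi^2}{2\sigma^2}}+\tfrac{\sigma}{\mathsf{A}}\tfrac{\mu}{\sqrt{2\pi}}\big(e^{-\frac{\xi^2}{2\sigma^2}}-e^{-\frac{(\mathsf{A}+\xi)^2}{2\sigma^2}}\big)+\mu\alpha\big(1-2\mathcal{Q}\big(\tfrac{\xi+\mathsf{A}/2}{\sigma}\big)\big)\Big],$$ $$c_2=\min_{\xi>0}\Big[1-2\mathcal{Q}\big(\tfrac{\xi+\mathsf{A}/2}{\sigma}\big)\Big]\log\Big(\frac{\mathsf{A}+2\xi}{\sigma\sqrt{2\pi}(1-2\mathcal{Q}(\xi/\sigma))}\Big)+\log(e)\Big[-\tfrac12+\mathcal{Q}\big(\tfrac{\xi}{\sigma}\big)+\tfrac{\xi}{\sqrt{2\pi}\sigma}e^{-\frac{\xi^2}{2\sigma^2}}\Big].$$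 $\mathsf{F}(a_1,a_2,a_3,\theta_1,\theta_2,\theta_3)=\frac12\log\Big(1+\frac{\rho(\theta_1)a_1^2+\rho(\theta_2)a_2^2}{\sigma^2\,2^{2\overline{\mathsf{C}}(a_3,\theta_3)}}\Big)$. *)

(* Defs.v *)
From HB Require Import structures.
From mathcomp Require Import all_boot all_order all_algebra.
From mathcomp Require Import all_classical all_reals all_analysis.
Set Implicit Arguments.
Unset Strict Implicit.
Unset Printing Implicit Defensive.
Import Order.TTheory GRing.Theory Num.Theory.
Import numFieldNormedType.Exports.
Local Open Scope classical_set_scope.
Local Open Scope ring_scope.

Section IMDD.
Variable R : realType.

Definition log2 (x : R) : R := ln x / ln 2.

Definition Qfun (x : R) : R :=
  Rintegral lebesgue_measure `[x, +oo[%classic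
    (fun t => (Num.sqrt (pi *+ 2))^-1 * expR (- (t ^+ 2) / 2)).

Definition mu_star (a : R) : R :=
  xget 0 [set mu : R | 0 < mu /\ a = mu^-1 - expR (- mu) / (1 - expR (- mu))].

Definition rho (a : R) : R :=
  if a < 2^-1 then
    let mu := mu_star a in
    expR (2 * a * mu - 1) / (pi *+ 2) * ((1 - expR (- mu)) / mu) ^+ 2
  else (pi *+ 2 * expR 1)^-1.

Definition c1_obj (sigma A a mu xi : R) : R :=
  (1 - Qfun ((xi + a * A) / sigma) - Qfun ((xi + (1 - a) * A) / sigma)) *
    log2 (A / sigma * (expR (mu * xi / A) - expR (- (mu * (1 + xi / A))))
          / (Num.sqrt (pi *+ 2) * mu * (1 - 2 * Qfun (xi / sigma))))
  + log2 (expR 1) *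
    (- 2^-1 + Qfun (xi / sigma)
     + xi / (Num.sqrt (pi *+ 2) * sigma) * expR (- (xi ^+ 2) / (2 * sigma ^+ 2))
     + sigma / A * (mu / Num.sqrt (pi *+ 2)) *
         (expR (- (xi ^+ 2) / (2 * sigma ^+ 2))
          - expR (- ((A + xi) ^+ 2) / (2 * sigma ^+ 2)))
     + mu * a * (1 - 2 * Qfun ((xi + A / 2) / sigma))).

Definition c2_obj (sigma A xi : R) : R :=
  (1 - 2 * Qfun ((xi + A / 2) / sigma)) *
    log2 ((A + 2 * xi) / (sigma * Num.sqrt (pi *+ 2) * (1 - 2 * Qfun (xi / sigma))))
  + log2 (expR 1) *
    (- 2^-1 + Qfun (xi / sigma)
     + xi / (Num.sqrt (pi *+ 2) * sigma) * expR (- (xi ^+ 2) / (2 * sigma ^+ 2))).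

(* the minima are taken as infima *)
Definition c1 (sigma A a : R) : R :=
  inf [set v : R | exists mu xi : R,
          0 < mu /\ 0 < xi /\ v = c1_obj sigma A a mu xi].
Definition c2 (sigma A : R) : R :=
  inf [set c2_obj sigma A xi | xi in [set xi : R | 0 < xi]].

Definition Cbar (sigma A a : R) : R :=
  if A == 0 then 0 else if a < 2^-1 then c1 sigma A a else c2 sigma A.

Definition Ffun (sigma a1 a2 a3 t1 t2 t3 : R) : R :=
  2^-1 * log2 (1 + (rho t1 * a1 ^+ 2 + rho t2 * a2 ^+ 2)
                   / (sigma ^+ 2 * 2 `^ (2 * Cbar sigma a3 t3))).

(* users are indexed by 'I_2: ord0 = user 1, ord_max = user 2 *)
Definition oth (i : 'I_2) : 'I_2 := if i == ord0 then ord_max else ord0.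
Definition rate (r : R * R) (i : 'I_2) : R := if i == ord0 then r.1 else r.2.

(* theta'_k, for receiver k; h k l = channel gain from transmitter k to receiver l *)
Definition theta' (h : 'I_2 -> 'I_2 -> R) (kap th : 'I_2 -> R) (i : 'I_2) : R :=
  let j := oth i in
  let s := h i i * kap i + h j i * kap j in
  if 0 < s then (h i i * th i * kap i + h j i * th j * kap j) / s else 0.

Definition RHK' (sigma : R) (h : 'I_2 -> 'I_2 -> R) (kap eta th ph : 'I_2 -> R)
  : set (R * R) :=
  [set r | 0 <= r.1 /\ 0 <= r.2 /\
    (forall i j : 'I_2, i != j ->
       rate r i <= Ffun sigma 0 (h i i * kap i) (h j i * kap j) 1 (th i) (th j)
         + Num.min
             (Ffun sigma 0 (h i ord0 * eta i) (h i ord0 * kap i + h j ord0 * kap j)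
                   1 (ph i) (theta' h kap th ord0))
             (Ffun sigma 0 (h i ord_max * eta i)
                   (h i ord_max * kap i + h j ord_max * kap j)
                   1 (ph i) (theta' h kap th ord_max))) /\
    r.1 + r.2 <=
      \sum_(i < 2) Ffun sigma 0 (h i i * kap i) (h (oth i) i * kap (oth i)) 1
                        (th i) (th (oth i))
      + Num.min
          (let i := ord0 in let j := ord_max in
           Ffun sigma (h i i * eta i) (h j i * eta j) (h i i * kap i + h j i * kap j)
                (ph i) (ph j) (theta' h kap th i))
          (let i := ord_max in let j := ord0 in
           Ffun sigma (h i i * eta i) (h j i * eta j) (h i i * kap i + h j i * kap j)
                (ph i) (ph j) (theta' h kap th i))].

Definition conv_hull (S : set (R * R)) : set (R * R) :=
  [set p | exists (n : nat) (w : 'I_n -> R) (q : 'I_n -> R * R),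
     (forall k, 0 <= w k) /\ \sum_(k < n) w k = 1 /\ (forall k, S (q k)) /\
     p = (\sum_(k < n) w k * (q k).1, \sum_(k < n) w k * (q k).2)].

Definition GHK' (A sigma : R) (alpha : 'I_2 -> R) (h : 'I_2 -> 'I_2 -> R)
  : set (R * R) :=
  conv_hull (\bigcup_(x in [set x : ('I_2 -> R) * ('I_2 -> R) * ('I_2 -> R) * ('I_2 -> R) |
        let: (kap, eta, th, ph) := x in
        forall i : 'I_2, 0 < th i <= 1 /\ 0 < ph i <= 1 /\
          0 <= kap i <= A /\ 0 <= eta i <= A /\ kap i + eta i <= A /\
          th i * kap i + ph i * eta i <= alpha i * A])
     (let: (kap, eta, th, ph) := x in RHK' sigma h kap eta th ph)).

(* E[f(Z^n)] for Z^n i.i.d. N(0, sigma^2), as an iterated integral *)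
Fixpoint gauss_expect (sigma : R) (n : nat) : (n.-tuple R -> \bar R) -> \bar R :=
  match n return (n.-tuple R -> \bar R) -> \bar R with
  | 0 => fun f => f [tuple]
  | n'.+1 => fun f =>
      (\int[normal_prob 0 sigma]_z gauss_expect sigma (fun w => f (cons_tuple z w)))%E
  end.

Definition nmsg (n : nat) (r : R) : nat := `|Num.ceil (2 `^ (n%:R * r))|%N.

Record code (n M1 M2 : nat) := Code {
  enc1 : 'I_M1 -> n.-tuple R;
  enc2 : 'I_M2 -> n.-tuple R;
  dec1 : n.-tuple R -> 'I_M1;
  dec2 : n.-tuple R -> 'I_M2 }.

Definition codeword_ok (A a : R) n (x : n.-tuple R) : Prop :=
  (forall t : 'I_n, 0 <= tnth x t <= A) /\
  \sum_(t < n) tnth x t <= n%:R * (a * A).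

Definition code_ok (A : R) (alpha : 'I_2 -> R) n M1 M2 (C : code n M1 M2) : Prop :=
  (forall m, codeword_ok A (alpha ord0) (enc1 C m)) /\
  (forall m, codeword_ok A (alpha ord_max) (enc2 C m)) /\
  (forall m, measurable [set y : n.-tuple R | dec1 C y = m]) /\
  (forall m, measurable [set y : n.-tuple R | dec2 C y = m]).

Definition out1 (h : 'I_2 -> 'I_2 -> R) n (x1 x2 z : n.-tuple R) : n.-tuple R :=
  mktuple (fun t => h ord0 ord0 * tnth x1 t + h ord_max ord0 * tnth x2 t + tnth z t).
Definition out2 (h : 'I_2 -> 'I_2 -> R) n (x1 x2 z : n.-tuple R) : n.-tuple R :=
  mktuple (fun t => h ord_max ord_max * tnth x2 t + h ord0 ord_max * tnth x1 t + tnth z t).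

Definition Perr1 sigma h n M1 M2 (C : code n M1 M2) : \bar R :=
  (((M1 * M2)%:R)^-1%:E *
   \sum_(m1 < M1) \sum_(m2 < M2)
     gauss_expect sigma (fun z =>
       ((dec1 C (out1 h (enc1 C m1) (enc2 C m2) z) != m1)%:R)%:E))%E.
Definition Perr2 sigma h n M1 M2 (C : code n M1 M2) : \bar R :=
  (((M1 * M2)%:R)^-1%:E *
   \sum_(m1 < M1) \sum_(m2 < M2)
     gauss_expect sigma (fun z =>
       ((dec2 C (out2 h (enc1 C m1) (enc2 C m2) z) != m2)%:R)%:E))%E.

Definition achievable (A sigma : R) (alpha : 'I_2 -> R) (h : 'I_2 -> 'I_2 -> R)
  (r : R * R) : Prop :=
  exists C : forall n : nat, code n (nmsg n r.1) (nmsg n r.2),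
    (forall n, code_ok A alpha (C n)) /\
    ((fun n => Perr1 sigma h (C n)) @ \oo --> 0%E) /\
    ((fun n => Perr2 sigma h (C n)) @ \oo --> 0%E).

Definition capacity_region (A sigma : R) (alpha : 'I_2 -> R) (h : 'I_2 -> 'I_2 -> R)
  : set (R * R) := closure [set r | achievable A sigma alpha h r].

End IMDD.

(* Main.v *)
(* Han-Kobayashi superposition coding, with an output quantizer and time sharing. Each user splits its
   message into a common and a private part, carried by independent codewords that are added. The
   alphabets are finite: a letter is uniform on the N quantiles of a truncated exponential law (or of a
   uniform one), and the outputs are quantized into finitely many cells, so that random coding with
   Chernoff bounds applies; codewords that violate the average intensity constraint are replaced by zero.
   The mutual informations are differences of differential entropies of finite Gaussian mixtures, up to
   errors vanishing with the number of quantiles and cells. The entropy of the interference is bounded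
   above by Gibbs' inequality against the Lapidoth-Moser-Wigger test density, which gives Cbar. The
   entropy of the total signal is bounded below by an entropy power inequality, proved by transporting a
   Gaussian to the signal and using Gibbs' inequality and the concavity of the logarithm; the entropy
   powers of the truncated exponential laws are the terms rho(theta) a^2. Convex combinations are obtained
   by time sharing between letter laws with an idle fraction of the time, which costs arbitrarily little
   rate and disappears in the closure. *)

Require Import Defs.
From HB Require Import structures.
From mathcomp Require Import all_boot all_order all_algebra.
From mathcomp Require Import all_classical all_reals all_analysis.
From mathcomp Require Import measurable_realfun.
From mathcomp Require Import ring lra.
Set Implicit Arguments.
Unset Strict Implicit.
Unset Printing Implicit Defensive.
Import Order.TTheory GRing.Theory Num.Theory.
Import numFieldNormedType.Exports.
Local Open Scope classical_set_scope.
Local Open Scope ring_scope.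

(** * Uniform averages over finite types *)

Section Avg.
Variable R : realType.

(** With finite codebooks, letters and outputs every expectation over codes is a nested uniform
    average, and the analysis that remains is Gaussian integration on the line. The price is that
    entropy power is wanted for a discrete signal, which has none. The way out is that the transport
    argument accepts any Gaussian mixture as test density: it is run on the continuous signal but
    tested against the mixture of the discretized sum, so that the density of the continuous sum
    never appears and the discrepancy is the error of a Riemann sum. Signals are added one after
    another to a mixture that is already discretized, so the error constants have to be uniform in
    the number of components. The common codewords are tested with the private letters averaged out,
    so a wrong common codeword is counted once and not once per private message. The resulting
    conditions bound private rates and common rates separately, which matches the shape of the
    region and allows an explicit splitting of each rate. *)

Definition avg (I : finType) (F : I -> R) : R := #|I|%:R^-1 * \sum_i F i.

Lemma eq_avg (I : finType) (F G : I -> R) : F =1 G -> avg F = avg G.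
Proof. by move=> FG; congr (_ * _); apply: eq_bigr => i _. Qed.

Lemma avgD (I : finType) (F G : I -> R) : avg (fun i => F i + G i) = avg F + avg G.
Proof. by rewrite /avg big_split mulrDr. Qed.

Lemma avgZ (I : finType) (c : R) (F : I -> R) : avg (fun i => c * F i) = c * avg F.
Proof. by rewrite /avg -mulr_sumr mulrCA. Qed.

Lemma avgZr (I : finType) (c : R) (F : I -> R) : avg (fun i => F i * c) = avg F * c.
Proof. by rewrite /avg -mulr_suml mulrA. Qed.

Lemma avgN (I : finType) (F : I -> R) : avg (fun i => - F i) = - avg F.
Proof. by rewrite /avg sumrN mulrN. Qed.

Lemma avgB (I : finType) (F G : I -> R) : avg (fun i => F i - G i) = avg F - avg G.
Proof. by rewrite avgD avgN. Qed.

Lemma avg_ge0 (I : finType) (F : I -> R) : (forall i, 0 <= F i) -> 0 <= avg F.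
Proof. by move=> h; rewrite mulr_ge0 ?invr_ge0// sumr_ge0. Qed.

Lemma le_avg (I : finType) (F G : I -> R) : (forall i, F i <= G i) -> avg F <= avg G.
Proof. by move=> h; rewrite ler_wpM2l ?invr_ge0// ler_sum. Qed.

Lemma avg_cst (I : finType) (c : R) : (0 < #|I|)%N -> avg (fun _ : I => c) = c.
Proof.
by move=> h; rewrite /avg sumr_const -[c *+ _]mulr_natl mulKf// pnatr_eq0 -lt0n.
Qed.

Lemma avg_gt0 (I : finType) (F : I -> R) : (0 < #|I|)%N -> (forall i, 0 < F i) -> 0 < avg F.
Proof.
move=> I0 h; have /card_gt0P[i0 _] := I0.
rewrite mulr_gt0 ?invr_gt0 ?ltr0n// (bigD1 i0)//= ltr_wpDr// sumr_ge0// => i _.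
exact: ltW.
Qed.

Lemma avg_sum (I : finType) (J : Type) (r : seq J) (F : I -> J -> R) :
  avg (fun i => \sum_(j <- r) F i j) = \sum_(j <- r) avg (fun i => F i j).
Proof. by rewrite /avg exchange_big mulr_sumr. Qed.

Lemma avg_exch (I J : finType) (F : I -> J -> R) :
  avg (fun i => avg (F i)) = avg (fun j => avg (fun i => F i j)).
Proof.
by rewrite /avg -!mulr_sumr exchange_big mulrCA.
Qed.

Lemma avg_pair (I J : finType) (F : I * J -> R) :
  avg F = avg (fun i => avg (fun j => F (i, j))).
Proof.
rewrite /avg -mulr_sumr mulrA -invfM -natrM -card_prod pair_big.
by congr (_ * _); apply: eq_bigr => -[].
Qed.

(** Distributivity of product over sum, read as independence of the coordinates of a uniform
    function. The independence of codewords and of positions in a block both come from here. *)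
Lemma avg_prod (I J : finType) (G : I -> J -> R) :
  avg (fun f : {ffun I -> J} => \prod_i G i (f i)) = \prod_i avg (G i).
Proof.
rewrite /avg big_split /= prodr_const bigA_distr_bigA card_ffun.
by rewrite natrX exprVn.
Qed.

End Avg.

(** * Random coding for one receiver *)

Section AvgEval.
Variable R : realType.
Implicit Types I J : finType.

Lemma avg_sumf (I Y : finType) (F : I -> Y -> R) :
  avg (fun i => \sum_y F i y) = \sum_y avg (fun i => F i y).
Proof. by rewrite avg_sum. Qed.

Lemma avg_ev1 I J (i : I) (F : J -> R) : (0 < #|J|)%N ->
  avg (fun f : {ffun I -> J} => F (f i)) = avg F.
Proof.
move=> J0; transitivity (avg (fun f : {ffun I -> J} => \prod_k (if k == i then F (f k) else 1))).
  apply: eq_avg => f; rewrite (bigD1 i)//= eqxx big1 ?mulr1// => k /negPf->//.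
rewrite (avg_prod (fun k a => if k == i then F a else 1)) (bigD1 i)//= eqxx big1 ?mulr1//.
by move=> k /negPf->; rewrite avg_cst.
Qed.

Lemma avg_eq1 J (b : J) : avg (fun a => (a == b)%:R) = #|J|%:R^-1 :> R.
Proof.
by rewrite /avg (bigD1 b)//= eqxx big1 ?addr0 ?mulr1// => a /negPf->.
Qed.

(** Two distinct codewords of a random codebook are independent. Splitting on the value b of [f j]
    makes the integrand a product over coordinates, so that [avg_prod] applies. *)
Lemma avg_ev2 I J (i j : I) (F : J -> J -> R) : (0 < #|J|)%N -> i != j ->
  avg (fun f : {ffun I -> J} => F (f i) (f j)) = avg (fun a => avg (fun b => F a b)).
Proof.
move=> J0 ij.
transitivity (avg (fun f : {ffun I -> J} => \sum_b F (f i) b * (f j == b)%:R)).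
  apply: eq_avg => f; rewrite (bigD1 (f j))//= eqxx mulr1 big1 ?addr0// => b.
  by rewrite eq_sym => /negPf->; rewrite mulr0.
rewrite avg_sumf [RHS]avg_exch /avg mulr_sumr; apply: eq_bigr => b _.
transitivity (avg (fun f : {ffun I -> J} =>
   \prod_k (if k == i then F (f k) b else if k == j then (f k == b)%:R else 1))).
  apply: eq_avg => f; rewrite (bigD1 i)//= eqxx (bigD1 j) ?(eq_sym j i)//= (negPf ij) ?eqxx.
  rewrite big1 ?mulr1// => k /andP[/negPf-> /negPf->]//.
rewrite (avg_prod (fun k a => if k == i then F a b else if k == j then (a == b)%:R else 1)).
have ji : j != i by rewrite eq_sym.
rewrite (bigD1 i)//= eqxx (bigD1 j)//= (negPf ji) eqxx big1 ?mulr1.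
  by rewrite avg_eq1 mulrC.
by move=> k /andP[/negPf-> /negPf->]; rewrite avg_cst.
Qed.

Lemma avg_le_ex I (F : I -> R) (c : R) : (0 < #|I|)%N -> avg F <= c -> exists i, F i <= c.
Proof.
move=> I0 h; apply: contrapT => /forallNP hn.
have : c < avg F; last by rewrite ltNge h.
rewrite -subr_gt0 -[c](avg_cst _ I0) -avgB; apply: avg_gt0 => // i.
by rewrite subr_gt0 ltNge; apply/negP; exact: hn.
Qed.

End AvgEval.

Section Receiver.
Variable R : realType.
Variables (U V Y : finType) (P : U -> V -> U -> V -> Y -> R).
Hypotheses (U0 : (0 < #|U|)%N) (V0 : (0 < #|V|)%N).
Hypotheses (P0 : forall u v u' v' y, 0 <= P u v u' v' y)
  (P1 : forall u v u' v', \sum_y P u v u' v' y = 1).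

(** In [P u v u' v'] the first pair is the common and private codeword of the receiver's own user,
    the second pair those of the other user. The averages that follow are the output laws when fewer
    and fewer of the four are known. *)
Definition W2 u v u' y : R := avg (fun v' => P u v u' v' y).
Definition W1 u u' y : R := avg (fun v => W2 u v u' y).
Definition Wa u' y : R := avg (fun u => W1 u u' y).
Definition Wb u y : R := avg (fun u' => W1 u u' y).
Definition W0 y : R := avg (fun u' => Wa u' y).

Lemma W2_ge0 u v u' y : 0 <= W2 u v u' y. Proof. exact: avg_ge0. Qed.
Lemma W1_ge0 u u' y : 0 <= W1 u u' y. Proof. by apply: avg_ge0 => ?; exact: W2_ge0. Qed.

Lemma sum_W2 u v u' : \sum_y W2 u v u' y = 1.
Proof. by rewrite -avg_sumf -[RHS](avg_cst _ V0); apply: eq_avg => v'. Qed.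

Lemma sum_W1 u u' : \sum_y W1 u u' y = 1.
Proof. by rewrite -avg_sumf -[RHS](avg_cst _ V0); apply: eq_avg => v; exact: sum_W2. Qed.

Variables G3 Ga Gb G0 : R.
Hypotheses (G30 : 0 < G3) (Ga0 : 0 < Ga) (Gb0 : 0 < Gb) (G00 : 0 < G0).

(** Threshold tests on likelihood ratios. The first one singles out the private codeword given both
    common ones; the other three treat both private codewords as noise and hence do not involve
    v. *)
Definition pass u v u' y : bool :=
  [&& G3 * W1 u u' y < W2 u v u' y, Ga * Wa u' y < W1 u u' y,
      Gb * Wb u y < W1 u u' y & G0 * W0 y < W1 u u' y].

Definition E4 (F : U -> V -> U -> V -> R) : R :=
  avg (fun u => avg (fun v => avg (fun u' => avg (fun v' => F u v u' v')))).

Lemma le_E4 F F' : (forall u v u' v', F u v u' v' <= F' u v u' v') -> E4 F <= E4 F'.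
Proof. by move=> h; do 4!(apply: le_avg => ?). Qed.

Definition Pfail : R := E4 (fun u v u' v' => \sum_y P u v u' v' y * (~~ pass u v u' y)%:R).

Variables (C Q C' Q' : finType).
(* The other user's common codeword is decoded non-uniquely, its private one is treated as noise. *)
Definition joint_decode (f : {ffun C -> U}) (g : {ffun Q -> V}) (f' : {ffun C' -> U}) y : option (C * Q) :=
  [pick z | [exists c', pass (f z.1) (g z.2) (f' c') y]].

Definition EE (F : {ffun C -> U} -> {ffun Q -> V} -> {ffun C' -> U} -> {ffun Q' -> V} -> R) : R :=
  avg (fun f => avg (fun g => avg (fun f' => avg (fun g' => F f g f' g')))).

Lemma le_EE F F' : (forall f g f' g', F f g f' g' <= F' f g f' g') -> EE F <= EE F'.
Proof. by move=> h; do 4!(apply: le_avg => ?). Qed.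

Lemma EED F F' : EE (fun f g f' g' => F f g f' g' + F' f g f' g') = EE F + EE F'.
Proof.
rewrite /EE -avgD; apply: eq_avg => f; rewrite -avgD; apply: eq_avg => g.
by rewrite -avgD; apply: eq_avg => f'; rewrite -avgD.
Qed.

Lemma EE_sum (T : finType) (p : pred T) F :
  EE (fun f g f' g' => \sum_(t | p t) F t f g f' g') = \sum_(t | p t) EE (F t).
Proof.
have s (I : finType) (H : I -> T -> R) :
    avg (fun i => \sum_(t | p t) H i t) = \sum_(t | p t) avg (fun i => H i t).
  by rewrite /avg exchange_big mulr_sumr.
rewrite /EE -s; apply: eq_avg => f; rewrite -s; apply: eq_avg => g.
by rewrite -s; apply: eq_avg => f'; rewrite -s.
Qed.

(** A change of measure: where the test passes, w is at most [F y / G], and F has total mass one. It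
    is used with F the likelihood of a wrong codeword and w the law of the output, which is
    independent of that codeword. *)
Lemma sum_le_inv (w F : Y -> R) (b : pred Y) (G : R) : 0 < G ->
  (forall y, 0 <= F y) -> (forall y, b y -> G * w y <= F y) ->
  \sum_y F y = 1 -> \sum_y w y * (b y)%R%:R <= G^-1.
Proof.
move=> G_0 F0 h F1; have -> : G^-1 = \sum_y G^-1 * F y by rewrite -mulr_sumr F1 mulr1.
apply: ler_sum => y _.
have := h y; case: (b y) => [/(_ isT)|_] /=; first by rewrite mulr1 => h1; rewrite ler_pdivlMl.
by rewrite mulr0 mulr_ge0// invr_ge0 ltW.
Qed.

Section Terms.
Variables (c : C) (p : Q) (c' : C') (p' : Q').

Definition Perr (f : {ffun C -> U}) (g : {ffun Q -> V}) (f' : {ffun C' -> U}) (g' : {ffun Q' -> V}) : R :=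
  \sum_y P (f c) (g p) (f' c') (g' p') y * (joint_decode f g f' y != Some (c, p))%:R.

Lemma EE_1111 (F : U -> V -> U -> V -> R) :
  EE (fun f g f' g' => F (f c) (g p) (f' c') (g' p')) = E4 F.
Proof.
rewrite /EE (avg_ev1 c (fun u => avg (fun (g : {ffun Q -> V}) => avg (fun (f' : {ffun C' -> U}) => avg (fun (g' : {ffun Q' -> V}) => F u (g p) (f' c') (g' p'))))))//.
apply: eq_avg => u; rewrite (avg_ev1 p (fun v => avg (fun (f' : {ffun C' -> U}) => avg (fun (g' : {ffun Q' -> V}) => F u v (f' c') (g' p')))))//.
apply: eq_avg => v; rewrite (avg_ev1 c' (fun u' => avg (fun (g' : {ffun Q' -> V}) => F u v u' (g' p'))))//.
by apply: eq_avg => u'; rewrite (avg_ev1 p' (fun v' => F u v u' v')).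
Qed.

(** The digits count the codewords read from each of the four codebooks. The averages are reordered
    so that everything the test depends on is outside; the inner averages then collapse P into one
    of the averaged laws. *)
Lemma EE_1211 (p2 : Q) (F : U -> V -> V -> U -> V -> R) : p != p2 ->
  EE (fun f g f' g' => F (f c) (g p) (g p2) (f' c') (g' p')) =
  avg (fun u => avg (fun v2 => avg (fun u' => avg (fun v => avg (fun v' => F u v v2 u' v'))))).
Proof.
move=> pp; rewrite /EE (avg_ev1 c (fun u => avg (fun (g : {ffun Q -> V}) => avg (fun (f' : {ffun C' -> U}) => avg (fun (g' : {ffun Q' -> V}) => F u (g p) (g p2) (f' c') (g' p'))))))//.
apply: eq_avg => u; rewrite (avg_ev2 (fun v v2 => avg (fun (f' : {ffun C' -> U}) => avg (fun (g' : {ffun Q' -> V}) => F u v v2 (f' c') (g' p')))) V0 pp).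
rewrite avg_exch; apply: eq_avg => v2; rewrite [RHS]avg_exch.
apply: eq_avg => v; rewrite (avg_ev1 c' (fun u' => avg (fun (g' : {ffun Q' -> V}) => F u v v2 u' (g' p'))))//.
by apply: eq_avg => u'; rewrite (avg_ev1 p' (fun v' => F u v v2 u' v')).
Qed.

Lemma EE_2111 (c2 : C) (F : U -> U -> V -> U -> V -> R) : c != c2 ->
  EE (fun f g f' g' => F (f c) (f c2) (g p) (f' c') (g' p')) =
  avg (fun u2 => avg (fun u' => avg (fun u => avg (fun v => avg (fun v' => F u u2 v u' v'))))).
Proof.
move=> pp; rewrite /EE (avg_ev2 (fun u u2 => avg (fun (g : {ffun Q -> V}) => avg (fun (f' : {ffun C' -> U}) => avg (fun (g' : {ffun Q' -> V}) => F u u2 (g p) (f' c') (g' p'))))) U0 pp).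
rewrite avg_exch; apply: eq_avg => u2; rewrite [RHS]avg_exch; apply: eq_avg => u.
rewrite [RHS]avg_exch (avg_ev1 p (fun v => avg (fun (f' : {ffun C' -> U}) => avg (fun (g' : {ffun Q' -> V}) => F u u2 v (f' c') (g' p')))))//.
apply: eq_avg => v; rewrite (avg_ev1 c' (fun u' => avg (fun (g' : {ffun Q' -> V}) => F u u2 v u' (g' p'))))//.
by apply: eq_avg => u'; rewrite (avg_ev1 p' (fun v' => F u u2 v u' v')).
Qed.

Lemma EE_1121 (c2' : C') (F : U -> V -> U -> U -> V -> R) : c' != c2' ->
  EE (fun f g f' g' => F (f c) (g p) (f' c') (f' c2') (g' p')) =
  avg (fun u => avg (fun u2 => avg (fun u' => avg (fun v => avg (fun v' => F u v u' u2 v'))))).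
Proof.
move=> pp; rewrite /EE (avg_ev1 c (fun u => avg (fun (g : {ffun Q -> V}) => avg (fun (f' : {ffun C' -> U}) => avg (fun (g' : {ffun Q' -> V}) => F u (g p) (f' c') (f' c2') (g' p'))))))//.
apply: eq_avg => u; rewrite (avg_ev1 p (fun v => avg (fun (f' : {ffun C' -> U}) => avg (fun (g' : {ffun Q' -> V}) => F u v (f' c') (f' c2') (g' p')))))//.
transitivity (avg (fun v => avg (fun u2 => avg (fun u' => avg (fun v' => F u v u' u2 v'))))).
  apply: eq_avg => v; rewrite (avg_ev2 (fun u' u2 => avg (fun (g' : {ffun Q' -> V}) => F u v u' u2 (g' p'))) U0 pp).
  rewrite avg_exch; apply: eq_avg => u2; apply: eq_avg => u'.
  by rewrite (avg_ev1 p' (fun v' => F u v u' u2 v')).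
by rewrite avg_exch; apply: eq_avg => u2; rewrite avg_exch.
Qed.

Lemma EE_2121 (c2 : C) (c2' : C') (F : U -> U -> V -> U -> U -> V -> R) : c != c2 -> c' != c2' ->
  EE (fun f g f' g' => F (f c) (f c2) (g p) (f' c') (f' c2') (g' p')) =
  avg (fun u2 => avg (fun u2' => avg (fun u' => avg (fun u => avg (fun v => avg (fun v' =>
    F u u2 v u' u2' v')))))).
Proof.
move=> pp pp'; rewrite /EE (avg_ev2 (fun u u2 => avg (fun (g : {ffun Q -> V}) => avg (fun (f' : {ffun C' -> U}) => avg (fun (g' : {ffun Q' -> V}) => F u u2 (g p) (f' c') (f' c2') (g' p'))))) U0 pp).
rewrite avg_exch; apply: eq_avg => u2.
transitivity (avg (fun u => avg (fun u2' => avg (fun u' => avg (fun v => avg (fun v' =>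
    F u u2 v u' u2' v')))))).
  apply: eq_avg => u; rewrite (avg_ev1 p (fun v => avg (fun (f' : {ffun C' -> U}) => avg (fun (g' : {ffun Q' -> V}) => F u u2 v (f' c') (f' c2') (g' p')))))//.
  transitivity (avg (fun v => avg (fun u2' => avg (fun u' => avg (fun v' => F u u2 v u' u2' v'))))).
    apply: eq_avg => v; rewrite (avg_ev2 (fun u' u2' => avg (fun (g' : {ffun Q' -> V}) => F u u2 v u' u2' (g' p'))) U0 pp').
    rewrite avg_exch; apply: eq_avg => u2'; apply: eq_avg => u'.
    by rewrite (avg_ev1 p' (fun v' => F u u2 v u' u2' v')).
  by rewrite avg_exch; apply: eq_avg => u2'; rewrite avg_exch.
by rewrite avg_exch; apply: eq_avg => u2'; rewrite avg_exch.
Qed.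

Lemma EE_priv p2 : p2 != p ->
  EE (fun f g f' g' => \sum_y P (f c) (g p) (f' c') (g' p') y *
    (G3 * W1 (f c) (f' c') y < W2 (f c) (g p2) (f' c') y)%R%:R) <= G3^-1.
Proof.
rewrite eq_sym => pp.
rewrite (EE_1211 (fun u v v2 u' v' => \sum_y P u v u' v' y * (G3 * W1 u u' y < W2 u v2 u' y)%R%:R))//.
rewrite -[leRHS](avg_cst _ U0); apply: le_avg => u.
rewrite -[leRHS](avg_cst _ V0); apply: le_avg => v2.
rewrite -[leRHS](avg_cst _ U0); apply: le_avg => u'.
under eq_avg => v.
  rewrite avg_sumf; under eq_bigr => y _ do rewrite avgZr -/(W2 u v u' y).
  over.
rewrite avg_sumf; under eq_bigr => y _ do rewrite avgZr -/(W1 u u' y).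
by apply: (sum_le_inv (F := W2 u v2 u')) => // [y|y /ltW//|]; [exact: W2_ge0|exact: sum_W2].
Qed.

Lemma EE_self c2 : c2 != c ->
  EE (fun f g f' g' => \sum_y P (f c) (g p) (f' c') (g' p') y *
    (Ga * Wa (f' c') y < W1 (f c2) (f' c') y)%R%:R) <= Ga^-1.
Proof.
rewrite eq_sym => pp.
rewrite (EE_2111 (fun u u2 v u' v' => \sum_y P u v u' v' y * (Ga * Wa u' y < W1 u2 u' y)%R%:R))//.
rewrite -[leRHS](avg_cst _ U0); apply: le_avg => u2.
rewrite -[leRHS](avg_cst _ U0); apply: le_avg => u'.
under eq_avg => u.
  under eq_avg => v.
    rewrite avg_sumf; under eq_bigr => y _ do rewrite avgZr -/(W2 u v u' y).
    over.
  rewrite avg_sumf; under eq_bigr => y _ do rewrite avgZr -/(W1 u u' y).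
  over.
rewrite avg_sumf; under eq_bigr => y _ do rewrite avgZr -/(Wa u' y).
by apply: (sum_le_inv (F := W1 u2 u')) => // [y|y /ltW//|]; [exact: W1_ge0|exact: sum_W1].
Qed.

Lemma EE_other c2' : c2' != c' ->
  EE (fun f g f' g' => \sum_y P (f c) (g p) (f' c') (g' p') y *
    (Gb * Wb (f c) y < W1 (f c) (f' c2') y)%R%:R) <= Gb^-1.
Proof.
rewrite eq_sym => pp.
rewrite (EE_1121 (fun u v u' u2 v' => \sum_y P u v u' v' y * (Gb * Wb u y < W1 u u2 y)%R%:R))//.
rewrite -[leRHS](avg_cst _ U0); apply: le_avg => u.
rewrite -[leRHS](avg_cst _ U0); apply: le_avg => u2.
under eq_avg => u'.
  under eq_avg => v.
    rewrite avg_sumf; under eq_bigr => y _ do rewrite avgZr -/(W2 u v u' y).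
    over.
  rewrite avg_sumf; under eq_bigr => y _ do rewrite avgZr -/(W1 u u' y).
  over.
rewrite avg_sumf; under eq_bigr => y _ do rewrite avgZr -/(Wb u y).
by apply: (sum_le_inv (F := W1 u u2)) => // [y|y /ltW//|]; [exact: W1_ge0|exact: sum_W1].
Qed.

Lemma EE_both c2 c2' : c2 != c -> c2' != c' ->
  EE (fun f g f' g' => \sum_y P (f c) (g p) (f' c') (g' p') y *
    (G0 * W0 y < W1 (f c2) (f' c2') y)%R%:R) <= G0^-1.
Proof.
rewrite eq_sym => pp; rewrite eq_sym => pp'.
rewrite (EE_2121 (fun u u2 v u' u2' v' => \sum_y P u v u' v' y * (G0 * W0 y < W1 u2 u2' y)%R%:R))//.
rewrite -[leRHS](avg_cst _ U0); apply: le_avg => u2.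
rewrite -[leRHS](avg_cst _ U0); apply: le_avg => u2'.
under eq_avg => u'.
  under eq_avg => u.
    under eq_avg => v.
      rewrite avg_sumf; under eq_bigr => y _ do rewrite avgZr -/(W2 u v u' y).
      over.
    rewrite avg_sumf; under eq_bigr => y _ do rewrite avgZr -/(W1 u u' y).
    over.
  rewrite avg_sumf; under eq_bigr => y _ do rewrite avgZr -/(Wa u' y).
  over.
rewrite avg_sumf; under eq_bigr => y _ do rewrite avgZr -/(W0 y).
by apply: (sum_le_inv (F := W1 u2 u2')) => // [y|y /ltW//|]; [exact: W1_ge0|exact: sum_W1].
Qed.

Lemma EE_fail :
  EE (fun f g f' g' => \sum_y P (f c) (g p) (f' c') (g' p') y *
    (~~ pass (f c) (g p) (f' c') y)%:R) = Pfail.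
Proof.
exact: (EE_1111 (fun u v u' v' => \sum_y P u v u' v' y * (~~ pass u v u' y)%:R)).
Qed.

(** A wrong answer comes from a passing triple, and its pattern of agreement with the true indices
    selects one of the sums. As soon as a common index is wrong the private index is dropped, since
    the corresponding test does not read it; this keeps the number of private messages out of the
    last three sums. *)
Lemma decode_err f g f' y : (joint_decode f g f' y != Some (c, p))%:R <=
  (~~ pass (f c) (g p) (f' c') y)%:R +
  \sum_(p2 | p2 != p) (G3 * W1 (f c) (f' c') y < W2 (f c) (g p2) (f' c') y)%R%:R +
  \sum_(c2 | c2 != c) (Ga * Wa (f' c') y < W1 (f c2) (f' c') y)%R%:R +
  \sum_(c2' | c2' != c') (Gb * Wb (f c) y < W1 (f c) (f' c2') y)%R%:R +
  \sum_(c2 | c2 != c) \sum_(c2' | c2' != c') (G0 * W0 y < W1 (f c2) (f' c2') y)%R%:R :> R.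
Proof.
have s1 (T : finType) (q b : pred T) : 0 <= \sum_(t | q t) (b t)%:R :> R by apply: sumr_ge0.
have s2 (T : finType) (q b : pred T) t : q t -> b t -> 1 <= \sum_(t | q t) (b t)%:R :> R.
  by move=> qt bt; rewrite (bigD1 t)//= bt ler_wpDr// sumr_ge0.
have s3 : 0 <= \sum_(c2 | c2 != c) \sum_(c2' | c2' != c') (G0 * W0 y < W1 (f c2) (f' c2') y)%R%:R :> R.
  by apply: sumr_ge0 => t _; exact: s1.
have t1 := s1 Q (fun p2 => p2 != p) (fun p2 => G3 * W1 (f c) (f' c') y < W2 (f c) (g p2) (f' c') y).
have t2 := s1 C (fun c2 => c2 != c) (fun c2 => Ga * Wa (f' c') y < W1 (f c2) (f' c') y).
have t3 := s1 C' (fun c2' => c2' != c') (fun c2' => Gb * Wb (f c) y < W1 (f c) (f' c2') y).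
case: (boolP (pass (f c) (g p) (f' c') y)) => [hp|_]; last first.
  rewrite /= mulr1n; apply: (@le_trans _ _ 1); last by lra.
  by case: (_ != _); rewrite /= ?ler01.
rewrite /= mulr0n add0r; rewrite /joint_decode; case: pickP => [[c2 p2]|/(_ (c, p))]; last first.
  by move/negbT/existsPn/(_ c'); rewrite /= hp.
move=> /existsP[c2' /and4P[/= h3 ha hb h0]].
case: eqP => [_|/eqP ne]; first by rewrite /= mulr0n; lra.
rewrite /= mulr1n.
have [e1|n1] := eqVneq c2 c; have [e2|n2] := eqVneq c2' c'.
- have np : p2 != p by apply: contra ne => /eqP->; rewrite e1.
  by have := s2 _ (fun p2 => p2 != p) (fun p2 => G3 * W1 (f c) (f' c') y < W2 (f c) (g p2) (f' c') y) p2 np;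
     rewrite -{1}e1 -{1}e2 -{1}e1 -{1}e2 => /(_ h3); lra.
- have := s2 _ (fun c2' => c2' != c') (fun c2' => Gb * Wb (f c) y < W1 (f c) (f' c2') y) c2' n2.
  by rewrite -{1}e1 -{1}e1 => /(_ hb); lra.
- have := s2 _ (fun c2 => c2 != c) (fun c2 => Ga * Wa (f' c') y < W1 (f c2) (f' c') y) c2 n1.
  by rewrite -{1}e2 -{1}e2 => /(_ ha); lra.
- have h := s2 _ (fun c2' => c2' != c') (fun c2' => G0 * W0 y < W1 (f c2) (f' c2') y) c2' n2 h0.
  have : 1 <= \sum_(c2 | c2 != c) \sum_(c2' | c2' != c') (G0 * W0 y < W1 (f c2) (f' c2') y)%R%:R :> R.
    by rewrite (bigD1 c2)//= ler_wpDr// sumr_ge0// => t _; exact: s1.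
  lra.
Qed.

Lemma random_coding :
  EE Perr <= Pfail + (#|Q|.-1%:R / G3 + #|C|.-1%:R / Ga + #|C'|.-1%:R / Gb +
    #|C|.-1%:R * #|C'|.-1%:R / G0).
Proof.
pose T1 (q : Q) (f : {ffun C -> U}) (g : {ffun Q -> V}) (f' : {ffun C' -> U}) (g' : {ffun Q' -> V}) := \sum_y P (f c) (g p) (f' c') (g' p') y *
    (G3 * W1 (f c) (f' c') y < W2 (f c) (g q) (f' c') y)%R%:R.
pose T2 (q : C) (f : {ffun C -> U}) (g : {ffun Q -> V}) (f' : {ffun C' -> U}) (g' : {ffun Q' -> V}) := \sum_y P (f c) (g p) (f' c') (g' p') y *
    (Ga * Wa (f' c') y < W1 (f q) (f' c') y)%R%:R.
pose T3 (q : C') (f : {ffun C -> U}) (g : {ffun Q -> V}) (f' : {ffun C' -> U}) (g' : {ffun Q' -> V}) := \sum_y P (f c) (g p) (f' c') (g' p') y *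
    (Gb * Wb (f c) y < W1 (f c) (f' q) y)%R%:R.
pose T4 (r : C) (q : C') (f : {ffun C -> U}) (g : {ffun Q -> V}) (f' : {ffun C' -> U}) (g' : {ffun Q' -> V}) := \sum_y P (f c) (g p) (f' c') (g' p') y *
    (G0 * W0 y < W1 (f r) (f' q) y)%R%:R.
have card1 (T : finType) (t : T) (k : R) : \sum_(s | s != t) k = #|T|.-1%:R * k.
  by rewrite sumr_const cardC1 mulr_natl.
rewrite -EE_fail !addrA.
have e1 : \sum_(q | q != p) EE (T1 q) <= #|Q|.-1%:R / G3.
  by rewrite -(card1 _ p); apply: ler_sum => q; exact: EE_priv.
have e2 : \sum_(q | q != c) EE (T2 q) <= #|C|.-1%:R / Ga.
  by rewrite -(card1 _ c); apply: ler_sum => q; exact: EE_self.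
have e3 : \sum_(q | q != c') EE (T3 q) <= #|C'|.-1%:R / Gb.
  by rewrite -(card1 _ c'); apply: ler_sum => q; exact: EE_other.
have e4 : \sum_(r | r != c) \sum_(q | q != c') EE (T4 r q) <= #|C|.-1%:R * #|C'|.-1%:R / G0.
  rewrite -mulrA -(card1 _ c); apply: ler_sum => r rc; rewrite -(card1 _ c').
  by apply: ler_sum => q; exact: EE_both.
apply: (le_trans _ (lerD (lerD (lerD (lerD (lexx _) e1) e2) e3) e4)).
rewrite -(EE_sum (fun q => q != p)) -(EE_sum (fun q => q != c)) -(EE_sum (fun q => q != c')).
under eq_bigr => r _ do rewrite -(EE_sum (fun q => q != c')).
rewrite -(EE_sum (fun q => q != c)) -!EED; apply: le_EE => f g f' g'.
rewrite /T1 /T2 /T3 /T4 /Perr.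
rewrite [\sum_(q | q != p) _]exchange_big [\sum_(q | q != c) \sum_y _]exchange_big.
rewrite [\sum_(q | q != c') \sum_y _]exchange_big /=.
under [\sum_(r | r != c) _]eq_bigr => r _ do rewrite exchange_big.
rewrite [\sum_(r | r != c) _]exchange_big /= -!big_split; apply: ler_sum => y _ /=.
under [\sum_(q | q != p) _]eq_bigr do rewrite /=.
rewrite -!mulr_sumr.
under [\sum_(r | r != c) \sum_(q | q != c') _]eq_bigr => r _ do rewrite -mulr_sumr.
rewrite -mulr_sumr -!mulrDr ler_wpM2l//; exact: decode_err.
Qed.

End Terms.
End Receiver.

(** * Gaussian integrals *)

Section GaussBasics.
Variable R : realType.
Notation mu := (@lebesgue_measure R).
Implicit Types (x y z c s C : R) (f g : R -> R).

Lemma lebesgue_shift c (A : set R) : measurable A ->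
  pushforward mu ((fun y : R => y + c) : _ -> measurableTypeR R) A = mu A.
Proof.
move=> mA; apply/esym/lebesgue_measure_unique => //=.
  exact: measurable_funD.
move=> mc _ [[a b]] /= _ <-; rewrite /pushforward /=.
have -> : (fun y : R => y + c) @^-1` `]a, b] = `](a - c), (b - c)]%classic.
  by apply/seteqP; split => y /=; rewrite !in_itv/= ltrBlDr lerBrDr.
rewrite !lebesgue_measure_itv /= !lte_fin ltrD2r; case: ifP => // _.
by rewrite -!EFinB; congr (_%:E); ring.
Qed.

Lemma ge0_int_shift c (f : R -> \bar R) : measurable_fun [set: R] f ->
  (forall y, (0 <= f y)%E) ->
  (\int[mu]_y f (y + c)%R = \int[mu]_y f y)%E.
Proof.
move=> mf f0.
transitivity (\int[pushforward mu ((fun y : R => y + c)%R : _ -> measurableTypeR R)]_y f y)%E.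
  by rewrite ge0_integral_pushforward//=; exact: measurable_funD.
apply: eq_measure_integral => //=; first exact: measurable_funD.
by move=> mc A mA _; exact: lebesgue_shift.
Qed.

Definition intble f := mu.-integrable setT (EFin \o f).

Lemma intble_shift c f : intble f -> intble (fun y => f (y + c)).
Proof.
move=> /integrableP[mf fi].
have mf' : measurable_fun setT f by exact/measurable_EFinP.
apply/integrableP; split.
  apply/measurable_EFinP; apply: measurableT_comp => //; exact: measurable_funD.
rewrite (ge0_int_shift c (f := fun y => `|(EFin \o f) y|%E))//.
by apply: measurableT_comp.
Qed.

Lemma int_shift c f : intble f -> \int[mu]_y f (y + c) = \int[mu]_y f y.
Proof.
move=> /integrableP[mf fi]; rewrite /Rintegral; congr fine.
have mp := measurable_funepos mf; have mn := measurable_funeneg mf.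
rewrite [LHS]integralE [RHS]integralE; congr (_ - _)%E.
  rewrite -[RHS](ge0_int_shift c mp (fun y => funepos_ge0 _ y)).
  by apply: eq_integral => y _; rewrite !funeposE.
rewrite -[RHS](ge0_int_shift c mn (fun y => funeneg_ge0 _ y)).
by apply: eq_integral => y _; rewrite !funenegE.
Qed.

Lemma ge0_int_opp (f : R -> \bar R) : measurable_fun [set: R] f ->
  (forall y, (0 <= f y)%E) ->
  (\int[mu]_y f (- y)%R = \int[mu]_y f y)%E.
Proof.
move=> mf f0.
transitivity (\int[pushforward mu (-%R : _ -> measurableTypeR R)]_y f y)%E.
  by rewrite ge0_integral_pushforward.
by apply: eq_measure_integral => //= A mA _; exact: lebesgue_measureN.
Qed.

Lemma int_opp f : intble f -> \int[mu]_y f (- y) = \int[mu]_y f y.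
Proof.
move=> /integrableP[mf fi]; rewrite /Rintegral; congr fine.
have mp := measurable_funepos mf; have mn := measurable_funeneg mf.
rewrite [LHS]integralE [RHS]integralE; congr (_ - _)%E.
  rewrite -[RHS](ge0_int_opp mp (fun y => funepos_ge0 _ y)).
  by apply: eq_integral => y _; rewrite !funeposE.
rewrite -[RHS](ge0_int_opp mn (fun y => funeneg_ge0 _ y)).
by apply: eq_integral => y _; rewrite !funenegE.
Qed.

Definition gd s y : R := (s * Num.sqrt (pi *+ 2))^-1 * expR (- (y ^+ 2) / (2 * s ^+ 2)).

Lemma sqrt2pi_gt0 : 0 < Num.sqrt (pi *+ 2) :> R.
Proof. by rewrite sqrtr_gt0 pmulrn_lgt0 ?pi_gt0. Qed.

Lemma gdE s x y : 0 < s -> normal_pdf x s y = gd s (y - x).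
Proof.
move=> s0; rewrite normal_pdfE ?gt_eqF// /normal_peak /normal_fun /gd; congr (_^-1 * expR (_ / _)).
  by rewrite -mulrnAr sqrtrM ?sqr_ge0// sqrtr_sqr gtr0_norm.
by rewrite mulr_natl.
Qed.

Lemma gd_gt0 s y : 0 < s -> 0 < gd s y.
Proof. by move=> s0; rewrite mulr_gt0 ?expR_gt0// invr_gt0 mulr_gt0 ?sqrt2pi_gt0. Qed.

Lemma gdN s y : gd s (- y) = gd s y.
Proof. by rewrite /gd sqrrN. Qed.

Lemma ln_gd s y : 0 < s ->
  ln (gd s y) = - ln (s * Num.sqrt (pi *+ 2)) - y ^+ 2 / (2 * s ^+ 2).
Proof.
move=> s0; have h := sqrt2pi_gt0.
rewrite [LHS]lnM ?posrE ?expR_gt0 ?invr_gt0 ?mulr_gt0// expRK mulNr; congr (_ - _).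
by rewrite [LHS]lnV// posrE mulr_gt0.
Qed.

Lemma gd_cont s : continuous (gd s).
Proof.
move=> y; apply: cvgM; first exact: cvg_cst.
apply: (cvg_comp _ expR); last exact: continuous_expR.
apply: cvgM; last exact: cvg_cst.
apply: (@cvgN _ R^o).
exact: sqr_continuous.
Qed.

Lemma gd_le s y : 0 < s -> gd s y <= (s * Num.sqrt (pi *+ 2))^-1.
Proof.
move=> s0; rewrite /gd ler_piMr ?invr_ge0 ?mulr_ge0 ?sqrtr_ge0 ?(ltW s0)//.
rewrite expR_le1 mulNr oppr_le0 mulr_ge0 ?sqr_ge0// invr_ge0 mulr_ge0// sqr_ge0//.
Qed.

Lemma int_gd s x : 0 < s -> \int[mu]_y gd s (y - x) = 1.
Proof.
move=> s0; rewrite /Rintegral -[RHS]/(fine 1%:E) -(integral_normal_pdf x s).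
by congr fine; apply: eq_integral => y _; rewrite gdE.
Qed.

Lemma intble_gd s x : 0 < s -> intble (fun y => gd s (y - x)).
Proof.
move=> s0; have := integrable_normal_pdf x s; rewrite /intble.
by apply: eq_integrable => // y _; rewrite gdE.
Qed.

(** Quadratic growth is the natural class because the logarithm of a Gaussian mixture density grows
    like y^2. One class closed under the operations in use settles all integrability questions
    against Gaussian densities. *)
Definition qg g := measurable_fun setT g /\ exists C, forall y, `|g y| <= C * (1 + y ^+ 2).

Lemma ge1_sqr y : 1 <= 1 + y ^+ 2. Proof. by rewrite lerDl sqr_ge0. Qed.

Lemma qg_bounded g C : measurable_fun setT g -> (forall y, `|g y| <= C) -> qg g.
Proof.
move=> mg gC; split=> //; exists C => y; apply: (le_trans (gC y)).
by rewrite ler_peMr ?ge1_sqr// (le_trans _ (gC y)).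
Qed.

Lemma qg_cst c : qg (fun=> c).
Proof. exact: (@qg_bounded _ `|c|). Qed.

Lemma qgD f g : qg f -> qg g -> qg (fun y => f y + g y).
Proof.
move=> [mf [Cf hf]] [mg [Cg hg]]; split; first exact: measurable_funD.
exists (Cf + Cg) => y; rewrite mulrDl (le_trans (ler_normD _ _))// lerD//.
Qed.

Lemma qgM f g C : measurable_fun setT f -> (forall y, `|f y| <= C) -> qg g ->
  qg (fun y => f y * g y).
Proof.
move=> mf hf [mg [Cg hg]]; split; first exact: measurable_funM.
by exists (C * Cg) => y; rewrite normrM -mulrA ler_pM.
Qed.

Lemma qgZ c g : qg g -> qg (fun y => c * g y).
Proof. exact: (@qgM (fun=> c) _ `|c|). Qed.

Lemma qgN g : qg g -> qg (fun y => - g y).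
Proof. by move=> /(@qgZ (-1)); congr qg; apply/funext => y; rewrite mulN1r. Qed.

Lemma qgB f g : qg f -> qg g -> qg (fun y => f y - g y).
Proof. by move=> qf /qgN; exact: qgD. Qed.

Lemma qg_sqr : qg (fun y => y ^+ 2).
Proof.
split; first exact: measurable_funX.
by exists 1 => y; rewrite mul1r ger0_norm ?sqr_ge0// lerDr.
Qed.

Lemma qg_id : qg id.
Proof.
split; first exact: measurable_id.
by exists 1 => y; rewrite mul1r ler_norml; nra.
Qed.

Lemma qg_norm g : qg g -> qg (fun y => `|g y|).
Proof.
move=> [mg [C hg]]; split; first exact: measurableT_comp.
by exists C => y; rewrite normr_id.
Qed.

Lemma qg_shift c g : qg g -> qg (fun y => g (y + c)).
Proof.
move=> [mg [C hg]]; split.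
  by apply: measurableT_comp => //; exact: measurable_funD.
have C0 : 0 <= C.
  have := hg 0; rewrite expr0n addr0 mulr1; exact: le_trans.
exists (C * (2 + 2 * c ^+ 2)) => y; apply: (le_trans (hg _)).
rewrite -mulrA ler_wpM2l//; have := sqr_ge0 (y - c); have := sqr_ge0 (y * c); nra.
Qed.

Lemma qg_sum (I : Type) (r : seq I) (F : I -> R -> R) : (forall i, qg (F i)) ->
  qg (fun y => \sum_(i <- r) F i y).
Proof.
move=> h; elim: r => [|i r ih].
  have := qg_cst 0; congr qg; apply/funext => y; by rewrite big_nil.
have := qgD (h i) ih; congr qg; apply/funext => y; by rewrite big_cons.
Qed.

Lemma qg_indic (A : set R) g : measurable A -> qg g -> qg (fun y => \1_A y * g y).
Proof.
move=> mA; apply: (@qgM _ _ 1) => [|y]; first exact: measurable_indic.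
by rewrite indicE; case: (_ \in _); rewrite ?normr0 ?normr1.
Qed.

Lemma intble_qg s x g : 0 < s -> qg g -> intble (fun y => g y * gd s (y - x)).
Proof.
move=> s0 /(qg_shift x)[mg [C hC]].
suff : intble (fun y => g (y + x) * gd s y).
  move/(intble_shift (- x)); rewrite /intble; apply: eq_integrable => // y _ /=.
  by rewrite subrK.
have C0 : 0 <= C.
  have := hC 0; rewrite expr0n addr0 mulr1; exact: le_trans.
(* The dominating function is a Gaussian of twice the deviation; it leaves a factor
   [expR (- (3 * y ^+ 2 / (8 * s ^+ 2)))] to absorb the quadratic growth. *)
have s20 : 0 < 2 * s by rewrite mulr_gt0.
have := intble_gd 0 s20; rewrite /intble => hi.
set K := C * 2 * (1 + 4 * s ^+ 2).
have hK : mu.-integrable setT (fun y => K%:E * (EFin \o (fun y => gd (2 * s) (y - 0))) y)%E.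
  exact: integrableZl.
apply: le_integrable hK => //.
  apply/measurable_EFinP; apply: measurable_funM => //.
  by apply: continuous_measurable_fun; exact: gd_cont.
move=> y _; rewrite /= subr0 lee_fin [leRHS]ger0_norm; last first.
  by apply: mulr_ge0; [rewrite /K !mulr_ge0// addr_ge0// mulr_ge0// sqr_ge0|apply/ltW/gd_gt0].
rewrite normrM (gtr0_norm (gd_gt0 _ s0)).
apply: (le_trans (ler_wpM2r _ (hC y))); first exact/ltW/gd_gt0.
rewrite /K -!mulrA ler_wpM2l//.
(* (1+y^2) gd s y <= 2 (1+4s^2) gd (2s) y *)
rewrite /gd.
set E1 := expR _; set E2 := expR _.
have E20 : 0 < E2 by exact: expR_gt0.
have h : (1 + y ^+ 2) * E1 <= (1 + 4 * s ^+ 2) * E2.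
  have -> : E1 = E2 * expR (- (3 * y ^+ 2 / (8 * s ^+ 2))).
    by rewrite -expRD; congr expR; field; rewrite gt_eqF.
  rewrite mulrCA mulrC ler_wpM2r ?(ltW E20)//.
  rewrite expRN ler_pdivrMr ?expR_gt0//.
  have h1 := expR_ge1Dx (3 * y ^+ 2 / (8 * s ^+ 2)).
  have s2 : 0 < s ^+ 2 by rewrite exprn_gt0.
  apply: (@le_trans _ _ ((1 + 4 * s ^+ 2) * (1 + (3 * y ^+ 2 / (8 * s ^+ 2))))).
    rewrite -subr_ge0.
    have -> : (1 + 4 * s ^+ 2) * (1 + 3 * y ^+ 2 / (8 * s ^+ 2)) - (1 + y ^+ 2) =
       4 * s ^+ 2 + 3 * y ^+ 2 / (8 * s ^+ 2) + y ^+ 2 / 2 by field; rewrite gt_eqF.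
    have y2 := sqr_ge0 y.
    have h3 : 0 <= 3 * y ^+ 2 / (8 * s ^+ 2) by rewrite divr_ge0// mulr_ge0// ltW.
    lra.
  by rewrite ler_wpM2l// addr_ge0// mulr_ge0// ltW.
have hs : (2 * s * Num.sqrt (pi *+ 2))^-1 = 2^-1 * (s * Num.sqrt (pi *+ 2))^-1.
  by rewrite -mulrA invfM.
rewrite hs.
set k := (_ * Num.sqrt _)^-1.
have k0 : 0 < k by rewrite invr_gt0 mulr_gt0// sqrt2pi_gt0.
rewrite (_ : 2 * _ = k * ((1 + 4 * s ^+ 2) * E2)); last by field.
by rewrite mulrCA ler_wpM2l ?(ltW k0).
Qed.

End GaussBasics.

(** * Gaussian mixtures and their differential entropy *)

Section Mixture.
Variable R : realType.
Notation mu := (@lebesgue_measure R).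
Implicit Types (x y z c s C : R) (f g r : R -> R).

Definition E1 s x g : R := \int[mu]_y (g y * gd s (y - x)).

Lemma E1D s x f g : 0 < s -> qg f -> qg g ->
  E1 s x (fun y => f y + g y) = E1 s x f + E1 s x g.
Proof.
move=> s0 qf qG; rewrite /E1 -RintegralD//; first 1 last.
- exact: intble_qg.
- exact: intble_qg.
by apply: eq_Rintegral => y _; rewrite mulrDl.
Qed.

Lemma E1Z s x c g : 0 < s -> qg g -> E1 s x (fun y => c * g y) = c * E1 s x g.
Proof.
move=> s0 qG; rewrite /E1 -RintegralZl//; last exact: intble_qg.
by apply: eq_Rintegral => y _; rewrite mulrA.
Qed.

Lemma E1N s x g : 0 < s -> qg g -> E1 s x (fun y => - g y) = - E1 s x g.
Proof.
move=> s0 qG; rewrite -mulN1r -E1Z//; congr E1; apply/funext => y.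
by rewrite mulN1r.
Qed.

Lemma E1B s x f g : 0 < s -> qg f -> qg g ->
  E1 s x (fun y => f y - g y) = E1 s x f - E1 s x g.
Proof. by move=> s0 qf qG; rewrite E1D// ?E1N//; exact: qgN. Qed.

Lemma E1_cst s x c : 0 < s -> E1 s x (fun=> c) = c.
Proof.
move=> s0; rewrite /E1 RintegralZl//; last exact: intble_gd.
by rewrite int_gd// mulr1.
Qed.

Lemma le_E1 s x f g : 0 < s -> qg f -> qg g -> (forall y, f y <= g y) ->
  E1 s x f <= E1 s x g.
Proof.
move=> s0 qf qG fg; apply: le_Rintegral => //; [exact: intble_qg|exact: intble_qg|].
by move=> y _; rewrite ler_wpM2r//; exact/ltW/gd_gt0.
Qed.

Lemma E1_shift s x c g : 0 < s -> qg g -> E1 s (x + c) g = E1 s x (fun y => g (y + c)).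
Proof.
move=> s0 qG; rewrite /E1 -(int_shift c); last exact: intble_qg.
by apply: eq_Rintegral => y _; rewrite opprD addrACA subrr addr0.
Qed.

Lemma E1_ge0 s x g : 0 < s -> (forall y, 0 <= g y) -> 0 <= E1 s x g.
Proof. by move=> s0 g0; apply: Rintegral_ge0 => y _; rewrite mulr_ge0// ltW ?gd_gt0. Qed.

Lemma E1_sum (I : Type) (t : seq I) s x (F : I -> R -> R) : 0 < s -> (forall i, qg (F i)) ->
  E1 s x (fun y => \sum_(i <- t) F i y) = \sum_(i <- t) E1 s x (F i).
Proof.
move=> s0 h; elim: t => [|i t ih].
  rewrite big_nil -[RHS](E1_cst x 0 s0); congr E1; apply/funext => y.
  by rewrite big_nil.
rewrite big_cons -ih -E1D//; last exact: qg_sum.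
by congr E1; apply/funext => y; rewrite big_cons.
Qed.

Lemma E1_opp s g : 0 < s -> qg g -> E1 s 0 (fun y => g (- y)) = E1 s 0 g.
Proof.
move=> s0 qG; rewrite /E1 -[RHS]int_opp; last exact: intble_qg.
by apply: eq_Rintegral => y _; rewrite !subr0 gdN.
Qed.

Lemma E1_id s : 0 < s -> E1 s 0 id = 0.
Proof.
move=> s0; have := E1_opp s0 (qg_id R); rewrite [LHS](E1N 0 s0 (qg_id R)); lra.
Qed.

Section Mix.
Variables (I : finType) (s : R).
Hypotheses (I0 : (0 < #|I|)%N) (s0 : 0 < s).
Implicit Types xc : I -> R.

Definition pm xc y : R := avg (fun i => gd s (y - xc i)).
Definition Emix xc g : R := avg (fun i => E1 s (xc i) g).
(* The differential entropy, in nats, of the Gaussian mixture density [pm xc]. *)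
Definition hh xc : R := - Emix xc (fun y => ln (pm xc y)).

Lemma pm_gt0 xc y : 0 < pm xc y.
Proof. by apply: avg_gt0 => // i; exact: gd_gt0. Qed.

Lemma pm_cont xc : continuous (pm xc).
Proof.
move=> y; apply: cvgM; first exact: cvg_cst.
have h i : {for y, continuous (fun y => gd s (y - xc i))}.
  apply: (continuous_comp (f := fun y => y - xc i)); last exact: gd_cont.
  by move=> ?; apply: (@cvgB _ R^o); [exact: cvg_id|exact: cvg_cst].
elim: (index_enum I) => [|i t ih].
  by under eq_fun do rewrite big_nil; rewrite big_nil; exact: cvg_cst.
under eq_fun do rewrite big_cons; rewrite big_cons; apply: (@cvgD _ R^o) => //; exact: h.
Qed.

Lemma pm_meas xc : measurable_fun setT (pm xc).
Proof. apply: continuous_measurable_fun; exact: pm_cont. Qed.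

Lemma EmixD xc f g : qg f -> qg g -> Emix xc (fun y => f y + g y) = Emix xc f + Emix xc g.
Proof. by move=> qf qG; rewrite /Emix -avgD; apply: eq_avg => i; rewrite E1D. Qed.

Lemma EmixZ xc c g : qg g -> Emix xc (fun y => c * g y) = c * Emix xc g.
Proof. by move=> qG; rewrite /Emix -avgZ; apply: eq_avg => i; rewrite E1Z. Qed.

Lemma EmixN xc g : qg g -> Emix xc (fun y => - g y) = - Emix xc g.
Proof. by move=> qG; rewrite /Emix -avgN; apply: eq_avg => i; rewrite E1N. Qed.

Lemma EmixB xc f g : qg f -> qg g -> Emix xc (fun y => f y - g y) = Emix xc f - Emix xc g.
Proof. by move=> qf qG; rewrite EmixD// ?EmixN//; exact: qgN. Qed.

Lemma Emix_cst xc c : Emix xc (fun=> c) = c.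
Proof.
rewrite /Emix (eq_avg (G := fun=> c)) ?avg_cst// => i; exact: E1_cst.
Qed.

Lemma le_EM xc f g : qg f -> qg g -> (forall y, f y <= g y) -> Emix xc f <= Emix xc g.
Proof. by move=> qf qG fg; apply: le_avg => i; exact: le_E1. Qed.

Lemma Emix_shift xc c g : qg g ->
  Emix (fun i => xc i + c) g = Emix xc (fun y => g (y + c)).
Proof. by move=> qG; apply: eq_avg => i; exact: E1_shift. Qed.

Lemma intble_pm xc g : qg g -> intble (fun y => g y * pm xc y).
Proof.
move=> qG.
have h : intble (fun y => \sum_(i : I) (g y * gd s (y - xc i))).
  rewrite /intble; under [X in _.-integrable _ X]eq_fun do rewrite /= -sumEFin.
  by apply: integrable_sum => // i _; exact: intble_qg.
have := integrableZl measurableT (#|I|%:R^-1) h; rewrite /intble.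
apply: eq_integrable => // y _; rewrite /= -EFinM /pm /avg -mulr_sumr.
by rewrite mulrCA.
Qed.

Lemma Emix_int xc g : qg g -> Emix xc g = \int[mu]_y (g y * pm xc y).
Proof.
move=> qG.
have h (t : seq I) : intble (fun y => \sum_(i <- t) (g y * gd s (y - xc i))).
  rewrite /intble; under [X in _.-integrable _ X]eq_fun do rewrite /= -sumEFin.
  by apply: integrable_sum => // i _; exact: intble_qg.
have -> : \int[mu]_y (g y * pm xc y) =
    \int[mu]_y (#|I|%:R^-1 * \sum_(i : I) (g y * gd s (y - xc i))).
  by apply: eq_Rintegral => y _; rewrite -mulr_sumr mulrCA.
rewrite RintegralZl//; last exact: h.
congr (_ * _); elim: (index_enum I) => [|i t ih].
  rewrite big_nil; symmetry; transitivity (\int[mu]_y (0 : R)); first by apply: eq_Rintegral => y _; rewrite big_nil.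
  by rewrite Rintegral_cst// mul0r.
rewrite big_cons ih -RintegralD//; [|exact: intble_qg|exact: h].
by apply: eq_Rintegral => y _; rewrite big_cons.
Qed.

Lemma intble_pm1 xc : intble (pm xc).
Proof.
have := intble_pm xc (qg_cst 1); rewrite /intble.
by apply: eq_integrable => // y _; rewrite /= mul1r.
Qed.

Lemma int_pm xc : \int[mu]_y pm xc y = 1.
Proof.
rewrite -[RHS](Emix_cst xc 1) Emix_int; last exact: qg_cst.
by apply: eq_Rintegral => y _; rewrite mul1r.
Qed.

Lemma pm_shift xc c y : pm (fun i => xc i + c) y = pm xc (y - c).
Proof. by apply: eq_avg => i; rewrite opprD addrA addrAC. Qed.

(** The slope of the log-density at y is at most (|y| + B) / s^2 for every centre in [-B, B].
    Uniformity over the centres carries the bound to mixtures with any number of components. It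
    later controls growth, Lipschitz constants and the oscillation within a quantizer cell. *)
Lemma gd_ratio x y (d B : R) : `|x| <= B ->
  gd s (y + d - x) <= expR ((`|y| + B + `|d|) * `|d| / s ^+ 2) * gd s (y - x).
Proof.
move=> xB; rewrite /gd [leRHS]mulrCA; apply: ler_wpM2l.
  by rewrite invr_ge0 mulr_ge0 ?sqrtr_ge0 ?ltW.
rewrite -expRD ler_expR -subr_ge0.
have s2 : 0 < s ^+ 2 by rewrite exprn_gt0.
rewrite (_ : _ - _ = ((`|y| + B + `|d|) * `|d| + (y - x) * d + d ^+ 2 / 2) / s ^+ 2); last first.
  by field; rewrite gt_eqF.
rewrite divr_ge0 ?(ltW s2)//.
have h1 : - (`|y - x| * `|d|) <= (y - x) * d by rewrite -normrM lerNl -normrN ler_norm.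
have h2 : `|y - x| <= `|y| + B by rewrite (le_trans (ler_normB _ _))// lerD2l.
have h3 : `|y - x| * `|d| <= (`|y| + B) * `|d| by rewrite ler_wpM2r.
have h4 := sqr_ge0 d; have h5 := sqr_ge0 `|d|.
nra.
Qed.

Lemma pm_ratio xc y (d B : R) : (forall i, `|xc i| <= B) ->
  pm xc (y + d) <= expR ((`|y| + B + `|d|) * `|d| / s ^+ 2) * pm xc y.
Proof. by move=> xB; rewrite /pm -avgZ; apply: le_avg => i; exact: gd_ratio. Qed.

Lemma lnpm_diff xc y (d B : R) : (forall i, `|xc i| <= B) ->
  ln (pm xc (y + d)) - ln (pm xc y) <= (`|y| + B + `|d|) * `|d| / s ^+ 2.
Proof.
move=> xB; rewrite lerBlDr -ler_expR expRD !lnK ?posrE ?pm_gt0//.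
exact: pm_ratio.
Qed.

(** [lnpm_diff] from 0 to y bounds the logarithm above, and from y back to 0 below. *)
Lemma qg_lnpm xc : qg (fun y => ln (pm xc y)).
Proof.
split; first by apply: measurableT_comp; [exact: measurable_ln|exact: pm_meas].
pose B : R := \sum_i `|xc i|.
have xB i : `|xc i| <= B by rewrite /B (bigD1 i)//= lerDl sumr_ge0.
pose K : R := `|ln (pm xc 0)|.
exists (K + (B + 3) / s ^+ 2) => y.
have s2 : 0 < s ^+ 2 by rewrite exprn_gt0.
have B0 : 0 <= B by rewrite sumr_ge0.
have h1 := lnpm_diff 0 y xB; have h2 := lnpm_diff y (- y) xB.
rewrite subrr in h2; rewrite add0r in h1.
rewrite normr0 add0r in h1; rewrite normrN in h2.
have y2 : `|y| ^+ 2 = y ^+ 2 by rewrite real_normK ?num_real.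
have y0 := normr_ge0 y.
have hB : 0 <= B * (1 + y ^+ 2 - `|y|) by apply: mulr_ge0 => //; nra.
have e1 : (B + `|y|) * `|y| / s ^+ 2 <= (B + 3) / s ^+ 2 * (1 + y ^+ 2).
  rewrite [leRHS]mulrAC; apply: ler_wpM2r; [by rewrite invr_ge0 ltW|nra].
have e2 : (`|y| + B + `|y|) * `|y| / s ^+ 2 <= (B + 3) / s ^+ 2 * (1 + y ^+ 2).
  rewrite [leRHS]mulrAC; apply: ler_wpM2r; [by rewrite invr_ge0 ltW|nra].
have hK : ln (pm xc 0) <= K by exact: ler_norm.
have hK' : - K <= ln (pm xc 0) by rewrite lerNl /K -normrN ler_norm.
have K0 : 0 <= K by exact: normr_ge0.
have hKy : 0 <= K * y ^+ 2 by rewrite mulr_ge0 ?sqr_ge0.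
rewrite ler_norml; apply/andP; split; rewrite mulrDl; lra.
Qed.

Lemma hh_shift xc c : hh (fun i => xc i + c) = hh xc.
Proof.
rewrite /hh Emix_shift; last exact: qg_lnpm.
by congr (- Emix _ _); apply/funext => y; rewrite pm_shift addrK.
Qed.

(** Integrate ln t <= t - 1 at t = r / [pm] against the mixture density. *)
Lemma gibbs xc r : (forall y, 0 < r y) -> qg (fun y => ln (r y)) ->
  intble r -> \int[mu]_y r y <= 1 ->
  Emix xc (fun y => ln (r y)) <= - hh xc.
Proof.
move=> r0 qr ir ir1; rewrite opprK -subr_le0 -EmixB//; last exact: qg_lnpm.
have qd : qg (fun y => ln (r y) - ln (pm xc y)) by apply: qgB => //; exact: qg_lnpm.
rewrite Emix_int//.
apply: (@le_trans _ _ (\int[mu]_y (r y - pm xc y))).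
  apply: le_Rintegral => //; first exact: intble_pm.
    have := integrableB measurableT ir (intble_pm1 xc); rewrite /intble.
    by apply: eq_integrable => // y _; rewrite /= EFinB.
  move=> y _; have p0 := pm_gt0 xc y.
  rewrite -ln_div ?posrE// -ler_pdivlMr//.
  have := le_ln1Dx (x := r y / pm xc y - 1).
  rewrite [1 + _]addrC subrK mulrBl divff ?gt_eqF//; apply.
  by rewrite ltrBrDl subrr divr_gt0.
rewrite RintegralB//; last exact: intble_pm1.
by rewrite int_pm subr_le0.
Qed.

End Mix.
End Mixture.

(** * An entropy power inequality *)

Section Tools.
Variable R : realType.
Notation mu := (@lebesgue_measure R).
Implicit Types (x y z c s C : R) (f g r : R -> R).

(** The minorant is signed and integrable, while D is nonnegative and may have infinite integral.
    This permits comparing with an inner integral of D before Tonelli has shown that the double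
    integral is finite. *)
Lemma le_int_ge0 f (D : R -> \bar R) : intble f -> measurable_fun [set: R] D ->
  (forall y, (0 <= D y)%E) -> (forall y, ((f y)%:E <= D y)%E) ->
  ((\int[mu]_y f y)%:E <= \int[mu]_y D y)%E.
Proof.
move=> fi mD D0 fD; rewrite /Rintegral fineK; last exact: integrable_fin_num.
have fp := integrable_funepos measurableT fi.
apply: (@le_trans _ _ (\int[mu]_y (EFin \o f)^\+ y)%E).
  apply: le_integral => // y _; rewrite funeposE le_max lexx//.
apply: ge0_le_integral => //.
- exact: (measurable_int mu fp).
- by move=> y _; rewrite funeposE ge_max D0 fD.
Qed.

Lemma symitv_bigcup : \bigcup_n `[- n%:R, n%:R]%classic = [set: R].
Proof.
apply/seteqP; split => // x _.
have [n xn] : exists n : nat, `|x| <= n%:R.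
  by exists (Num.truncn `|x|).+1; rewrite ltW// truncnS_gt.
by exists n => //=; rewrite in_itv /= -ler_norml.
Qed.

Section Primitive.
Variables u U : R -> R.
Hypotheses (uc : continuous u) (u0 : forall y, 0 <= u y)
  (dU : forall y, is_derive y 1 U (u y)).

Lemma int_symitv (n : nat) : (\int[mu]_(y in `[(- n%:R)%R, n%:R%R]) (u y)%:E = (U n%:R - U (- n%:R))%:E)%E.
Proof.
case: n => [|n].
  by rewrite oppr0 set_itv1 integral_set1 subrr.
have Uc : continuous U.
  move=> y; apply/differentiable_continuous/derivable1_diffP.
  by have [] := dU y.
rewrite (continuous_FTC2 (F := U))//.
- by rewrite gtrN.
- exact: continuous_subspaceT.
- split=> [y _||].
  + by have [] := dU y.
  + by apply: cvg_at_right_filter; exact: Uc.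
  + by apply: cvg_at_left_filter; exact: Uc.
- by move=> y _; rewrite derive1E; have [] := dU y.
Qed.

(** Monotone convergence along [-n, n], with the fundamental theorem on each interval; the behaviour
    of the primitive at infinity need not be known beforehand. *)
Lemma cvg_symitv : (U n%:R - U (- n%:R))%:E @[n --> \oo] --> (\int[mu]_y (u y)%:E)%E.
Proof.
rewrite -symitv_bigcup; under eq_fun do rewrite -int_symitv.
apply: ge0_nondecreasing_set_cvg_integral => //.
- apply/nondecreasing_seqP => n; apply/subsetPset => y /=.
  rewrite !in_itv /= => /andP[h1 h2]; rewrite (le_trans _ h1) ?(le_trans h2)//.
    by rewrite ler_nat.
  by rewrite lerN2 ler_nat.
- move=> n; apply/measurable_EFinP; apply: measurable_funTS.
  exact: continuous_measurable_fun.
- by move=> n y _; rewrite lee_fin.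
Qed.

Lemma primitive_int_le M : (forall x y, U y - U x <= M) -> (\int[mu]_y (u y)%:E <= M%:E)%E.
Proof.
move=> UM; apply: (cvge_le _ cvg_symitv); last by apply: nearW => n; rewrite lee_fin.
Qed.

Lemma primitive_int_ge (l : R) : U n%:R - U (- n%:R) @[n --> \oo] --> l ->
  (\int[mu]_y (u y)%:E = l%:E)%E.
Proof.
move=> h; apply: (cvg_unique _ cvg_symitv) => //.
by apply: cvg_EFin => //; exact: nearW.
Qed.

End Primitive.

Definition cdf1 f y := \int[mu]_(t in `]-oo, y]) f t.

Section Cdf.
Variable p : R -> R.
Hypotheses (pc : continuous p) (p0 : forall y, 0 < p y) (pi : intble p)
  (p1 : \int[mu]_y p y = 1).

Lemma cdf1_derive y : is_derive y 1 (cdf1 p) (p y).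
Proof.
have yy : y < y + 1 by rewrite ltrDl.
have [] := @continuous_FTC1 R p -oo%O y (y + 1) yy.
- exact: (integrableS measurableT _ _ pi).
- by rewrite ltNyr.
- exact: pc.
move=> h1 h2; split; first exact: h1.
by rewrite -derive1E; exact: h2.
Qed.

Lemma cdf1_cont : continuous (cdf1 p).
Proof.
move=> y; apply/differentiable_continuous/derivable1_diffP.
by have [] := cdf1_derive y.
Qed.

Lemma cdf1_ge0 y : 0 <= cdf1 p y.
Proof. by apply: Rintegral_ge0 => t _; exact: ltW. Qed.

Lemma cdf1_lt x y : x < y -> cdf1 p x < cdf1 p y.
Proof.
move=> xy; have [|c _ h] := @MVT R (cdf1 p) p x y xy (fun z _ => cdf1_derive z).
  exact: (continuous_subspaceT cdf1_cont).
by rewrite -subr_gt0 h mulr_gt0// subr_gt0.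
Qed.

Lemma cdf1C y : 1 - cdf1 p y = \int[mu]_(t in `]y, +oo[) p t.
Proof. by rewrite -p1 -(Rintegral_itvB (a := -oo%O) (b := +oo%O)) ?set_itvNyy. Qed.

Lemma cdf1_le1 y : cdf1 p y <= 1.
Proof. by rewrite -subr_ge0 cdf1C; apply: Rintegral_ge0 => t _; exact: ltW. Qed.

Lemma cdf1_gt0 y : 0 < cdf1 p y.
Proof. by apply: (le_lt_trans (cdf1_ge0 (y - 1))); apply: cdf1_lt; rewrite ltrBlDr ltrDl. Qed.

Lemma cdf1_lt1 y : cdf1 p y < 1.
Proof. by apply: (lt_le_trans _ (cdf1_le1 (y + 1))); apply: cdf1_lt; rewrite ltrDl. Qed.

Lemma p1E : (\int[mu]_t (p t)%:E = 1%:E)%E.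
Proof. by rewrite -p1 fineK//; exact: integrable_fin_num. Qed.

Lemma cdf1_cvgy : cdf1 p n%:R @[n --> \oo] --> (1 : R).
Proof.
have h : (\int[mu]_(t in `]-oo, n%:R%R]) (p t)%:E)%E @[n --> \oo] --> (\int[mu]_t (p t)%:E)%E.
  rewrite (_ : [set: R] = \bigcup_n (`]-oo, n%:R])%classic); last first.
    apply/seteqP; split => // x _; exists (Num.truncn x).+1 => //=.
    by rewrite in_itv /= ltW// truncnS_gt.
  apply: ge0_nondecreasing_set_cvg_integral => //.
  - apply/nondecreasing_seqP => n; apply/subsetPset => y /=.
    by rewrite !in_itv /= => /le_trans; apply; rewrite ler_nat.
  - move=> n; apply/measurable_EFinP; apply: measurable_funTS.
    exact: continuous_measurable_fun.
  - by move=> n y _; rewrite lee_fin ltW.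
by move: h; rewrite p1E => /fine_cvgP[].
Qed.

Lemma cdf1_cvgNy : cdf1 p (- n%:R) @[n --> \oo] --> (0 : R).
Proof.
have h : (\int[mu]_(t in `](- n%:R)%R, +oo[) (p t)%:E)%E @[n --> \oo] --> (\int[mu]_t (p t)%:E)%E.
  rewrite (_ : [set: R] = \bigcup_n (`]- n%:R, +oo[)%classic); last first.
    apply/seteqP; split => // x _; exists (Num.truncn (- x)).+1 => //=.
    by rewrite in_itv /= andbT ltrNl truncnS_gt.
  apply: ge0_nondecreasing_set_cvg_integral => //.
  - apply/nondecreasing_seqP => n; apply/subsetPset => y /=.
    by rewrite !in_itv /= !andbT; apply: le_lt_trans; rewrite lerN2 ler_nat.
  - move=> n; apply/measurable_EFinP; apply: measurable_funTS.
    exact: continuous_measurable_fun.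
  - by move=> n y _; rewrite lee_fin ltW.
have h2 : 1 - cdf1 p (- n%:R) @[n --> \oo] --> (1 : R).
  under eq_fun do rewrite cdf1C.
  by move: h; rewrite p1E => /fine_cvgP[].
have : (1 - (1 - cdf1 p (- n%:R))) @[n --> \oo] --> (1 - 1 : R).
  by apply: (@cvgB _ R^o); [exact: cvg_cst|exact: h2].
by under eq_fun do rewrite subKr; rewrite subrr.
Qed.

End Cdf.

Lemma lnM2 (u v : R) : 0 < u -> 0 < v -> ln (u * v) = ln u + ln v.
Proof. by move=> u0 v0; rewrite lnM ?posrE. Qed.

Lemma lndiv2 (u v : R) : 0 < u -> 0 < v -> ln (u / v) = ln u - ln v.
Proof. by move=> u0 v0; rewrite ln_div ?posrE. Qed.

Lemma ln_concave (c d u v : R) : 0 < u -> 0 < v -> 0 <= c -> 0 <= d -> c + d = 1 ->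
  c * ln u + d * ln v <= ln (c * u + d * v).
Proof.
move=> u0 v0 c0 d0 cd; set m := c * u + d * v.
have m0 : 0 < m.
  move: c0; rewrite le_eqVlt => /orP[/eqP c0|c0].
    by rewrite /m -c0 mul0r add0r; move: cd; rewrite -c0 add0r => ->; rewrite mul1r.
  by rewrite ltr_pwDl ?mulr_gt0// mulr_ge0// ltW.
have key w : 0 < w -> ln w - ln m <= w / m - 1.
  move=> w0; rewrite -ln_div ?posrE//.
  have := le_ln1Dx (x := w / m - 1); rewrite [1 + _]addrC subrK; apply.
  by rewrite ltrBrDl subrr divr_gt0.
have h1 := ler_wpM2l c0 (key u u0); have h2 := ler_wpM2l d0 (key v v0).
have h3 : c * (u / m - 1) + d * (v / m - 1) = 0.
  rewrite (_ : _ + _ = m / m - (c + d)); last by rewrite /m; field; rewrite gt_eqF.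
  by rewrite divff ?gt_eqF// cd subrr.
have h4 : ln m = c * ln m + d * ln m by rewrite -mulrDl cd mul1r.
rewrite h4; lra.
Qed.

End Tools.

Section EpiCore.
Variable R : realType.
Notation mu := (@lebesgue_measure R).
Variables (sg : R) (I J : finType) (xc : I -> R) (yc : J -> R) (B : R).
Hypotheses (sg0 : 0 < sg) (I0 : (0 < #|I|)%N) (J0 : (0 < #|J|)%N).
Hypothesis xcB : forall i, 0 <= xc i <= B.
Implicit Types (x y z a w : R).

Notation gam := (gd sg).
Notation Phi := (cdf1 (gd sg)).
Notation p := (pm sg xc).
Notation F := (cdf1 (pm sg xc)).

Lemma intble_gam : intble gam.
Proof.
have := intble_gd 0 sg0; rewrite /intble; apply: eq_integrable => // y _ /=.
by rewrite subr0.
Qed.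

Lemma int_gam : \int[mu]_y gam y = 1.
Proof.
by rewrite -[RHS](int_gd 0 sg0); apply: eq_Rintegral => y _; rewrite subr0.
Qed.

Lemma Phi_derive y : is_derive y 1 Phi (gam y).
Proof. exact: (cdf1_derive (@gd_cont _ _) intble_gam). Qed.

Lemma Phi_lt x y : x < y -> Phi x < Phi y.
Proof. exact: (cdf1_lt (@gd_cont _ _) (fun y => gd_gt0 y sg0) intble_gam). Qed.

Lemma Phi_le x y : x <= y -> Phi x <= Phi y.
Proof. by rewrite le_eqVlt => /orP[/eqP->//|/Phi_lt/ltW]. Qed.

Lemma Phi_cont : continuous Phi.
Proof. exact: (cdf1_cont (@gd_cont _ _) intble_gam). Qed.

Lemma Phi01 y : 0 < Phi y < 1.
Proof.
apply/andP; split.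
  exact: (cdf1_gt0 (@gd_cont _ _) (fun y => gd_gt0 y sg0) intble_gam).
exact: (cdf1_lt1 (@gd_cont _ _) (fun y => gd_gt0 y sg0) intble_gam int_gam).
Qed.

Lemma F_derive y : is_derive y 1 F (p y).
Proof. exact: (cdf1_derive (@pm_cont _ _ _ _) (intble_pm1 sg0 _)). Qed.

Lemma F_cont : continuous F.
Proof. exact: (cdf1_cont (@pm_cont _ _ _ _) (intble_pm1 sg0 _)). Qed.

Lemma Phi_shift x y : Phi (y - x) = \int[mu]_(t in `]-oo, y]) gd sg (t - x).
Proof.
rewrite /cdf1 [LHS]Rintegral_mkcond [RHS]Rintegral_mkcond.
rewrite -(int_shift (- x)); last first.
  have := intble_gam; rewrite /intble => h.
  rewrite -restrict_EFin; apply: (iffLR (integrable_mkcond _ _)) => //.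
  exact: (integrableS measurableT _ _ h).
apply: eq_Rintegral => t _; rewrite !patchE.
rewrite (_ : (t - x \in `]-oo, y - x]%classic) = (t \in `]-oo, y]%classic))//.
by apply/idP/idP; rewrite !inE /= !in_itv /= lerD2r.
Qed.

Lemma F_avg y : F y = avg (fun i => Phi (y - xc i)).
Proof.
rewrite /cdf1 /pm.
have hi i : mu.-integrable `]-oo, y] (EFin \o (fun t => gd sg (t - xc i))).
  exact: (integrableS measurableT _ _ (intble_gd (xc i) sg0)).
have hs (t : seq I) : mu.-integrable `]-oo, y] (EFin \o (fun z => \sum_(i <- t) gd sg (z - xc i))).
  under [X in _.-integrable _ X]eq_fun do rewrite /= -sumEFin.
  by apply: integrable_sum => // i _; exact: hi.
rewrite /avg (RintegralZl _ _ (hs (index_enum I)))//.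
congr (_ * _); elim: (index_enum I) => [|i t ih].
  rewrite big_nil; transitivity (\int[mu]_(z in `]-oo, y]) (0 : R)).
    by apply: eq_Rintegral => z _; rewrite big_nil.
  by rewrite Rintegral_cst// mul0r.
rewrite big_cons -ih -[X in _ = X + _]/(Phi (y - xc i)) Phi_shift -RintegralD//.
by apply: eq_Rintegral => z _; rewrite big_cons.
Qed.

Lemma F_bounds y : Phi (y - B) <= F y <= Phi y.
Proof.
rewrite F_avg; apply/andP; split.
  rewrite -[leLHS](avg_cst _ I0); apply: le_avg => i; apply: Phi_le.
  by rewrite lerD2l lerN2; case/andP: (xcB i).
rewrite -[leRHS](avg_cst _ I0); apply: le_avg => i; apply: Phi_le.
by rewrite gerDl oppr_le0; case/andP: (xcB i).
Qed.

(** All centres lie in [0, B], so F is squeezed between Phi and its translate by B, and the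
    intermediate value theorem on [y - B, y] finds the point. The same bracket gives the linear
    growth of [beta]. *)
Lemma beta_ex y : exists b, Phi b = F y /\ y - B <= b <= y.
Proof.
have [h1 h2] := andP (F_bounds y).
have B0 : 0 <= B by have /card_gt0P[i _] := I0; case/andP: (xcB i); exact: le_trans.
have yB : y - B <= y by rewrite gerDl oppr_le0.
have [||b bi bE] := @IVT R Phi (y - B) y (F y) yB.
- exact: (continuous_subspaceT Phi_cont).
- by rewrite ge_min h1 le_max h2 orbT.
by exists b; split => //; move: bi; rewrite in_itv.
Qed.

(** The increasing transport of the mixture onto the centred Gaussian of deviation sg, that is, the
    inverse of Phi applied to F. *)
Definition beta y : R := proj1_sig (cid (beta_ex y)).

Lemma betaE y : Phi (beta y) = F y.
Proof. by rewrite /beta; case: cid => b /= []. Qed.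

Lemma beta_bd y : y - B <= beta y <= y.
Proof. by rewrite /beta; case: cid => b /= []. Qed.

Lemma beta_cont : continuous beta.
Proof.
move=> y; apply/cvgrPdist_lt => e e0.
have h1 : Phi (beta y - e) < F y by rewrite -betaE; apply: Phi_lt; rewrite ltrBlDr ltrDl.
have h2 : F y < Phi (beta y + e) by rewrite -betaE; apply: Phi_lt; rewrite ltrDl.
have n1 := cvgr_gt (F y) (@F_cont y) _ h1; have n2 := cvgr_lt (F y) (@F_cont y) _ h2.
near=> z.
have z1 : Phi (beta y - e) < F z by near: z; exact: n1.
have z2 : F z < Phi (beta y + e) by near: z; exact: n2.
have b1 : beta y - e < beta z.
  by rewrite ltNge; apply/negP => /Phi_le; rewrite betaE leNgt z1.
have b2 : beta z < beta y + e.
  by rewrite ltNge; apply/negP => /Phi_le; rewrite betaE leNgt z2.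
by rewrite ltr_distlC b1 b2.
Unshelve. all: by end_near. Qed.

Definition dbeta y : R := p y / gam (beta y).

Lemma dbeta_gt0 y : 0 < dbeta y.
Proof. by rewrite divr_gt0// ?gd_gt0 ?pm_gt0. Qed.

Lemma dbeta_cont : continuous dbeta.
Proof.
move=> y; apply: cvgM; first exact: pm_cont.
apply: cvgV; first by rewrite gt_eqF ?gd_gt0.
by apply: continuous_comp; [exact: beta_cont|exact: gd_cont].
Qed.

(** Differentiate [betaE] through Caratheodory slopes: the slope of F divided by the slope of Phi at
    [beta] is a continuous slope for [beta]. *)
Lemma beta_derive y : is_derive y 1 beta (dbeta y).
Proof.
have /is_derive1_caratheodory [hP [hPE hPc hPb]] := Phi_derive (beta y).
have /is_derive1_caratheodory [hF [hFE hFc hFy]] := F_derive y.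
(* Phi is strictly increasing, so its slope vanishes nowhere and may be divided by. *)
have hP0 z : hP z != 0.
  have [->|zb] := eqVneq z (beta y); first by rewrite hPb gt_eqF ?gd_gt0.
  apply/eqP => h; have := hPE z; rewrite h mul0r => /eqP; rewrite subr_eq0.
  by move: zb; rewrite neq_lt => /orP[]/Phi_lt; rewrite lt_neqAle => /andP[/negbTE + _]; rewrite ?[_ == Phi z]eq_sym => ->.
apply/is_derive1_caratheodory; exists (fun z => hF z / hP (beta z)); split.
- move=> z; have := hPE (beta z); rewrite !betaE hFE => h.
  by apply: (mulfI (hP0 (beta z))); rewrite -h; field.
- apply: cvgM; first exact: hFc.
  apply: cvgV => //; apply: continuous_comp; first exact: beta_cont.
  exact: hPc.
- by rewrite hFy hPb.
Qed.

Lemma beta_qg : qg beta.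
Proof.
split; first exact: continuous_measurable_fun beta_cont.
exists (B + 1) => y; have /andP[h1 h2] := beta_bd y.
have B0 : 0 <= B by have /card_gt0P[i _] := I0; case/andP: (xcB i); exact: le_trans.
have hB : 0 <= B * y ^+ 2 by rewrite mulr_ge0 ?sqr_ge0.
by rewrite ler_norml; apply/andP; split; nra.
Qed.

Section Transport.
Variables (T dT : R -> R) (Bt L l c d : R).
Hypotheses (TB : forall t : R, 0 < t < 1 -> 0 <= T t <= Bt)
  (dTd : forall t : R, 0 < t < 1 -> is_derive t 1 T (dT t))
  (dTc : forall t : R, 0 < t < 1 -> {for t, continuous dT})
  (dTl : forall t : R, 0 < t < 1 -> l <= dT t <= L) (l0 : 0 < l).
Hypotheses (c0 : 0 < c) (d0 : 0 < d) (cd1 : c ^+ 2 + d ^+ 2 = 1).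

(** For a Gaussian, [Phi a] is uniform, so [XX a] has quantile function T. The signal is thus driven
    by a and the mixture by [beta y], two independent Gaussians of equal variance, and c, d are the
    coefficients of a rotation of this pair. *)
Definition XX a : R := T (Phi a).
Definition dXX a : R := dT (Phi a) * gam a.

Lemma dT_gt0 a : 0 < dT (Phi a).
Proof. by have /andP[h _] := dTl (Phi01 a); exact: lt_le_trans h. Qed.

Lemma dXX_gt0 a : 0 < dXX a.
Proof. by rewrite mulr_gt0 ?dT_gt0 ?gd_gt0. Qed.

Lemma XX_derive a : is_derive a 1 XX (dXX a).
Proof.
have h := Phi_derive a; have h2 := dTd (Phi01 a).
exact: is_derive1_comp.
Qed.

Lemma XX_cont : continuous XX.
Proof.
move=> y; apply/differentiable_continuous/derivable1_diffP.
by have [] := XX_derive y.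
Qed.

Lemma dXX_cont : continuous dXX.
Proof.
move=> a; apply: cvgM; last exact: gd_cont.
by apply: (continuous_comp (f := Phi) (g := dT)); [exact: Phi_cont|exact: dTc (Phi01 a)].
Qed.

(* For fixed w the integrand is the a-derivative of - Phi (c * beta (w - XX a) - d * a), so it has
   integral at most one, whatever w. *)
Definition kk w a : R := gam (c * beta (w - XX a) - d * a) * (c * dbeta (w - XX a) * dXX a + d).

Lemma kk_gt0 w a : 0 < kk w a.
Proof.
by rewrite mulr_gt0 ?gd_gt0// ltr_wpDl// mulr_ge0 ?ltW ?dXX_gt0// mulr_gt0 ?dbeta_gt0.
Qed.

Lemma bb_derive w a :
  is_derive a 1 (fun a : R => c * beta (w - XX a) - d * a) (- (c * dbeta (w - XX a) * dXX a + d)).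
Proof.
have hX := XX_derive a.
have h1 : is_derive a 1 (fun a : R => w - XX a) (- dXX a).
  have -> : (fun a : R => w - XX a) = cst w - XX by [].
  by apply: is_derive_eq; rewrite sub0r.
have h2 := beta_derive (w - XX a).
have h3 : is_derive a 1 (beta \o (fun a : R => w - XX a)) (dbeta (w - XX a) * (- dXX a)).
  exact: is_derive1_comp.
have -> : (fun a : R => c * beta (w - XX a) - d * a) =
    c *: (beta \o (fun a : R => w - XX a)) - d *: id by [].
by apply: is_derive_eq; rewrite /GRing.scale /=; ring.
Qed.

Lemma bb_cont w : continuous (fun a : R => c * beta (w - XX a) - d * a).
Proof.
move=> y; apply/differentiable_continuous/derivable1_diffP.
by have [] := bb_derive w y.
Qed.

Lemma wX_cont w : continuous (fun a : R => w - XX a).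
Proof. by move=> y; apply: (@cvgB _ R^o); [exact: cvg_cst|exact: XX_cont]. Qed.

Lemma kk_cont w : continuous (kk w).
Proof.
move=> a; apply: cvgM.
  apply: (continuous_comp (f := fun a : R => c * beta (w - XX a) - d * a) (g := gam)); [exact: bb_cont|exact: gd_cont].
apply: (@cvgD _ R^o); last exact: cvg_cst.
apply: cvgM; last exact: dXX_cont.
apply: cvgM; first exact: cvg_cst.
by apply: (continuous_comp (f := fun a => w - XX a)); [exact: wX_cont|exact: dbeta_cont].
Qed.

Lemma kk_int w : (\int[mu]_a (kk w a)%:E <= 1)%E.
Proof.
apply: (@primitive_int_le _ (kk w) (fun a : R => - Phi (c * beta (w - XX a) - d * a))).
- exact: kk_cont.
- by move=> a; apply/ltW/kk_gt0.
- move=> a.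
  have h1 := bb_derive w a; have h2 := Phi_derive (c * beta (w - XX a) - d * a).
  have h3 : is_derive a 1 (Phi \o (fun a : R => c * beta (w - XX a) - d * a))
      (gam (c * beta (w - XX a) - d * a) * (- (c * dbeta (w - XX a) * dXX a + d))).
    exact: is_derive1_comp.
  have -> : (fun a : R => - Phi (c * beta (w - XX a) - d * a)) =
    - (Phi \o (fun a : R => c * beta (w - XX a) - d * a)) by [].
  by apply: is_derive_eq; rewrite /kk; ring.
- move=> x y; have /andP[h1 h2] := Phi01 (c * beta (w - XX x) - d * x).
  have /andP[h3 h4] := Phi01 (c * beta (w - XX y) - d * y); lra.
Qed.

Notation rr := (pm sg yc).

(** The product density of rr in the coordinate w = [XX a + y] and of a Gaussian in the rotated
    coordinate [c * beta y - d * a], pulled back to (a, y). The factor [c * dbeta y * dXX a + d] is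
    the Jacobian determinant of that change of coordinates. *)
Definition DD a y : R := rr (XX a + y) * kk (XX a + y) a.

Lemma DDE a y : DD a y = rr (XX a + y) * gam (c * beta y - d * a) * (c * dbeta y * dXX a + d).
Proof. by rewrite /DD /kk [XX a + y]addrC addrK mulrA. Qed.

Lemma DD_gt0 a y : 0 < DD a y.
Proof. by rewrite mulr_gt0 ?kk_gt0 ?pm_gt0. Qed.

Lemma DD_meas : measurable_fun [set: R * R] (fun z : R * R => DD z.1 z.2).
Proof.
have mX : measurable_fun [set: R * R] (fun z : R * R => XX z.1).
  by apply: measurableT_comp => //; exact: continuous_measurable_fun XX_cont.
have mdX : measurable_fun [set: R * R] (fun z : R * R => dXX z.1).
  by apply: measurableT_comp => //; exact: continuous_measurable_fun dXX_cont.
have mb : measurable_fun [set: R * R] (fun z : R * R => beta z.2).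
  by apply: measurableT_comp => //; exact: continuous_measurable_fun beta_cont.
have mdb : measurable_fun [set: R * R] (fun z : R * R => dbeta z.2).
  by apply: measurableT_comp => //; exact: continuous_measurable_fun dbeta_cont.
rewrite (_ : (fun z : R * R => DD z.1 z.2) = fun z : R * R => rr (XX z.1 + z.2) *
  gam (c * beta z.2 - d * z.1) * (c * dbeta z.2 * dXX z.1 + d)); last first.
  by apply/funext => z; rewrite DDE.
apply: measurable_funM; last first.
  apply: measurable_funD => //; apply: measurable_funM => //.
  exact: measurable_funM.
apply: measurable_funM.
  apply: measurableT_comp; first exact: pm_meas.
  exact: measurable_funD.
apply: measurableT_comp; first exact: continuous_measurable_fun (@gd_cont _ _).
by apply: measurable_funB; exact: measurable_funM.
Qed.

Lemma DD_meas2 a : measurable_fun [set: R] (DD a).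
Proof.
have := measurableT_comp DD_meas (measurable_pair1 a) .
exact.
Qed.

(** Tonelli after the shear y = w - [XX a]: for each w the integral over a is at most one, and rr
    has mass one. *)
Lemma DD_int : (\int[mu]_a \int[mu]_y (DD a y)%:E <= 1)%E.
Proof.
have mS : measurable_fun [set: R * R] (fun z : R * R => (z.1, z.2 - XX z.1)).
  apply/measurable_fun_pair => //; apply: measurable_funB => //.
  by apply: measurableT_comp => //; exact: continuous_measurable_fun XX_cont.
have mG : measurable_fun [set: R * R] (fun z : R * R => (DD z.1 (z.2 - XX z.1))%:E).
  apply/measurable_EFinP.
  exact: (measurableT_comp DD_meas mS).
rewrite (_ : (\int[mu]_a \int[mu]_y (DD a y)%:E)%E =
   (\int[mu]_a \int[mu]_w (DD a (w - XX a))%:E)%E); last first.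
  apply: eq_integral => a _.
  rewrite -(ge0_int_shift (- XX a) (f := fun y => (DD a y)%:E))//.
    by apply/measurable_EFinP; exact: DD_meas2.
  by move=> y; rewrite lee_fin ltW// DD_gt0.
have pG (z : R * R) : (0 <= (DD z.1 (z.2 - XX z.1))%:E)%E by rewrite lee_fin ltW// DD_gt0.
have fub := @fubini_tonelli _ _ _ _ _ mu mu _ mG pG.
rewrite /= in fub; rewrite fub {fub}.
rewrite (_ : 1%E = (\int[mu]_w (rr w)%:E)%E); last first.
  rewrite -[LHS]/(1%:E) -(int_pm J0 sg0 yc) fineK//.
  exact: (integrable_fin_num _ (intble_pm1 sg0 yc)).
apply: ge0_le_integral => //.
- by move=> w _; apply: integral_ge0 => a _; rewrite lee_fin ltW// DD_gt0.
- exact: (@measurable_fun_fubini_tonelli_G _ _ _ _ _ mu _ mG pG).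
- by apply/measurable_EFinP; exact: pm_meas.
move=> w _ /=.
rewrite (_ : (\int[mu]_x (DD x (w - XX x))%:E)%E = ((rr w)%:E * \int[mu]_a (kk w a)%:E)%E).
  rewrite -[leRHS]mule1; apply: lee_wpmul2l; last exact: kk_int.
  by rewrite lee_fin ltW// pm_gt0.
transitivity (\int[mu]_a ((rr w)%:E * (kk w a)%:E))%E.
  by apply: eq_integral => a _; rewrite /DD addrCA subrr addr0 EFinM.
apply: ge0_integralZl_EFin => //.
- by move=> a _; rewrite lee_fin ltW// kk_gt0.
- by apply/measurable_EFinP; exact: continuous_measurable_fun (@kk_cont w).
- by rewrite ltW// pm_gt0.
Qed.

Definition LL a y : R := ln (rr (XX a + y)) - d ^+ 2 * ln (p y) + c ^+ 2 * ln (dT (Phi a))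
  - c ^+ 2 * ln c - d ^+ 2 * ln d + c * d * a * beta y / sg ^+ 2.

(* Writing 1 + ln t <= t and using concavity of ln on the Jacobian factor turns the bound on the mass
   of DD into a linear inequality between expected logarithms; the cross term in a * beta y of the two
   Gaussian exponents averages out since a has mean zero. *)
Lemma LL_le a y : gam a * p y * (1 + LL a y) <= DD a y.
Proof.
have s2 : 0 < sg ^+ 2 by rewrite exprn_gt0.
have ga0 := gd_gt0 a sg0; have py0 := pm_gt0 I0 sg0 xc y.
have gp0 : 0 < gam a * p y by rewrite mulr_gt0.
rewrite mulrC -ler_pdivlMr//.
suff h : LL a y <= ln (DD a y / (gam a * p y)).
  have := le_ln1Dx (x := DD a y / (gam a * p y) - 1); rewrite [1 + (_ - 1)]addrC subrK => h2.
  have : ln (DD a y / (gam a * p y)) <= DD a y / (gam a * p y) - 1.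
    by apply: h2; rewrite ltrBrDl subrr divr_gt0// DD_gt0.
  lra.
have gb0 := gd_gt0 (beta y) sg0; have db0 := dbeta_gt0 y.
have dT0 := dT_gt0 a; have dX0 := dXX_gt0 a.
have r0 := pm_gt0 J0 sg0 yc (XX a + y).
have gg0 := gd_gt0 (c * beta y - d * a) sg0.
have jj0 : 0 < c * dbeta y * dXX a + d by rewrite ltr_wpDl// mulr_ge0 ?ltW// mulr_gt0.
rewrite (lndiv2 (DD_gt0 a y) gp0) DDE (lnM2 (mulr_gt0 r0 gg0) jj0) (lnM2 r0 gg0) (lnM2 ga0 py0).
(* The concavity points are [dbeta y * dXX a / c] and 1/d; with weights c^2 and d^2 their mean is
   exactly the Jacobian. *)
have hc : c ^+ 2 * (ln (dbeta y) + ln (dXX a) - ln c) - d ^+ 2 * ln d <= ln (c * dbeta y * dXX a + d).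
  have := @ln_concave _ (c ^+ 2) (d ^+ 2) (dbeta y * dXX a / c) d^-1 _ _ _ _ cd1.
  rewrite (_ : c ^+ 2 * (dbeta y * dXX a / c) + d ^+ 2 / d = c * dbeta y * dXX a + d); last first.
    by field; rewrite !gt_eqF.
  rewrite (lndiv2 (mulr_gt0 db0 dX0) c0) (lnM2 db0 dX0) lnV ?posrE// mulrN.
  by apply; [apply: divr_gt0 => //; exact: mulr_gt0|rewrite invr_gt0|exact: sqr_ge0|exact: sqr_ge0].
apply: le_trans (_ : _ <= ln (rr (XX a + y)) + ln (gam (c * beta y - d * a)) +
    (c ^+ 2 * (ln (dbeta y) + ln (dXX a) - ln c) - d ^+ 2 * ln d) - (ln (gam a) + ln (p y))) _; last first.
  by rewrite lerD2r lerD2l.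
rewrite {1}/dbeta {1}/dXX (lndiv2 py0 gb0) (lnM2 dT0 ga0).
rewrite !ln_gd// /LL.
set k := ln (sg * _); set A1 := ln (rr _); set A2 := ln (p y); set A3 := ln (dT _).
set A4 := ln c; set A5 := ln d.
rewrite le_eqVlt; apply/orP; left; apply/eqP.
(* With c^2 + d^2 = 1 the squares of a and of [beta y] in the Gaussian exponents cancel and only the
   product survives. *)
have -> : d ^+ 2 = 1 - c ^+ 2 by rewrite -cd1 addrC addKr.
have e : forall u, (c * u - d * a) ^+ 2 = c ^+ 2 * u ^+ 2 - 2 * c * d * u * a + (1 - c ^+ 2) * a ^+ 2.
  move=> u; have -> : 1 - c ^+ 2 = d ^+ 2 by rewrite -cd1 addrC addKr.
  by ring.
by rewrite e; field; rewrite gt_eqF.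
Qed.


(** Minus the cross entropy, relative to rr, of the mixture shifted by the signal value x. *)
Definition GG x : R := Emix sg xc (fun y => ln (rr (x + y))).

Lemma qg_rr x : qg (fun y => ln (rr (x + y))).
Proof.
have := qg_shift x (qg_lnpm J0 sg0 yc); congr qg; apply/funext => y.
by rewrite addrC.
Qed.

Variable By : R.
Hypothesis ycB : forall j, `|yc j| <= By.
Hypothesis Bt0 : 0 <= Bt.

(** The Lipschitz constant of [GG] on [0, Bt]. The slope in [lnpm_diff] is linear in |y|, so it is
    finite after averaging over the mixture. *)
Definition KK : R := (Emix sg xc (fun y => `|y|) + By + 2 * Bt) / sg ^+ 2.

Lemma KK_ge0 : 0 <= KK.
Proof.
have By0 : 0 <= By by have /card_gt0P[j _] := J0; exact: le_trans (ycB j).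
rewrite divr_ge0 ?sqr_ge0// !addr_ge0// ?mulr_ge0//.
by apply: sumr_ge0 => i _; exact: E1_ge0.
Qed.

Lemma GG_lip1 x z : 0 <= x <= Bt -> 0 <= z <= Bt -> GG z - GG x <= KK * `|z - x|.
Proof.
move=> /andP[x0 xB] /andP[z0 zB].
have s2 : 0 < sg ^+ 2 by rewrite exprn_gt0.
have qabs : qg (fun y : R => `|y|) by exact/qg_norm/qg_id.
rewrite /GG -EmixB//; [|exact: qg_rr|exact: qg_rr].
rewrite (_ : KK * `|z - x| = Emix sg xc (fun y => (`|z - x| / sg ^+ 2) * (`|y| + (By + 2 * Bt)))); last first.
  rewrite EmixZ//; last by apply: qgD => //; exact: qg_cst.
  by rewrite EmixD// ?Emix_cst// /KK; [ring|exact: qg_cst].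
apply: le_EM => //; first by apply: qgB; exact: qg_rr.
  by apply: qgZ; apply: qgD => //; exact: qg_cst.
move=> y; have := lnpm_diff J0 sg0 (x + y) (z - x) ycB.
rewrite (_ : x + y + (z - x) = z + y); last by ring.
move=> h; apply: (le_trans h).
rewrite (_ : `|z - x| / sg ^+ 2 * (`|y| + (By + 2 * Bt)) =
   (`|y| + (By + 2 * Bt)) * `|z - x| / sg ^+ 2); last by ring.
apply: ler_wpM2r; first by rewrite invr_ge0 ltW.
apply: ler_wpM2r => //.
have h1 : `|x + y| <= x + `|y| by rewrite (le_trans (ler_normD _ _))// ger0_norm.
have h2 : `|z - x| <= Bt by rewrite ler_norml; apply/andP; split; lra.
lra.
Qed.

Lemma GG_lip x z : 0 <= x <= Bt -> 0 <= z <= Bt -> `|GG z - GG x| <= KK * `|z - x|.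
Proof.
move=> hx hz; rewrite ler_norml lerNl opprB; apply/andP; split; last exact: GG_lip1.
by rewrite distrC; exact: GG_lip1.
Qed.

Lemma GX_cont : continuous (fun a => GG (XX a)).
Proof.
move=> a; apply/cvgrPdist_lt => e e0.
have K0 := KK_ge0; have K1 : 0 < KK + 1 by rewrite ltr_wpDl.
have h : \forall z \near nbhs a, `|XX a - XX z| < e / (KK + 1).
  have /cvgrPdist_lt hX := @XX_cont a.
  by apply: hX; rewrite divr_gt0.
near=> z.
have hz : `|XX a - XX z| < e / (KK + 1) by near: z; exact: h.
apply: (le_lt_trans (GG_lip (TB (Phi01 z)) (TB (Phi01 a)))).
rewrite ltr_pdivlMr// in hz.
by have := normr_ge0 (XX a - XX z); rewrite -/(XX a) -/(XX z); nra.
Unshelve. all: by end_near. Qed.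

Lemma GX_qg : qg (fun a => GG (XX a)).
Proof.
apply: (@qg_bounded _ _ (`|GG 0| + KK * Bt)).
  exact: continuous_measurable_fun GX_cont.
move=> a; have hX := TB (Phi01 a).
have h0 : 0 <= (0 : R) <= Bt by rewrite lexx.
rewrite -[GG (XX a)](subrK (GG 0)) addrC (le_trans (ler_normD _ _))// lerD2l.
apply: (le_trans (GG_lip h0 hX)); rewrite subr0 ler_wpM2l ?KK_ge0//.
by case/andP: hX => h1 h2; rewrite ger0_norm.
Qed.

Lemma lndT_qg : qg (fun a => ln (dT (Phi a))).
Proof.
apply: (@qg_bounded _ _ (`|ln l| + `|ln L|)).
  apply: measurableT_comp; first exact: measurable_ln.
  apply: continuous_measurable_fun => a.
  by apply: (continuous_comp (f := Phi) (g := dT)); [exact: Phi_cont|exact: dTc (Phi01 a)].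
move=> a; have /andP[h1 h2] := dTl (Phi01 a); have h3 := dT_gt0 a.
have L0 : 0 < L by exact: lt_le_trans h2.
have e1 : ln l <= ln (dT (Phi a)) by rewrite ler_ln ?posrE.
have e2 : ln (dT (Phi a)) <= ln L by rewrite ler_ln ?posrE.
have := ler_norm (ln L); have := ler_norm (- ln l); rewrite normrN.
have := normr_ge0 (ln l); have := normr_ge0 (ln L).
by rewrite ler_norml => *; apply/andP; split; lra.
Qed.

Definition Ebeta : R := Emix sg xc beta.

Definition uu a : R := GG (XX a) + (c ^+ 2 * ln (dT (Phi a)) +
  ((d ^+ 2 * hh sg xc - c ^+ 2 * ln c - d ^+ 2 * ln d) + (c * d * Ebeta / sg ^+ 2) * a)).

Lemma uu_qg : qg uu.
Proof.
apply: qgD; first exact: GX_qg.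
apply: qgD; first by apply: qgZ; exact: lndT_qg.
by apply: qgD; [exact: qg_cst|apply: qgZ; exact: qg_id].
Qed.

Lemma LL_qg a : qg (LL a).
Proof.
have := qgD (qgB (qg_rr (XX a)) (qgZ (d ^+ 2) (qg_lnpm I0 sg0 xc)))
  (qgD (qg_cst (c ^+ 2 * ln (dT (Phi a)) - c ^+ 2 * ln c - d ^+ 2 * ln d))
  (qgZ (c * d * a / sg ^+ 2) beta_qg)).
by congr qg; apply/funext => y; rewrite /LL; field; rewrite gt_eqF.
Qed.

Lemma Emix_LL a : Emix sg xc (LL a) = uu a.
Proof.
have q1 := qg_rr (XX a); have q2 := qgZ (d ^+ 2) (qg_lnpm I0 sg0 xc).
have q3 := qg_cst (c ^+ 2 * ln (dT (Phi a)) - c ^+ 2 * ln c - d ^+ 2 * ln d).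
have q4 := qgZ (c * d * a / sg ^+ 2) beta_qg.
rewrite (_ : LL a = fun y => (ln (rr (XX a + y)) - d ^+ 2 * ln (p y)) +
   ((c ^+ 2 * ln (dT (Phi a)) - c ^+ 2 * ln c - d ^+ 2 * ln d) +
   (c * d * a / sg ^+ 2) * beta y)); last first.
  by apply/funext => y; rewrite /LL; field; rewrite gt_eqF.
rewrite EmixD//; [|exact: qgB|exact: qgD].
rewrite EmixB// [Emix _ _ (fun y => _ + _ * beta y)]EmixD// Emix_cst//.
rewrite EmixZ; [|done|exact: (qg_lnpm I0 sg0 xc)].
rewrite EmixZ; [|done|exact: beta_qg].
rewrite /uu /hh /GG /Ebeta; ring.
Qed.

Lemma inner_le a : ((gam a * (1 + uu a))%:E <= \int[mu]_y (DD a y)%:E)%E.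
Proof.
have qL : qg (fun y => gam a * (1 + LL a y)).
  by apply: qgZ; apply: qgD; [exact: qg_cst|exact: LL_qg].
have -> : gam a * (1 + uu a) = \int[mu]_y (gam a * (1 + LL a y) * p y).
  rewrite -Emix_int// EmixZ//; last by apply: qgD; [exact: qg_cst|exact: LL_qg].
  by rewrite EmixD// ?Emix_cst// ?Emix_LL//; [exact: qg_cst|exact: LL_qg].
apply: le_int_ge0.
- exact: intble_pm.
- by apply/measurable_EFinP; exact: DD_meas2.
- by move=> y; rewrite lee_fin ltW// DD_gt0.
- by move=> y; rewrite lee_fin -mulrA [_ * p y]mulrC mulrA; exact: LL_le.
Qed.

(** Integrating [LL_le] over a and y against [DD_int] leaves a nonpositive mean of [LL]. Read with H
    = E ln T'(Phi), the entropy of the continuous signal, it says that the cross entropy of the sum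
    relative to any mixture rr is at least c^2 (H - ln c) + d^2 (h - ln d), where h is the entropy
    of the mixture p. *)
Lemma epi_core :
  E1 sg 0 (fun a => GG (XX a)) + c ^+ 2 * E1 sg 0 (fun a => ln (dT (Phi a))) +
  (d ^+ 2 * hh sg xc - c ^+ 2 * ln c - d ^+ 2 * ln d) <= 0.
Proof.
have -> : E1 sg 0 (fun a => GG (XX a)) + c ^+ 2 * E1 sg 0 (fun a => ln (dT (Phi a))) +
  (d ^+ 2 * hh sg xc - c ^+ 2 * ln c - d ^+ 2 * ln d) = E1 sg 0 uu.
  have q1 := GX_qg; have q2 := qgZ (c ^+ 2) lndT_qg.
  have q3 := qg_cst (d ^+ 2 * hh sg xc - c ^+ 2 * ln c - d ^+ 2 * ln d).
  have q4 := qgZ (c * d * Ebeta / sg ^+ 2) (qg_id R).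
  rewrite /uu E1D//; last exact: (qgD q2 (qgD q3 q4)).
  rewrite [E1 _ _ (fun y => _ * ln _ + _)]E1D//; last exact: (qgD q3 q4).
  rewrite E1D// E1_cst// E1Z; [|done|exact: lndT_qg].
  have -> : E1 sg 0 ( *%R (c * d * Ebeta / sg ^+ 2)) = 0.
    by rewrite (E1Z 0 _ sg0 (qg_id R)) E1_id// mulr0.
  by rewrite addr0 [RHS]addrA.
have q1u : qg (fun a => 1 + uu a) by apply: qgD; [exact: qg_cst|exact: uu_qg].
have : E1 sg 0 (fun a => 1 + uu a) <= 1.
  rewrite -lee_fin; apply: le_trans DD_int; apply: le_int_ge0.
  - exact: intble_qg.
  - apply: (@measurable_fun_fubini_tonelli_F _ _ _ _ _ mu (fun z : R * R => (DD z.1 z.2)%:E)).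
      by apply/measurable_EFinP; exact: DD_meas.
    by move=> z; rewrite lee_fin ltW// DD_gt0.
  - by move=> a; apply: integral_ge0 => y _; rewrite lee_fin ltW// DD_gt0.
  - by move=> a; rewrite subr0 mulrC; exact: inner_le.
by rewrite E1D// ?E1_cst ?gerDl//; [exact: qg_cst|exact: uu_qg].
Qed.

End Transport.
End EpiCore.

(** * Riemann sums for a uniform variable *)

Section Discretize.
Variable R : realType.
Notation mu := (@lebesgue_measure R).
Variable sg : R.
Hypothesis sg0 : 0 < sg.
Notation gam := (gd sg).
Notation Phi := (cdf1 (gd sg)).

Lemma derive_cont (f : R -> R) (t df : R) : is_derive t 1 f df -> {for t, continuous f}.
Proof. by move=> [h _]; exact/differentiable_continuous/derivable1_diffP. Qed.

(** The substitution t = [Phi a], under which the Gaussian weight becomes the uniform one on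
    [0, 1]. *)
Lemma push_primitive (g G : R -> R) :
  (forall t : R, 0 <= t <= 1 -> is_derive t 1 G (g t)) ->
  (forall t : R, 0 < t < 1 -> {for t, continuous g}) ->
  (forall t : R, 0 < t < 1 -> 0 <= g t) ->
  E1 sg 0 (fun a => g (Phi a)) = G 1 - G 0.
Proof.
move=> dG gc g0.
have h := @primitive_int_ge _ (fun a => g (Phi a) * gam a) (fun a => G (Phi a)) _ _ _ (G 1 - G 0).
rewrite /E1 /Rintegral.
under eq_integral do rewrite subr0.
rewrite -[RHS]/(fine (G 1 - G 0)%:E); congr fine; apply: h.
- move=> a; apply: cvgM; last exact: gd_cont.
  apply: (continuous_comp (f := Phi) (g := g)); first exact: Phi_cont.
  by apply: gc; exact: Phi01.
- move=> a; apply: mulr_ge0; last by apply/ltW/gd_gt0.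
  by apply: g0; exact: Phi01.
- move=> a; have h1 := Phi_derive sg0 a.
  have h2 : is_derive (Phi a) 1 G (g (Phi a)).
    by apply: dG; have /andP[? ?] := Phi01 sg0 a; rewrite !ltW.
  exact: is_derive1_comp.
- have i01 : 0 <= (0:R) <= 1 by rewrite lexx ler01.
  have i11 : 0 <= (1:R) <= 1 by rewrite lexx ler01.
  apply: (@cvgB _ R^o).
    apply: (@cvg_comp _ _ _ (fun n : nat => Phi n%:R) G _ (nbhs (1:R))).
      exact: (cdf1_cvgy (@gd_cont _ _) (fun y => gd_gt0 y sg0) (intble_gam sg0) (int_gam sg0)).
    exact: (derive_cont (dG _ i11)).
  apply: (@cvg_comp _ _ _ (fun n : nat => Phi (- n%:R)) G _ (nbhs (0:R))).
    exact: (cdf1_cvgNy (@gd_cont _ _) (fun y => gd_gt0 y sg0) (intble_gam sg0) (int_gam sg0)).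
  exact: (derive_cont (dG _ i01)).
Qed.

Lemma telescope_avg (G : R -> R) (N : nat) : (0 < N)%N ->
  \sum_(j < N) (G (j.+1%:R / N%:R) - G (j%:R / N%:R)) = G 1 - G 0.
Proof.
move=> N0; rewrite -(big_mkord predT (fun j => G (j.+1%:R / N%:R) - G (j%:R / N%:R))).
rewrite telescope_sumr// mul0r divff// pnatr_eq0 -lt0n//.
Qed.

Lemma grid_in (N j : nat) : (j <= N)%N -> 0 <= (j%:R / N%:R : R) <= 1.
Proof.
case: N => [|N]; first by rewrite leqn0 => /eqP->; rewrite mul0r lexx ler01.
by move=> jN; rewrite divr_ge0//= ler_pdivrMr ?ltr0n// mul1r ler_nat.
Qed.

(** On each cell the mean value theorem writes the increment of G as g(u) / N with u to the right of
    the grid point. The bound on g is therefore one-sided: Lipschitz functions pay [Lam],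
    nondecreasing ones take [Lam] = 0. *)
Lemma riemann_le (g G : R -> R) (Lam : R) (N : nat) : (0 < N)%N ->
  (forall t : R, 0 <= t <= 1 -> is_derive t 1 G (g t)) ->
  (forall t u : R, 0 <= t -> t <= u -> u <= 1 -> u - t <= N%:R^-1 -> g t <= g u + Lam / N%:R) ->
  avg (fun j : 'I_N => g (j%:R / N%:R)) <= G 1 - G 0 + Lam / N%:R.
Proof.
move=> N0 dG hg; have N0' : 0 < N%:R :> R by rewrite ltr0n.
rewrite -(telescope_avg G N0).
have cI : (0 < #|'I_N|)%N by rewrite card_ord.
rewrite -[Lam / N%:R](avg_cst _ cI) /avg card_ord -lerBlDr -mulrBr -sumrB.
rewrite mulr_sumr; apply: ler_sum => j _.
have hj : j%:R / N%:R < j.+1%:R / N%:R :> R by rewrite ltr_pM2r ?invr_gt0// ltr_nat.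
have /andP[a0 _] := grid_in (ltnW (ltn_ord j)); have /andP[_ b1] := grid_in (ltn_ord j).
have [||u ui ->] := @MVT R G g _ _ hj.
- move=> t; rewrite in_itv /= => /andP[t1 t2]; apply: dG.
  by rewrite (le_trans a0 (ltW t1)) (le_trans (ltW t2) b1).
- apply: derivable_within_continuous => t; rewrite in_itv /= => /andP[t1 t2].
  by have [] := dG t; rewrite ?(le_trans a0 t1) ?(le_trans t2 b1).
move: ui; rewrite in_itv /= => /andP[u1 u2].
have hd : j.+1%:R / N%:R - j%:R / N%:R = N%:R^-1 :> R.
  by rewrite -mulrBl -natrB// subSnn mul1r.
rewrite hd mulrC ler_wpM2r ?invr_ge0//.
rewrite lerBlDr; apply: hg => //; [exact: ltW|exact: le_trans (ltW u2) b1|].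
lra.
Qed.

Lemma discretize_le (g : R -> R) (Lam : R) (N : nat) : (0 < N)%N ->
  (forall t u : R, 0 <= t <= 1 -> 0 <= u <= 1 -> `|g t - g u| <= Lam * `|t - u|) ->
  avg (fun j : 'I_N => g (j%:R / N%:R)) <= E1 sg 0 (fun a => g (Phi a)) + Lam / N%:R.
Proof.
move=> N0 hg.
have Lam0 : 0 <= Lam.
  have h : `|g 0 - g 1| <= Lam * `|0 - 1| by apply: hg; rewrite ?lexx ?ler01.
  by rewrite sub0r normrN normr1 mulr1 in h; exact: le_trans h.
(* Clamping extends g continuously past the ends of [0, 1], where G must be differentiable on both
   sides. The shift by M makes it nonnegative, as the monotone convergence behind [push_primitive]
   demands. *)
pose cl t : R := Num.max 0 (Num.min 1 t).
have cl01 t : 0 <= cl t <= 1.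
  by rewrite /cl le_max lexx /= ge_max ler01 /= ge_min lexx.
have clE t : 0 <= t <= 1 -> cl t = t.
  by move=> /andP[t0 t1]; rewrite /cl (min_idPr t1) (max_idPr t0).
have cl_le t u : t <= u -> cl u - cl t <= u - t.
  move=> tu; rewrite /cl /Num.max /Num.min.
  by do ! case: ifPn; rewrite -?leNgt; lra.
have cl_ge t u : t <= u -> cl t <= cl u.
  move=> tu; rewrite /cl /Num.max /Num.min.
  by do ! case: ifPn; rewrite -?leNgt; lra.
pose M : R := `|g 0| + Lam.
pose g1 t := g (cl t) + M.
have gM t : 0 <= g1 t.
  have i01 : 0 <= (0:R) <= 1 by rewrite lexx ler01.
  have := hg _ _ (cl01 t) i01; rewrite subr0 => h.
  have /andP[c0 c1] := cl01 t.
  have h2 : `|g (cl t) - g 0| <= Lam.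
    by rewrite (le_trans h)// ger0_norm// ler_piMr.
  have : - `|g (cl t) - g 0| <= g (cl t) - g 0 by rewrite lerNl -normrN ler_norm.
  have : - `|g 0| <= g 0 by rewrite lerNl -normrN ler_norm.
  rewrite /g1 /M; lra.
have g1lip t u : `|g1 t - g1 u| <= Lam * `|t - u|.
  rewrite (_ : g1 t - g1 u = g (cl t) - g (cl u)); last by rewrite /g1; ring.
  apply: (le_trans (hg _ _ (cl01 t) (cl01 u))); rewrite ler_wpM2l//.
  have [tu|/ltW tu] := leP t u.
    rewrite distrC [leRHS]distrC !ger0_norm ?subr_ge0//; [exact: cl_le|exact: cl_ge].
  by rewrite !ger0_norm ?subr_ge0//; [exact: cl_le|exact: cl_ge].
have g1c : continuous g1.
  move=> t; apply/cvgrPdist_lt => e e0.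
  have L1 : 0 < Lam + 1 by rewrite ltr_wpDl.
  near=> z; apply: (le_lt_trans (g1lip _ _)).
  have : `|t - z| < e / (Lam + 1).
    by near: z; apply: cvgr_dist_lt => //; rewrite divr_gt0.
  by rewrite ltr_pdivlMr// => h; have := normr_ge0 (t - z); nra.
pose G1 (t : R) : R := \int[mu]_(x in `[-1, t]) g1 x.
have dG (t : R) : 0 <= t <= 1 -> is_derive t 1 G1 (g1 t).
  move=> /andP[t0 t1].
  have t2 : t < 2 by rewrite (le_lt_trans t1)// ltr1n.
  have mt : -1 < t by rewrite (lt_le_trans _ t0)// ltrN10.
  have gi : mu.-integrable `[-1, 2] (EFin \o g1).
    apply: continuous_compact_integrable; first exact: segment_compact.
    exact: continuous_subspaceT.
  have [h1 h2] := continuous_FTC1_closed t2 gi mt (g1c t).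
  by split; [exact: h1|rewrite -derive1E; exact: h2].
have q1 : qg (fun a => g1 (Phi a)).
  apply: (@qg_bounded _ _ (`|g1 0| + Lam)).
    apply: continuous_measurable_fun => a.
    by apply: (continuous_comp (f := Phi) (g := g1)); [exact: Phi_cont|exact: g1c].
  move=> a; have /andP[p0 p1] := Phi01 sg0 a.
  rewrite -[g1 (Phi a)](subrK (g1 0)) addrC (le_trans (ler_normD _ _))// lerD2l.
  by rewrite (le_trans (g1lip _ _))// subr0 gtr0_norm// ler_piMr// ltW.
have e1 : E1 sg 0 (fun a => g (Phi a)) = G1 1 - G1 0 - M.
  rewrite -(push_primitive dG)//; last by move=> t _; exact: g1c.
  rewrite -[M in RHS](E1_cst 0 M sg0) -E1B//; last exact: qg_cst.
  congr E1; apply/funext => a; rewrite /g1 clE ?addrK//.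
  by have /andP[? ?] := Phi01 sg0 a; rewrite !ltW.
have := @riemann_le g1 G1 Lam N N0 dG.
rewrite (_ : avg _ = avg (fun j : 'I_N => g (j%:R / N%:R)) + M); last first.
  rewrite -[M in RHS](avg_cst (I := 'I_N)) ?card_ord// -avgD.
  by apply: eq_avg => j; rewrite /g1 clE//; apply: grid_in; exact: ltnW.
rewrite e1 => h; suff : avg (fun j : 'I_N => g (j%:R / N%:R)) + M <= G1 1 - G1 0 + Lam / N%:R by lra.
apply: h => t u t0 tu u1 utN.
have := g1lip t u; rewrite ler_norml distrC (ger0_norm (x := u - t)) ?subr_ge0// => /andP[_ h].
have : Lam * (u - t) <= Lam / N%:R by rewrite ler_wpM2l.
lra.
Unshelve. all: by end_near. Qed.

End Discretize.

Section Epi.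
Variable R : realType.
Variable sg : R.
Hypothesis sg0 : 0 < sg.
Notation Phi := (cdf1 (gd sg)).

Section OneSignal.
Variables (I : finType) (xc : I -> R) (B : R).
Hypotheses (I0 : (0 < #|I|)%N) (xcB : forall i, 0 <= xc i <= B).
Variables (T dT : R -> R) (Bt L l H : R).
Hypotheses (TB : forall t : R, 0 <= t <= 1 -> 0 <= T t <= Bt)
  (dTd : forall t : R, 0 < t < 1 -> is_derive t 1 T (dT t))
  (dTc : forall t : R, 0 < t < 1 -> {for t, continuous dT})
  (dTl : forall t : R, 0 < t < 1 -> l <= dT t <= L) (l0 : 0 < l)
  (TL : forall t u : R, 0 <= t <= 1 -> 0 <= u <= 1 -> `|T t - T u| <= L * `|t - u|)
  (TH : H <= E1 sg 0 (fun a => ln (dT (Phi a)))).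

Definition grid (N : nat) (z : 'I_N * I) : R := xc z.2 + T (z.1%:R / N%:R).

(** [epi_core] is applied with the mixture of the discretized sum as its own test density. The grid
    average of [GG] is then minus its entropy, and [discretize_le] compares it with the expectation
    over the continuous signal. *)
Lemma epi_weighted (N : nat) (c d : R) : (0 < N)%N -> 0 < c -> 0 < d -> c ^+ 2 + d ^+ 2 = 1 ->
  c ^+ 2 * (H - ln c) + d ^+ 2 * (hh sg xc - ln d) -
    (E1 sg 0 (fun y => `|y|) + 2 * B + 3 * Bt) / sg ^+ 2 * L / N%:R
  <= hh sg (@grid N).
Proof.
move=> N0 c0 d0 cd1.
have J0 : (0 < #|{: 'I_N * I}|)%N by rewrite card_prod card_ord muln_gt0 N0.
have TB' (t : R) : 0 < t < 1 -> 0 <= T t <= Bt.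
  by move=> /andP[? ?]; apply: TB; rewrite !ltW.
have Bt0 : 0 <= Bt.
  by have /andP[+ +] := TB (t := 0) (introT andP (conj (lexx _) ler01)); exact: le_trans.
have B0 : 0 <= B by have /card_gt0P[i _] := I0; case/andP: (xcB i); exact: le_trans.
have gB z : `|@grid N z| <= B + Bt.
  have /andP[h1 h2] := xcB z.2.
  have /andP[h3 h4] := TB (grid_in R (ltnW (ltn_ord z.1))).
  by rewrite ger0_norm ?addr_ge0// lerD.
have core := epi_core sg0 I0 J0 xcB TB' dTd dTc dTl l0 c0 d0 cd1 gB Bt0.
set K := KK sg xc Bt (B + Bt) in core.
have K0 : 0 <= K by exact: (KK_ge0 xc sg0 J0 gB Bt0).
have L0 : 0 <= L.
  have := TL (t := 0) (u := 1); rewrite lexx ler01 /= => /(_ isT).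
  by rewrite lexx => /(_ isT); rewrite sub0r normrN normr1 mulr1; exact: le_trans.
set g := fun t => GG sg xc (@grid N) (T t).
have glip (t u : R) : 0 <= t <= 1 -> 0 <= u <= 1 -> `|g t - g u| <= K * L * `|t - u|.
  move=> ht hu; have h : `|g t - g u| <= K * `|T t - T u|.
    by apply: GG_lip gB _ _ _ _ => //; [exact: TB hu|exact: TB ht].
  apply: (le_trans h).
  by rewrite -mulrA ler_wpM2l// TL.
have disc := discretize_le sg0 N0 glip.
have hhE : hh sg (@grid N) = - avg (fun j : 'I_N => g (j%:R / N%:R)).
  rewrite /hh {1}/Emix avg_pair; congr (- _); apply: eq_avg => j.
  rewrite /g /GG /Emix; apply: eq_avg => i.
  rewrite -[LHS]/(E1 sg (xc i + T (j%:R / N%:R)) (fun y => ln (pm sg (@grid N) y))).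
  rewrite (E1_shift _ _ sg0 (qg_lnpm J0 sg0 (@grid N))).
  by congr E1; apply/funext => y; rewrite addrC.
(* The Lipschitz constant sees the mixture only through the mean of |y|. Bounding that mean by B
   frees the error term from I and xc, which themselves depend on N when signals are stacked. *)
have KE : K <= (E1 sg 0 (fun y => `|y|) + 2 * B + 3 * Bt) / sg ^+ 2.
  rewrite /K /KK ler_wpM2r ?invr_ge0 ?sqr_ge0//.
  suff : Emix sg xc (fun y => `|y|) <= E1 sg 0 (fun y => `|y|) + B by lra.
  rewrite /Emix -[leRHS](avg_cst _ I0); apply: le_avg => i.
  have qabs : qg (fun y : R => `|y|) by exact/qg_norm/qg_id.
  have -> : E1 sg 0 (fun y => `|y|) + B = E1 sg 0 (fun y => `|y| + B).
    by rewrite E1D// ?E1_cst//; exact: qg_cst.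
  rewrite -[xc i]add0r E1_shift//; apply: le_E1 => //.
  - exact: qg_shift.
  - by apply: qgD => //; exact: qg_cst.
  move=> y; rewrite (le_trans (ler_normD _ _))// lerD2l.
  by have /andP[? ?] := xcB i; rewrite ger0_norm.
have KLN : K * L / N%:R <= (E1 sg 0 (fun y => `|y|) + 2 * B + 3 * Bt) / sg ^+ 2 * L / N%:R.
  by rewrite ler_wpM2r ?invr_ge0// ler_wpM2r.
have c2 : 0 <= c ^+ 2 by exact: sqr_ge0.
have hTH := ler_wpM2l c2 TH.
have {}core : E1 sg 0 (fun a => g (Phi a)) + c ^+ 2 * E1 sg 0 (fun a => ln (dT (Phi a))) +
  (d ^+ 2 * hh sg xc - c ^+ 2 * ln c - d ^+ 2 * ln d) <= 0 := core.
rewrite hhE; move: core disc hTH KLN; move: (avg _) (E1 sg 0 (fun a => g _)) (K * L / _).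
move: (E1 sg 0 (fun a => ln _)) (_ * L / _) (ln c) (ln d) (hh sg xc) => *; lra.
Qed.

(* The optimal weights c^2, d^2 are proportional to the two entropy powers. *)
Lemma epi_one (N : nat) : (0 < N)%N ->
  2^-1 * ln (expR (2 * H) + expR (2 * hh sg xc)) -
    (E1 sg 0 (fun y => `|y|) + 2 * B + 3 * Bt) / sg ^+ 2 * L / N%:R
  <= hh sg (@grid N).
Proof.
move=> N0; set a := expR (2 * H); set b := expR (2 * _); set S := a + b.
have a0 : 0 < a by exact: expR_gt0.
have b0 : 0 < b by exact: expR_gt0.
have S0 : 0 < S by exact: addr_gt0.
have c0 : 0 < Num.sqrt (a / S) by rewrite sqrtr_gt0 divr_gt0.
have d0 : 0 < Num.sqrt (b / S) by rewrite sqrtr_gt0 divr_gt0.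
have c2 : Num.sqrt (a / S) ^+ 2 = a / S by rewrite sqr_sqrtr// ltW// divr_gt0.
have d2 : Num.sqrt (b / S) ^+ 2 = b / S by rewrite sqr_sqrtr// ltW// divr_gt0.
have cd : Num.sqrt (a / S) ^+ 2 + Num.sqrt (b / S) ^+ 2 = 1.
  by rewrite c2 d2 -mulrDl divff// gt_eqF.
have := epi_weighted N0 c0 d0 cd; apply: le_trans; rewrite lerD2r.
have lc : ln (Num.sqrt (a / S)) = H - 2^-1 * ln S.
  have : ln (Num.sqrt (a / S) ^+ 2) = 2 * H - ln S.
    by rewrite c2 lndiv2// expRK.
  rewrite lnXn// -mulr_natl; lra.
have ld : ln (Num.sqrt (b / S)) = hh sg xc - 2^-1 * ln S.
  have : ln (Num.sqrt (b / S) ^+ 2) = 2 * hh sg xc - ln S.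
    by rewrite d2 lndiv2// expRK.
  rewrite lnXn// -mulr_natl; lra.
rewrite lc ld !subKr -mulrDl cd mul1r lexx//.
Qed.

End OneSignal.
End Epi.

(** * An upper bound on the entropy of a bounded signal in Gaussian noise *)

Section GaussTail.
Variable R : realType.
Notation mu := (@lebesgue_measure R).
Implicit Types (x y z t : R).

Lemma Rint_indic (S : set R) (f : R -> R) : measurable S ->
  \int[mu]_y (\1_S y * f y) = \int[mu]_(y in S) f y.
Proof.
move=> mS; rewrite [RHS]Rintegral_mkcond; apply: eq_Rintegral => y _.
by rewrite patchE indicE; case: (y \in S); rewrite ?mul1r ?mul0r.
Qed.

Lemma intD (f g : R -> R) : intble f -> intble g ->
  \int[mu]_y (f y + g y) = \int[mu]_y f y + \int[mu]_y g y.
Proof. by move=> hf hg; rewrite RintegralD. Qed.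

Lemma qg_opp (g : R -> R) : qg g -> qg (fun y => g (- y)).
Proof.
move=> [mg [C hC]]; split; first exact: measurableT_comp.
by exists C => y; have := hC (- y); rewrite sqrrN.
Qed.

Lemma primitive_int_le2 (u U : R -> R) (M : R) : continuous u -> (forall y, 0 <= u y) ->
  (forall y, is_derive y 1 U (u y)) -> (forall n : nat, U n%:R - U (- n%:R) <= M) ->
  (\int[mu]_y (u y)%:E <= M%:E)%E.
Proof.
move=> uc u0 dU UM; apply: (cvge_le _ (cvg_symitv uc u0 dU)).
by apply: nearW => n; rewrite lee_fin.
Qed.

Lemma FTC_itv (u U : R -> R) (a b : R) : a < b -> continuous u ->
  (forall y, is_derive y 1 U (u y)) ->
  \int[mu]_(y in `]a, b]) u y = U b - U a.
Proof.
move=> ab uc dU.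
have Uc : continuous U by move=> y; exact: derive_cont (dU y).
rewrite Rintegral_itv_obnd_cbnd; last first.
  apply: (@integrableS _ _ _ mu `[a, b]%classic) => //; first exact: subset_itv_oc_cc.
  apply: continuous_compact_integrable; first exact: segment_compact.
  exact: continuous_subspaceT.
rewrite /Rintegral (continuous_FTC2 (F := U))//.
- exact: continuous_subspaceT.
- split=> [y _||].
  + by have [] := dU y.
  + by apply: cvg_at_right_filter; exact: Uc.
  + by apply: cvg_at_left_filter; exact: Uc.
- by move=> y _; rewrite derive1E; have [] := dU y.
Qed.

Lemma halfline_int_le (u U : R -> R) (a M : R) : continuous u ->
  (forall y, a < y -> 0 <= u y) -> intble u ->
  (forall y, is_derive y 1 U (u y)) -> (forall y, a < y -> U y - U a <= M) ->
  \int[mu]_(y in `]a, +oo[) u y <= M.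
Proof.
move=> uc u0 ui dU UM.
have hu : \bigcup_n `]a, (a + n.+1%:R)]%classic = `]a, +oo[%classic.
  apply/seteqP; split => [x [n _] /=|x /=]; first by rewrite !in_itv /= => /andP[->].
  rewrite in_itv /= andbT => ax; exists (Num.truncn (x - a)) => //=.
  by rewrite in_itv /= ax /= -lerBlDl ltW// truncnS_gt.
have h : (\int[mu]_(y in `]a, (a + n.+1%:R)%R]) (u y)%:E)%E @[n --> \oo] -->
    (\int[mu]_(y in `]a, +oo[) (u y)%:E)%E.
  rewrite -hu; apply: ge0_nondecreasing_set_cvg_integral => //.
  - apply/nondecreasing_seqP => n; apply/subsetPset => y /=.
    rewrite !in_itv /= => /andP[-> h]; rewrite (le_trans h)//= lerD2l ler_nat//.
  - move=> n; apply/measurable_EFinP; apply: measurable_funTS.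
    exact: continuous_measurable_fun.
  - by move=> n y /=; rewrite in_itv /= => /andP[ay _]; rewrite lee_fin u0.
have hi : mu.-integrable `]a, +oo[ (EFin \o u) by exact: (integrableS measurableT _ _ ui).
rewrite -lee_fin /Rintegral fineK; last exact: integrable_fin_num.
apply: (cvge_le _ h); apply: nearW => n.
have an : a < a + n.+1%:R by rewrite ltrDl.
have hn : mu.-integrable `]a, (a + n.+1%:R)] (EFin \o u).
  exact: (integrableS measurableT _ _ ui).
rewrite -(fineK (integrable_fin_num _ hn))// lee_fin -/(Rintegral mu _ u) (FTC_itv an uc dU).
exact: UM.
Qed.

Variable sg : R.
Hypothesis sg0 : 0 < sg.
Notation gam := (gd sg).
Notation Phi := (cdf1 (gd sg)).

Lemma gam_derive y : is_derive y 1 gam (- (y / sg ^+ 2) * gam y).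
Proof.
have h1 : is_derive y 1 (fun y : R => - (y ^+ 2) / (2 * sg ^+ 2)) (- (y / sg ^+ 2)).
  have -> : (fun y : R => - (y ^+ 2) / (2 * sg ^+ 2)) = (- (2 * sg ^+ 2)^-1) *: (id * id : R -> R).
    by apply/funext => z; rewrite mulNr mulrC -mulNr expr2.
  by apply: is_derive_eq; rewrite /GRing.scale /=; field; rewrite gt_eqF.
have h2 : is_derive y 1 (expR \o (fun y : R => - (y ^+ 2) / (2 * sg ^+ 2)))
    (expR (- (y ^+ 2) / (2 * sg ^+ 2)) * (- (y / sg ^+ 2))).
  exact: is_derive1_comp.
have -> : gam = (sg * Num.sqrt (pi *+ 2))^-1 *: (expR \o (fun y : R => - (y ^+ 2) / (2 * sg ^+ 2))).
  by [].
apply: is_derive_eq.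
transitivity ((sg * Num.sqrt (pi *+ 2))^-1 *
  (expR (- (y ^+ 2) / (2 * sg ^+ 2)) * (- (y / sg ^+ 2)))); first by [].
transitivity (- (y / sg ^+ 2) *
  ((sg * Num.sqrt (pi *+ 2))^-1 * expR (- (y ^+ 2) / (2 * sg ^+ 2)))); last by [].
by ring.
Qed.

Lemma gam_dec x y : 0 <= x -> x <= y -> gam y <= gam x.
Proof.
move=> x0 xy; rewrite /gd ler_wpM2l//.
  by rewrite invr_ge0 mulr_ge0 ?sqrtr_ge0// ltW.
rewrite ler_expR ler_pM2r ?invr_gt0 ?mulr_gt0 ?exprn_gt0//.
by rewrite lerN2 lerXn2r// nnegrE (le_trans x0).
Qed.

Lemma Phi_opp y : Phi (- y) = 1 - Phi y.
Proof.
suff h z : Phi (- z) + Phi z = 1 by have := h y; lra.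
have cst0 x w : Phi (- x) + Phi x = Phi (- w) + Phi w.
  apply: (@is_derive_0_is_cst _ (fun x => Phi (- x) + Phi x)) => {}x.
  have h1 := Phi_derive sg0 (- x); have h2 := Phi_derive sg0 x.
  have h3 : is_derive x 1 (Phi \o (-%R)) (gam (- x) * (- 1)).
    exact: is_derive1_comp.
  have -> : (fun x : R => Phi (- x) + Phi x) = (Phi \o -%R) + Phi by [].
  by apply: is_derive_eq; rewrite gdN; ring.
have c1 := cdf1_cvgy (@gd_cont _ sg) (fun y => gd_gt0 y sg0) (intble_gam sg0) (int_gam sg0).
have c2 := cdf1_cvgNy (@gd_cont _ sg) (fun y => gd_gt0 y sg0) (intble_gam sg0) (int_gam sg0).
have h : Phi (- n%:R) + Phi n%:R @[n --> \oo] --> (0 + 1 : R).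
  by apply: (@cvgD _ R^o); [exact: c2|exact: c1].
rewrite add0r in h.
have h' : Phi (- n%:R) + Phi n%:R @[n --> \oo] --> Phi (- z) + Phi z.
  by under eq_fun do rewrite (cst0 _ z); exact: cvg_cst.
exact: (cvg_unique _ h' h).
Qed.

Lemma int_mid (a b : R) : a < b -> \int[mu]_(y in `]a, b]) gam y = Phi b - Phi a.
Proof. by move=> ab; apply: FTC_itv => //; [exact: gd_cont|exact: Phi_derive]. Qed.

Lemma int_mid_id (a b : R) : a < b ->
  \int[mu]_(y in `]a, b]) (y * gam y) = sg ^+ 2 * (gam a - gam b).
Proof.
move=> ab; apply: (etrans (FTC_itv (u := fun y => y * gam y) (U := (- sg ^+ 2) *: gam) ab _ _)); last first.
- have scE t : (- sg ^+ 2 *: gam) t = - sg ^+ 2 * gam t by [].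
  by rewrite !scE; ring.
- move=> y; have := gam_derive y => h; apply: is_derive_eq; rewrite /GRing.scale /=.
  by field; rewrite gt_eqF.
- by move=> y; apply: cvgM; [exact: cvg_id|exact: gd_cont].
Qed.

Lemma sqr_derive y :
  is_derive y 1 (fun y => sg ^+ 2 * (Phi y - y * gam y)) (y ^+ 2 * gam y).
Proof.
have h1 := Phi_derive sg0 y; have h2 := gam_derive y.
have -> : (fun y : R => sg ^+ 2 * (Phi y - y * gam y)) = (sg ^+ 2) *: (Phi - (id * gam)) by [].
by apply: is_derive_eq; rewrite /GRing.scale /=; field; rewrite gt_eqF.
Qed.

Lemma sqrgam_cont : continuous (fun y => y ^+ 2 * gam y).
Proof. by move=> y; apply: cvgM; [exact: sqr_continuous|exact: gd_cont]. Qed.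

Lemma E1_sqr : E1 sg 0 (fun y => y ^+ 2) <= sg ^+ 2.
Proof.
rewrite -lee_fin /E1 /Rintegral fineK; last first.
  exact: (integrable_fin_num _ (intble_qg 0 sg0 (qg_sqr R))).
under eq_integral do rewrite subr0.
apply: (primitive_int_le2 sqrgam_cont _ sqr_derive) => [y|n].
  by rewrite mulr_ge0 ?sqr_ge0 ?ltW ?gd_gt0.
rewrite -mulrBr ler_piMr ?sqr_ge0// gdN.
have /andP[_ p1] := Phi01 sg0 n%:R; have /andP[p0 _] := Phi01 sg0 (- n%:R).
have : 0 <= n%:R * gam n%:R by rewrite mulr_ge0// ltW ?gd_gt0.
lra.
Qed.

(** [sg ^+ 2 * (Phi y - y * gam y)] is a primitive of the integrand and stays below sg^2 on the
    positive half-line. *)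
Lemma tail_sqr (x : R) : 0 <= x ->
  \int[mu]_(y in `]x, +oo[) (y ^+ 2 * gam y) <= sg ^+ 2 * (1 - Phi x + x * gam x).
Proof.
move=> x0; apply: (halfline_int_le sqrgam_cont _ _ sqr_derive) => [y _||y xy].
- by rewrite mulr_ge0 ?sqr_ge0 ?ltW ?gd_gt0.
- have := intble_qg 0 sg0 (qg_sqr R); rewrite /intble.
  by apply: eq_integrable => // y _ /=; rewrite subr0.
- rewrite -mulrBr ler_wpM2l ?sqr_ge0//.
  have /andP[_ p1] := Phi01 sg0 y.
  have : 0 <= y * gam y by rewrite mulr_ge0 ?ltW ?gd_gt0// (le_lt_trans x0).
  lra.
Qed.

End GaussTail.

(** The rescaling of the integral is obtained by comparing derivatives; both distribution functions
    equal 1/2 at 0 by symmetry. *)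
Lemma QfunE (R : realType) (sg x : R) : 0 < sg -> Qfun (x / sg) = 1 - cdf1 (gd sg) x.
Proof.
move=> sg0.
have g1E t : (Num.sqrt (pi *+ 2))^-1 * expR (- (t ^+ 2) / 2) = gd 1 t :> R.
  by rewrite /gd mul1r expr1n mulr1.
have -> : Qfun (x / sg) = 1 - cdf1 (gd 1) (x / sg).
  rewrite (cdf1C (intble_gam ltr01) (int_gam ltr01)) Rintegral_itv_obnd_cbnd; last first.
    exact: (integrableS measurableT _ _ (intble_gam (@ltr01 R))).
  by apply: eq_Rintegral => t _; rewrite g1E.
congr (1 - _).
have h0 (s : R) : 0 < s -> cdf1 (gd s) 0 = 2^-1 by move=> s0; have := Phi_opp s0 0; rewrite oppr0; lra.
have cst0 z w : cdf1 (gd 1) (z / sg) - cdf1 (gd sg) z = cdf1 (gd 1) (w / sg) - cdf1 (gd sg) w.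
  apply: (@is_derive_0_is_cst _ (fun z => cdf1 (gd 1) (z / sg) - cdf1 (gd sg) z)) => {}z.
  have h1 := Phi_derive (@ltr01 R) (z / sg); have h2 := Phi_derive sg0 z.
  have h3 : is_derive z 1 (fun z : R => z / sg) (sg^-1).
    have -> : (fun z : R => z / sg) = sg^-1 *: id by apply/funext => u; rewrite /GRing.scale /= mulrC.
    by apply: is_derive_eq; rewrite /GRing.scale /= mulr1.
  have h4 : is_derive z 1 (cdf1 (gd 1) \o (fun z : R => z / sg)) (gd 1 (z / sg) * sg^-1).
    exact: is_derive1_comp.
  have -> : (fun z : R => cdf1 (gd 1) (z / sg) - cdf1 (gd sg) z) =
    (cdf1 (gd 1) \o (fun z : R => z / sg)) - cdf1 (gd sg) by [].
  apply: is_derive_eq; apply/eqP; rewrite subr_eq0; apply/eqP.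
  have q0 := @sqrt2pi_gt0 R.
  rewrite /gd mul1r expr1n mulr1 invfM mulrAC [sg^-1 * _]mulrC; congr (_ * _ * expR _).
  by field; rewrite gt_eqF.
have := cst0 x 0; rewrite mul0r !h0// subrr => /eqP; rewrite subr_eq0 => /eqP//.
Qed.

Section LMW.
Variable R : realType.
Notation mu := (@lebesgue_measure R).
Variables (sg A xi nu c0 : R) (I : finType) (xc : I -> R).
Hypotheses (sg0 : 0 < sg) (A0 : 0 < A) (xi0 : 0 < xi) (nu0 : 0 <= nu) (c00 : 0 < c0).
Hypotheses (I0 : (0 < #|I|)%N) (xcA : forall i, 0 <= xc i <= A).
Notation gam := (gd sg).
Notation Phi := (cdf1 (gd sg)).
Implicit Types (x y z t : R).

Notation low := (`]-oo, (- xi)]%classic).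
Notation mid := (`](- xi), (A + xi)]%classic).
Notation high := (`](A + xi), +oo[%classic).

(** A sum of indicators, so that integrals split linearly; [pwE] recovers the definition by
    cases. *)
Definition pw (f1 f2 f3 : R -> R) y : R := \1_low y * f1 y + (\1_mid y * f2 y + \1_high y * f3 y).

Lemma pwE f1 f2 f3 y : pw f1 f2 f3 y =
  if y <= - xi then f1 y else if y <= A + xi then f2 y else f3 y.
Proof.
have hx : - xi < A + xi by rewrite (lt_trans (y := 0)) ?oppr_lt0// addr_gt0.
rewrite /pw !indicE.
have -> : (y \in low) = (y <= - xi) by apply/idP/idP; rewrite inE /= in_itv.
have -> : (y \in mid) = (- xi < y <= A + xi) by apply/idP/idP; rewrite inE /= in_itv.
have -> : (y \in high) = (A + xi < y) by apply/idP/idP; rewrite inE /= in_itv /= andbT.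
rewrite ltNge [A + xi < y]ltNge.
case: (leP y (- xi)) => h /=.
  by rewrite (le_trans h (ltW hx)) /= !mul0r !addr0 mul1r.
by case: (leP y (A + xi)) => h2 /=; rewrite !mul0r !mul1r ?add0r ?addr0.
Qed.

Lemma pw_qg f1 f2 f3 : qg f1 -> qg f2 -> qg f3 -> qg (pw f1 f2 f3).
Proof. by move=> q1 q2 q3; apply: qgD; [|apply: qgD]; apply: qg_indic => //; exact: measurable_itv. Qed.

(** With [norm], the middle piece receives the mass Phi xi - Phi (- xi) that the two Gaussian tails
    leave over, so that the test density has total mass one. *)
Definition II : R := \int[mu]_(y in mid) (expR (- (nu * y))).
Hypothesis norm : c0 * II = Phi xi - Phi (- xi).

(* The test density of Lapidoth, Moser and Wigger: Gaussian tails outside [-xi, A + xi] and an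
   exponential (constant if nu = 0) in between. *)
Definition qf : R -> R := pw gam (fun y => c0 * expR (- (nu * y))) (fun y => gam (y - A)).

Lemma qf_gt0 y : 0 < qf y.
Proof.
rewrite /qf pwE; case: ifP => _; first exact: gd_gt0.
by case: ifP => _; [rewrite mulr_gt0// expR_gt0|exact: gd_gt0].
Qed.

Let kk : R := ln (sg * Num.sqrt (pi *+ 2)).
Let Lam : R := - ln c0 - kk.

Definition Jf : R -> R := pw (fun y => y ^+ 2 / (2 * sg ^+ 2)) (fun y => Lam + nu * y)
  (fun y => (y - A) ^+ 2 / (2 * sg ^+ 2)).

Lemma ln_qf y : ln (qf y) = - kk - Jf y.
Proof.
rewrite /qf /Jf !pwE; case: ifP => _; first by rewrite ln_gd.
case: ifP => _; last by rewrite ln_gd.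
by rewrite lnM2// ?expR_gt0// expRK /Lam; ring.
Qed.

Lemma Jf_qg : qg Jf.
Proof.
have q2 : qg (fun y : R => y ^+ 2 / (2 * sg ^+ 2)).
  by have := qgZ (2 * sg ^+ 2)^-1 (qg_sqr R); congr qg; apply/funext => y; rewrite mulrC.
apply: pw_qg => //; first by apply: qgD; [exact: qg_cst|apply: qgZ; exact: qg_id].
exact: (qg_shift (- A) q2).
Qed.

Lemma mlow : measurable low. Proof. exact: measurable_itv. Qed.
Lemma mmid : measurable mid. Proof. exact: measurable_itv. Qed.
Lemma mhigh : measurable high. Proof. exact: measurable_itv. Qed.

Lemma cexp : continuous (fun y : R => c0 * expR (- (nu * y))).
Proof.
move=> y; apply: cvgM; first exact: cvg_cst.
apply: (continuous_comp (f := fun y : R => - (nu * y)) (g := expR)); last exact: continuous_expR.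
by apply: (@cvgN _ R^o); apply: cvgM; [exact: cvg_cst|exact: cvg_id].
Qed.

Lemma imid : mu.-integrable mid (EFin \o (fun y => c0 * expR (- (nu * y)))).
Proof.
apply: (@integrableS _ _ _ mu `[- xi, A + xi]%classic) => //; first exact: subset_itv_oc_cc.
apply: continuous_compact_integrable; first exact: segment_compact.
apply: continuous_subspaceT; exact: cexp.
Qed.

Lemma intble_indic (S : set (measurableTypeR R)) f : measurable S -> mu.-integrable S (EFin \o f) ->
  intble (fun y => \1_S y * f y).
Proof.
move=> mS hS; have := iffLR (integrable_mkcond _ mS) hS; rewrite /intble; apply: eq_integrable => // y _ /=.
by rewrite patchE indicE; case: (y \in S); rewrite /= ?mul1r ?mul0r.
Qed.

Lemma ilow : intble (fun y => \1_low y * gam y).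
Proof.
apply: intble_indic => //; exact: (integrableS measurableT _ _ (intble_gam sg0)).
Qed.

Lemma ihigh : intble (fun y => \1_high y * gam (y - A)).
Proof.
apply: intble_indic => //; exact: (integrableS measurableT _ _ (intble_gd A sg0)).
Qed.

Lemma qf_intble : intble qf.
Proof.
have i2 := intble_indic mmid imid.
have := integrableD measurableT ilow (integrableD measurableT i2 ihigh).
by rewrite /intble; apply: eq_integrable => // y _.
Qed.

Lemma qf_int : \int[mu]_y qf y <= 1.
Proof.
have i2 := intble_indic mmid imid.
have i23 : intble (fun y => \1_mid y * (c0 * expR (- (nu * y))) + \1_high y * gam (y - A)).
  by have := integrableD measurableT i2 ihigh; rewrite /intble; apply: eq_integrable.
rewrite /qf /pw (intD ilow i23) (intD i2 ihigh) !Rint_indic//.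
have -> : \int[mu]_(y in low) gam y = Phi (- xi) by [].
rewrite RintegralZl//; last first.
  apply: (@integrableS _ _ _ mu `[- xi, A + xi]%classic) => //; first exact: subset_itv_oc_cc.
  apply: continuous_compact_integrable; first exact: segment_compact.
  apply: continuous_subspaceT => y.
  apply: (continuous_comp (f := fun y : R => - (nu * y)) (g := expR)); last exact: continuous_expR.
  by apply: (@cvgN _ R^o); apply: cvgM; [exact: cvg_cst|exact: cvg_id].
rewrite -/II norm.
have -> : \int[mu]_(y in high) gam (y - A) = 1 - Phi xi.
  have hi : intble (fun y => gam (y - A)) := intble_gd A sg0.
  rewrite -(cdf1C hi (int_gd A sg0)) [X in 1 - X](esym (Phi_shift sg0 A (A + xi))).
  by rewrite addrAC subrr add0r.
by lra.
Qed.

Lemma hh_le_J : hh sg xc <= kk + Emix sg xc Jf.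
Proof.
have qln : qg (fun y => ln (qf y)).
  by have := qgB (qg_cst (- kk)) Jf_qg; congr qg; apply/funext => y; rewrite ln_qf.
have := gibbs I0 sg0 xc qf_gt0 qln qf_intble qf_int.
rewrite (_ : (fun y => ln (qf y)) = fun y => - kk - Jf y); last by apply/funext => y; rewrite ln_qf.
rewrite EmixB// ?Emix_cst//; [lra|exact: qg_cst|exact: Jf_qg].
Qed.

(** The probability that the output falls in the middle interval when the input is x. *)
Definition Pm x : R := Phi (A + xi - x) - Phi (- xi - x).

Lemma E1_mid x f : qg f -> E1 sg x (fun y => \1_mid y * f y) =
  \int[mu]_(y in `](- xi - x), (A + xi - x)]) (f (y + x) * gam y).
Proof.
move=> qF; rewrite /E1 -(int_shift x); last first.
  by apply: intble_qg => //; exact: qg_indic mmid qF.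
transitivity (\int[mu]_y (\1_(`](- xi - x), (A + xi - x)]%classic) y * (f (y + x) * gam y))); last exact: Rint_indic.
apply: eq_Rintegral => y _.
rewrite addrK -mulrA; congr (_ * _); rewrite !indicE; congr (_%:R).
by congr nat_of_bool; apply/idP/idP; rewrite !inE /= !in_itv /= ltrBlDr lerBrDr.
Qed.

Lemma mid_lt x : - xi - x < A + xi - x.
Proof. by rewrite ltrD2r (lt_trans (y := 0)) ?oppr_lt0// addr_gt0. Qed.

Lemma E1_mid1 x : E1 sg x (fun y => \1_mid y * 1) = Pm x.
Proof.
rewrite E1_mid; last exact: qg_cst.
rewrite /Pm -(int_mid sg0 (mid_lt x)).
by apply: eq_Rintegral => y _; rewrite mul1r.
Qed.

Lemma E1_mid_id x : E1 sg x (fun y => \1_mid y * y) =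
  x * Pm x + sg ^+ 2 * (gam (xi + x) - gam (A + xi - x)).
Proof.
rewrite E1_mid; last exact: qg_id.
have hc f : continuous f -> mu.-integrable `](- xi - x), (A + xi - x)] (EFin \o f).
  move=> cf; apply: (@integrableS _ _ _ mu `[- xi - x, A + xi - x]%classic) => //.
    exact: subset_itv_oc_cc.
  apply: continuous_compact_integrable; first exact: segment_compact.
  exact: continuous_subspaceT.
have c1 := hc _ (@gd_cont _ sg).
have c2 : mu.-integrable `](- xi - x), (A + xi - x)] (EFin \o (fun y => y * gam y)).
  by apply: hc => y; apply: cvgM; [exact: cvg_id|exact: gd_cont].
have c3 : mu.-integrable `](- xi - x), (A + xi - x)] (EFin \o (fun y => x * gam y)).
  by apply: hc => y; apply: cvgM; [exact: cvg_cst|exact: gd_cont].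
transitivity (\int[mu]_(y in `](- xi - x), (A + xi - x)]) (y * gam y + x * gam y)).
  by apply: eq_Rintegral => y _; rewrite mulrDl.
rewrite RintegralD// RintegralZl// (int_mid sg0 (mid_lt x)) (int_mid_id sg0 (mid_lt x)).
have -> : gam (- xi - x) = gam (xi + x) by rewrite -opprD gdN.
by rewrite /Pm; ring.
Qed.

Lemma q2 : qg (fun y : R => y ^+ 2 / (2 * sg ^+ 2)).
Proof.
by have := qgZ (2 * sg ^+ 2)^-1 (qg_sqr R); congr qg; apply/funext => y; rewrite mulrC.
Qed.

Definition Tl : R := 2^-1 * (1 - Phi xi + xi * gam xi).

Lemma qt : qg (fun y : R => \1_(`[xi, +oo[%classic : set R) y * (y ^+ 2 / (2 * sg ^+ 2))).
Proof. by apply: (@qg_indic _ `[xi, +oo[%classic) q2; exact: measurable_itv. Qed.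

Lemma tail_hi : E1 sg 0 (fun z => \1_(`[xi, +oo[%classic : set R) z * (z ^+ 2 / (2 * sg ^+ 2))) <= Tl.
Proof.
have -> : E1 sg 0 (fun z => \1_(`[xi, +oo[%classic : set R) z * (z ^+ 2 / (2 * sg ^+ 2))) =
   (2 * sg ^+ 2)^-1 * E1 sg 0 (fun z => \1_(`[xi, +oo[%classic : set R) z * z ^+ 2).
  rewrite -E1Z//; first by congr E1; apply/funext => z; ring.
  by apply: qg_indic; [exact: measurable_itv|exact: qg_sqr].
have s2 : 0 < sg ^+ 2 by rewrite exprn_gt0.
rewrite /Tl invfM -mulrA; apply: ler_wpM2l; first by rewrite invr_ge0.
rewrite ler_pdivrMl//.
have := tail_sqr sg0 (ltW xi0).
rewrite Rintegral_itv_obnd_cbnd; last first.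
  have h : intble (fun y => y ^+ 2 * gam y).
    have := intble_qg 0 sg0 (qg_sqr R); rewrite /intble.
    by apply: eq_integrable => // y _ /=; rewrite subr0.
  exact: (integrableS measurableT _ _ h).
rewrite -Rint_indic//; apply: le_trans; rewrite le_eqVlt; apply/orP; left; apply/eqP.
rewrite /E1; apply: eq_Rintegral => y _.
by rewrite -mulrA subr0.
Qed.

(** Among the inputs in [0, A] the upper tail is heaviest at x = A, where it is the tail above xi of
    the centred noise. *)
Lemma E1_high x : 0 <= x <= A ->
  E1 sg x (fun y => \1_high y * ((y - A) ^+ 2 / (2 * sg ^+ 2))) <= Tl.
Proof.
have xi1 := xi0; have A1 := A0.
move=> /andP[x0 xA]; apply: le_trans tail_hi.
have qh : qg (fun y : R => \1_high y * ((y - A) ^+ 2 / (2 * sg ^+ 2))).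
  by apply: qg_indic => //; exact: (qg_shift (- A) q2).
rewrite -[x]add0r E1_shift//; apply: le_E1 => //.
- exact: (qg_shift x qh).
- exact: qt.
move=> y; rewrite !indicE.
have -> : (y + x \in high) = (A + xi < y + x) by apply/idP/idP; rewrite inE /= in_itv /= andbT.
have -> : (y \in `[xi, +oo[%classic) = (xi <= y) by apply/idP/idP; rewrite inE /= in_itv /= andbT.
have i2 : 0 <= (2 * sg ^+ 2)^-1 by rewrite invr_ge0 mulr_ge0 ?sqr_ge0.
case: (ltP (A + xi) (y + x)) => h1; case: (leP xi y) => h2 /=; rewrite ?mul0r ?mul1r//.
- apply: ler_wpM2r => //; apply: lerXn2r; rewrite ?nnegrE; lra.
- exfalso; lra.
- by rewrite mulr_ge0 ?sqr_ge0.
Qed.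

(** The mirror image of [E1_high]: reflecting the noise turns the lower tail into an upper one,
    heaviest at x = 0. *)
Lemma E1_low x : 0 <= x <= A ->
  E1 sg x (fun y => \1_low y * (y ^+ 2 / (2 * sg ^+ 2))) <= Tl.
Proof.
have xi1 := xi0; have A1 := A0.
move=> /andP[x0 xA]; apply: le_trans tail_hi.
have qh : qg (fun y : R => \1_low y * (y ^+ 2 / (2 * sg ^+ 2))) := qg_indic mlow q2.
have qs := qg_shift x qh.
rewrite -[x in E1 _ x]add0r (E1_shift _ _ sg0 qh) -(E1_opp sg0 qs).
have qo := qg_opp qs.
apply: le_E1 => //; first exact: qt.
move=> y; rewrite !indicE.
have -> : (- y + x \in low) = (- y + x <= - xi) by apply/idP/idP; rewrite inE /= in_itv.
have -> : (y \in `[xi, +oo[%classic) = (xi <= y) by apply/idP/idP; rewrite inE /= in_itv /= andbT.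
have i2 : 0 <= (2 * sg ^+ 2)^-1 by rewrite invr_ge0 mulr_ge0 ?sqr_ge0.
case: (leP (- y + x) (- xi)) => h1; case: (leP xi y) => h2 /=; rewrite ?mul0r ?mul1r//.
- apply: ler_wpM2r => //; rewrite -sqrrN; apply: lerXn2r; rewrite ?nnegrE; lra.
- exfalso; lra.
- by rewrite mulr_ge0 ?sqr_ge0.
Qed.

Lemma E1_Jf x : 0 <= x <= A ->
  E1 sg x Jf <= Lam * Pm x + nu * (x * Pm x + sg ^+ 2 * (gam xi - gam (A + xi))) + 2 * Tl.
Proof.
have xi1 := xi0; have A1 := A0.
move=> hx; have /andP[x0 xA] := hx.
have ql := qg_indic mlow q2; have qh := qg_indic mhigh (qg_shift (- A) q2).
have qm1 := qg_indic mmid (qg_cst (1 : R)); have qmi := qg_indic mmid (qg_id R).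
have qm : qg (fun y => \1_mid y * (Lam + nu * y)).
  by apply: qg_indic => //; apply: qgD; [exact: qg_cst|apply: qgZ; exact: qg_id].
rewrite /Jf /pw E1D//; last exact: qgD.
rewrite [E1 _ _ (fun y => \1_mid y * _ + _)]E1D//.
have -> : E1 sg x (fun y => \1_mid y * (Lam + nu * y)) =
    Lam * Pm x + nu * (x * Pm x + sg ^+ 2 * (gam (xi + x) - gam (A + xi - x))).
  have e1 := E1_mid1 x; have e2 := E1_mid_id x.
  rewrite -e2 -e1 -!E1Z// -E1D//; [|exact: qgZ|exact: qgZ].
  by congr E1; apply/funext => y; ring.
have h1 := E1_low hx; have h2 := E1_high hx.
have g1 : gam (xi + x) <= gam xi by apply: (gam_dec sg0); lra.
have g2 : gam (A + xi) <= gam (A + xi - x) by apply: (gam_dec sg0); lra.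
have h3 : nu * (x * Pm x + sg ^+ 2 * (gam (xi + x) - gam (A + xi - x))) <=
   nu * (x * Pm x + sg ^+ 2 * (gam xi - gam (A + xi))).
  by rewrite ler_wpM2l// lerD2l ler_wpM2l ?sqr_ge0//; lra.
lra.
Qed.

Definition dPm x : R := gam (xi + x) - gam (A + xi - x).

Lemma Pm_derive x : is_derive x 1 Pm (dPm x).
Proof.
have h1 := Phi_derive sg0 (A + xi - x); have h2 := Phi_derive sg0 (- xi - x).
have e (c : R) : is_derive x 1 (fun x : R => c - x) (- 1).
  have -> : (fun x : R => c - x) = cst c - id by [].
  by apply: is_derive_eq; rewrite sub0r.
have h3 : is_derive x 1 (Phi \o (fun x : R => A + xi - x)) (gam (A + xi - x) * - 1).
  exact: is_derive1_comp.
have h4 : is_derive x 1 (Phi \o (fun x : R => - xi - x)) (gam (- xi - x) * - 1).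
  exact: is_derive1_comp.
have -> : Pm = (Phi \o (fun x : R => A + xi - x)) - (Phi \o (fun x : R => - xi - x)) by [].
apply: is_derive_eq; rewrite /dPm -opprD gdN; ring.
Qed.

Lemma dPm_dec x y : 0 <= x -> x <= y -> y <= A -> dPm y <= dPm x.
Proof.
have xi1 := xi0; have A1 := A0.
move=> x0 xy yA; rewrite /dPm.
have g1 : gam (xi + y) <= gam (xi + x) by apply: (gam_dec sg0); lra.
have g2 : gam (A + xi - x) <= gam (A + xi - y) by apply: (gam_dec sg0); lra.
lra.
Qed.

(** [Pm] is concave on [0, A] because its derivative decreases there. *)
Lemma Pm_tangent x0 x : 0 <= x0 <= A -> 0 <= x <= A -> Pm x <= Pm x0 + dPm x0 * (x - x0).
Proof.
have xi1 := xi0; have A1 := A0.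
move=> /andP[a0 aA] /andP[b0 bA].
have Pc : continuous Pm by move=> t; exact: derive_cont (Pm_derive t).
have [xx|xx|->] := ltgtP x0 x; last by rewrite subrr mulr0 addr0.
- have [|c] := MVT xx (fun t _ => Pm_derive t); first exact: continuous_subspaceT.
  rewrite in_itv /= => /andP[c1 c2] h.
  have : dPm c * (x - x0) <= dPm x0 * (x - x0).
    by apply: ler_wpM2r; [lra|apply: (dPm_dec (x := x0) (y := c)); lra].
  lra.
- have [|c] := MVT xx (fun t _ => Pm_derive t); first exact: continuous_subspaceT.
  rewrite in_itv /= => /andP[c1 c2] h.
  have : dPm x0 * (x0 - x) <= dPm c * (x0 - x).
    by apply: ler_wpM2r; [lra|apply: (dPm_dec (x := c) (y := x0)); lra].
  lra.
Qed.

Lemma Pm_max x : 0 <= x <= A -> Pm x <= Pm (A / 2).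
Proof.
have xi1 := xi0; have A1 := A0.
move=> hx; have := Pm_tangent (x0 := A / 2) _ hx.
have -> : dPm (A / 2) = 0.
  by rewrite /dPm (_ : A + xi - A / 2 = xi + A / 2) ?subrr//; field.
by rewrite mul0r addr0; apply; apply/andP; split; lra.
Qed.

Lemma Pm_ge0 x : 0 <= Pm x.
Proof. by rewrite subr_ge0; apply: Phi_le => //; exact/ltW/mid_lt. Qed.

(** Jensen's inequality through the tangent at x0. To the left of A/2 the tangent has nonnegative
    slope, so an upper bound on the mean suffices. *)
Lemma avg_Pm_concave x0 : 0 <= x0 <= A / 2 -> avg xc <= x0 -> avg (fun i => Pm (xc i)) <= Pm x0.
Proof.
have xi1 := xi0; have A1 := A0.
move=> /andP[a0 aA] hx.
apply: (@le_trans _ _ (avg (fun i => (Pm x0 - dPm x0 * x0) + dPm x0 * xc i))).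
  apply: le_avg => i; have := Pm_tangent (x0 := x0) _ (xcA i).
  have -> : 0 <= x0 <= A by apply/andP; split; lra.
  by move=> /(_ isT); lra.
rewrite avgD avg_cst// avgZ.
have d0 : 0 <= dPm x0.
  have -> : 0 = dPm (A / 2).
    by rewrite /dPm (_ : A + xi - A / 2 = xi + A / 2) ?subrr//; field.
  by apply: dPm_dec; lra.
have := ler_wpM2l d0 hx; lra.
Qed.

Lemma avg_xPm (m : R) : avg xc <= m -> avg (fun i => xc i * Pm (xc i)) <= m * Pm (A / 2).
Proof.
move=> hm; apply: (@le_trans _ _ (avg (fun i => xc i * Pm (A / 2)))).
  by apply: le_avg => i; have /andP[h1 h2] := xcA i; rewrite ler_wpM2l// Pm_max.
by rewrite avgZr ler_wpM2r// Pm_ge0.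
Qed.

(* The coefficient of P(middle) is nonnegative, so P may be replaced by an upper bound. *)
Lemma Lam_ge0 : 2 * xi <= II -> 0 <= Lam.
Proof.
move=> hI; have h := sqrt2pi_gt0 R.
have xx : - xi < xi by rewrite (lt_trans (y := 0)) ?oppr_lt0.
have [|c _ hc] := MVT xx (fun t _ => Phi_derive sg0 t).
  exact: continuous_subspaceT (Phi_cont sg0).
have g0 : gam c <= (sg * Num.sqrt (pi *+ 2))^-1 by exact: gd_le.
set k := sg * Num.sqrt (pi *+ 2) in g0 *.
have k0 : 0 < k by rewrite mulr_gt0.
have h2 : c0 * II <= k^-1 * (2 * xi).
  rewrite norm hc (_ : xi - - xi = 2 * xi); last by ring.
  by rewrite ler_wpM2r// mulr_ge0// ltW.
have h3 : c0 <= k^-1.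
  have : c0 * (2 * xi) <= k^-1 * (2 * xi).
    by apply: le_trans h2; rewrite ler_wpM2l// ltW.
  by rewrite ler_pM2r// mulr_gt0.
have : ln c0 <= ln k^-1 by rewrite ler_ln ?posrE ?invr_gt0.
by rewrite lnV ?posrE// /Lam /kk -/k; lra.
Qed.

Lemma hh_le_gen (P0 m : R) : 2 * xi <= II -> avg (fun i => Pm (xc i)) <= P0 -> avg xc <= m ->
  hh sg xc <= kk + (P0 * Lam + nu * (m * Pm (A / 2) + sg ^+ 2 * (gam xi - gam (A + xi))) + 2 * Tl).
Proof.
have xi1 := xi0; have A1 := A0.
move=> hI hP hm; apply: (le_trans hh_le_J); rewrite lerD2l.
have L0 := Lam_ge0 hI.
apply: (@le_trans _ _ (avg (fun i => Lam * Pm (xc i) + nu * (xc i * Pm (xc i)) +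
   (nu * (sg ^+ 2 * (gam xi - gam (A + xi))) + 2 * Tl)))).
  by apply: le_avg => i; have := E1_Jf (xcA i); rewrite mulrDr; lra.
rewrite avgD avg_cst// avgD !avgZ.
have h1 := ler_wpM2l L0 hP; have h2 := ler_wpM2l nu0 (avg_xPm hm).
rewrite mulrDr; lra.
Qed.

End LMW.

(** * From the test density to [Cbar] *)

Section CbarBound.
Variable R : realType.
Variables (sg : R) (I : finType) (xc : I -> R).
Hypotheses (sg0 : 0 < sg) (I0 : (0 < #|I|)%N).
Notation Phi := (cdf1 (gd sg)).

Definition hnoise : R := 2^-1 * ln (pi *+ 2 * expR 1 * sg ^+ 2).

Lemma hnoiseE : hnoise = ln (sg * Num.sqrt (pi *+ 2)) + 2^-1.
Proof.
have q0 := sqrt2pi_gt0 R; have p0 := pi_gt0 R.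
have k0 : 0 < sg * Num.sqrt (pi *+ 2) by rewrite mulr_gt0.
rewrite /hnoise (_ : pi *+ 2 * expR 1 * sg ^+ 2 = (sg * Num.sqrt (pi *+ 2)) ^+ 2 * expR 1); last first.
  by rewrite exprMn sqr_sqrtr; [ring|rewrite pmulrn_lge0// ltW].
by rewrite lnM2 ?exprn_gt0 ?expR_gt0// expRK lnXn// -mulr_natr; field.
Qed.

Lemma lnVdiv (c k : R) : 0 < c -> 0 < k -> ln (c^-1 / k) = - ln c - ln k.
Proof. by move=> c0 k0; rewrite lndiv2 ?invr_gt0// lnV. Qed.

Lemma log2_mul_ln2 (x : R) : ln 2 * log2 x = ln x.
Proof. by rewrite /log2 mulrC divfK// gt_eqF// ln_gt0// ltr1n. Qed.

Lemma ln2_split (P X Y : R) : ln 2 * (P * log2 X + log2 (expR 1) * Y) = P * ln X + Y.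
Proof. by rewrite mulrDr mulrCA log2_mul_ln2 mulrA log2_mul_ln2 expRK mul1r. Qed.

Lemma hh_le_noise : (forall i, xc i = 0) -> hh sg xc <= hnoise.
Proof.
move=> xc0; have q0 := sqrt2pi_gt0 R.
have q2 : qg (fun y : R => y ^+ 2 / (2 * sg ^+ 2)).
  by have := qgZ (2 * sg ^+ 2)^-1 (qg_sqr R); congr qg; apply/funext => y; rewrite mulrC.
have pmE y : ln (pm sg xc y) = - ln (sg * Num.sqrt (pi *+ 2)) - y ^+ 2 / (2 * sg ^+ 2).
  rewrite -ln_gd// /pm -[gd sg y](avg_cst _ I0); congr (ln _).
  by apply: eq_avg => i; rewrite xc0 subr0.
rewrite /hh (_ : (fun y => ln (pm sg xc y)) =
  fun y => - ln (sg * Num.sqrt (pi *+ 2)) - y ^+ 2 / (2 * sg ^+ 2)); last by apply/funext.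
rewrite EmixB//; [|exact: qg_cst].
rewrite Emix_cst// opprB opprK addrC hnoiseE lerD2l.
rewrite -[2^-1](avg_cst _ I0); apply: le_avg => i; rewrite xc0.
have -> : E1 sg 0 (fun y => y ^+ 2 / (2 * sg ^+ 2)) = (2 * sg ^+ 2)^-1 * E1 sg 0 (fun y => y ^+ 2).
  rewrite -(E1Z _ _ sg0 (qg_sqr R)); congr E1; apply/funext => y; exact: mulrC.
have h := E1_sqr sg0; have s2 : 0 < sg ^+ 2 by rewrite exprn_gt0.
by rewrite ler_pdivrMl ?mulr_gt0// mulrAC divff// mul1r.
Qed.

Section Pos.
Variables (A a : R).
Hypotheses (A0 : 0 < A) (xcA : forall i, 0 <= xc i <= A) (xcm : avg xc <= a * A).

Lemma PhiQ x : Qfun (x / sg) = 1 - Phi x. Proof. exact: QfunE. Qed.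

Lemma one_sub2Q (xi : R) : 0 < xi -> 1 - 2 * Qfun (xi / sg) = Phi xi - Phi (- xi).
Proof. by move=> xi0; rewrite PhiQ Phi_opp//; ring. Qed.

Lemma PmQ (xi x : R) : Pm sg A xi x = 1 - Qfun ((xi + x) / sg) - Qfun ((xi + (A - x)) / sg).
Proof.
rewrite /Pm !PhiQ (_ : - xi - x = - (xi + x)); last by ring.
by rewrite Phi_opp// (_ : A + xi - x = xi + (A - x)); ring.
Qed.

Lemma II_pos (xi nu : R) : 0 < xi -> 0 < nu ->
  II A xi nu = (expR (nu * xi) - expR (- (nu * (A + xi)))) / nu.
Proof.
move=> xi0 nu0; rewrite /II.
have hx : - xi < A + xi by rewrite (lt_trans (y := 0)) ?oppr_lt0// addr_gt0.
have hl (y : R) : is_derive y 1 (fun y : R => - (nu * y)) (- nu).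
  have -> : (fun y : R => - (nu * y)) = - (nu *: id) by [].
  by apply: is_derive_eq; rewrite /GRing.scale /= mulr1.
have hd (y : R) : is_derive y 1 (- nu^-1 *: (expR \o (fun y : R => - (nu * y))))
     (expR (- (nu * y))).
  have h := hl y.
  have h2 : is_derive y 1 (expR \o (fun y : R => - (nu * y))) (expR (- (nu * y)) * (- nu)).
    exact: is_derive1_comp.
  by apply: is_derive_eq; rewrite /GRing.scale /=; field; rewrite gt_eqF.
have hc : continuous (fun y : R => expR (- (nu * y))).
  move=> y; apply: (continuous_comp (f := fun y : R => - (nu * y)) (g := expR)); last exact: continuous_expR.
  exact: derive_cont (hl y).
rewrite (FTC_itv hx hc hd).
have scE t : (- nu^-1 *: (expR \o (fun y : R => - (nu * y)))) t = - nu^-1 * expR (- (nu * t)) by [].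
by rewrite !scE mulrN opprK; ring.
Qed.

Lemma sinh_ge (t : R) : 0 <= t -> 2 * t <= expR t - expR (- t).
Proof.
rewrite le_eqVlt => /orP[/eqP<-|t0]; first by rewrite oppr0 subrr mulr0.
pose f (x : R) := expR x - expR (- x).
have hd (x : R) : is_derive x 1 f (expR x + expR (- x)).
  have he (z : R) : is_derive z 1 (expR : R -> R) (expR z) by exact: is_derive_expR.
  have h1 := he x; have h2 := he (- x).
  have h3 : is_derive x 1 (expR \o (-%R : R -> R)) (expR (- x) * (- 1)) by exact: is_derive1_comp.
  have -> : f = (expR : R -> R) - (expR \o (-%R : R -> R)) by [].
  by apply: is_derive_eq; ring.
have [|c _] := MVT t0 (fun x _ => hd x).
  by apply: continuous_subspaceT => x; exact: derive_cont (hd x).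
rewrite /f oppr0 subrr !subr0 => ->.
rewrite ?oppr0 ?addr0; apply: ler_wpM2r; [exact: ltW|rewrite expRN].
have e0 := expR_gt0 c; have e1 : expR c * (expR c)^-1 = 1 by rewrite divff// gt_eqF.
have i0 : 0 < (expR c)^-1 by rewrite invr_gt0.
by have := sqr_ge0 (expR c - (expR c)^-1); nra.
Qed.

(** The middle interval contains [-xi, xi], over which the exponential integrates to 2 sinh (nu xi)
    / nu. This is the premise of [Lam_ge0]. *)
Lemma II_ge (xi nu : R) : 0 < xi -> 0 < nu -> 2 * xi <= II A xi nu.
Proof.
move=> xi0 nu0; have A1 := A0; rewrite II_pos// ler_pdivlMr//.
have : expR (- (nu * (A + xi))) <= expR (- (nu * xi)).
  by rewrite ler_expR lerN2 ler_wpM2l ?ltW//; lra.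
have := sinh_ge (t := nu * xi) (mulr_ge0 (ltW nu0) (ltW xi0)).
lra.
Qed.

(** Here a < 1/2 places a A to the left of A/2, so that Jensen's inequality may be used at a A. *)
Lemma hh_le_c1_obj (mu xi : R) : 0 <= a -> a < 2^-1 -> 0 < mu -> 0 < xi ->
  hh sg xc <= hnoise + ln 2 * c1_obj sg A a mu xi.
Proof.
move=> a0 a2 mu0 xi0; have q0 := sqrt2pi_gt0 R; have A1 := A0.
(* The parameter mu is the decay of the exponential over the whole amplitude A, while [nu] is the
   decay per unit. *)
set nu := mu / A; have nu0 : 0 < nu by rewrite divr_gt0.
have Pd : 0 < Phi xi - Phi (- xi).
  by rewrite subr_gt0 Phi_lt//; lra.
have I2 := II_ge xi0 nu0.
have I1 : 0 < II A xi nu by apply: lt_le_trans I2; rewrite mulr_gt0.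
set c0 := (Phi xi - Phi (- xi)) / II A xi nu.
have c00 : 0 < c0 by rewrite divr_gt0.
have norm : c0 * II A xi nu = Phi xi - Phi (- xi) by rewrite /c0 divfK// gt_eqF.
have hP : avg (fun i => Pm sg A xi (xc i)) <= Pm sg A xi (a * A).
  apply: avg_Pm_concave => //; apply/andP; split; first by apply: mulr_ge0 => //; exact: ltW.
  by rewrite [leRHS]mulrC; apply: ler_wpM2r; exact: ltW.
have := hh_le_gen sg0 A0 xi0 (ltW nu0) c00 I0 xcA norm I2 hP xcm.
move=> h; apply: (le_trans h); rewrite hnoiseE /c1_obj.
rewrite ln2_split.
have -> : 1 - Qfun ((xi + a * A) / sg) - Qfun ((xi + (1 - a) * A) / sg) = Pm sg A xi (a * A).
  by rewrite PmQ mulrBl mul1r.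
have -> : 1 - 2 * Qfun ((xi + A / 2) / sg) = Pm sg A xi (A / 2).
  by rewrite PmQ (_ : A - A / 2 = A / 2); [rewrite mulr_natl mulr2n opprD addrA|field].
rewrite one_sub2Q//.
set E1' := expR (mu * xi / A); set E2' := expR (- (mu * (1 + xi / A))).
have e1 : expR (nu * xi) = E1' by rewrite /E1' /nu mulrAC.
have e2 : expR (- (nu * (A + xi))) = E2'.
  by rewrite /E2' /nu; congr (expR (- _)); field; rewrite gt_eqF.
have -> : ln (A / sg * (E1' - E2') / (Num.sqrt (pi *+ 2) * mu * (Phi xi - Phi (- xi)))) =
   - ln c0 - ln (sg * Num.sqrt (pi *+ 2)).
  transitivity (ln (c0^-1 / (sg * Num.sqrt (pi *+ 2)))); last first.
    by apply: lnVdiv => //; rewrite mulr_gt0.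
  apply: (congr1 (@ln R)).
  rewrite /c0 invf_div II_pos// e1 e2 /nu.
  by field; rewrite !gt_eqF.
rewrite /Tl PhiQ.
have g1 z : gd sg z = (sg * Num.sqrt (pi *+ 2))^-1 * expR (- (z ^+ 2) / (2 * sg ^+ 2)) by [].
rewrite !g1.
set L1 := - ln c0 - _; set P1 := Pm _ _ _ _; set P2 := Pm _ _ _ (A / 2).
set X1 := expR (- (xi ^+ 2) / _); set X2 := expR (- ((A + xi) ^+ 2) / _).
rewrite le_eqVlt; apply/orP; left; apply/eqP; rewrite /nu.
by field; rewrite !gt_eqF.
Qed.

(** The flat case nu = 0: the mean drops out of the bound, and [Pm] is replaced by its maximum,
    attained at A/2. *)
Lemma hh_le_c2_obj (xi : R) : 0 < xi -> hh sg xc <= hnoise + ln 2 * c2_obj sg A xi.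
Proof.
move=> xi0; have q0 := sqrt2pi_gt0 R; have A1 := A0.
have Pd : 0 < Phi xi - Phi (- xi).
  by rewrite subr_gt0 Phi_lt//; lra.
have hx : - xi < A + xi by rewrite (lt_trans (y := 0)) ?oppr_lt0// addr_gt0.
have IE : II A xi 0 = A + 2 * xi.
  rewrite /II; have hd (y : R) : is_derive y 1 (id : R -> R) (expR (- (0 * y))).
    by rewrite mul0r oppr0 expR0; exact: is_derive_id.
  have hc : continuous (fun y : R => expR (- (0 * y))).
    by under eq_fun do rewrite mul0r oppr0 expR0; move=> y; exact: cvg_cst.
  by rewrite (FTC_itv hx hc hd); ring.
have I2 : 2 * xi <= II A xi 0 by rewrite IE; lra.
have I1 : 0 < II A xi 0 by apply: lt_le_trans I2; rewrite mulr_gt0.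
set c0 := (Phi xi - Phi (- xi)) / II A xi 0.
have c00 : 0 < c0 by rewrite divr_gt0.
have norm : c0 * II A xi 0 = Phi xi - Phi (- xi) by rewrite /c0 divfK// gt_eqF.
have hP : avg (fun i => Pm sg A xi (xc i)) <= Pm sg A xi (A / 2).
  by rewrite -[leRHS](avg_cst _ I0); apply: le_avg => i; exact: Pm_max.
have := hh_le_gen sg0 A0 xi0 (lexx 0) c00 I0 xcA norm I2 hP xcm.
move=> h; apply: (le_trans h); rewrite hnoiseE /c2_obj.
rewrite ln2_split.
have -> : 1 - 2 * Qfun ((xi + A / 2) / sg) = Pm sg A xi (A / 2).
  by rewrite PmQ (_ : A - A / 2 = A / 2); [rewrite mulr_natl mulr2n opprD addrA|field].
rewrite one_sub2Q//.
have -> : ln ((A + 2 * xi) / (sg * Num.sqrt (pi *+ 2) * (Phi xi - Phi (- xi)))) =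
   - ln c0 - ln (sg * Num.sqrt (pi *+ 2)).
  transitivity (ln (c0^-1 / (sg * Num.sqrt (pi *+ 2)))); last first.
    by apply: lnVdiv => //; rewrite mulr_gt0.
  apply: (congr1 (@ln R)).
  rewrite /c0 invf_div IE.
  by field; rewrite !gt_eqF.
rewrite /Tl PhiQ /gd.
set L1 := - ln c0 - _; set P2 := Pm _ _ _ (A / 2).
set X1 := expR (- (xi ^+ 2) / _).
rewrite le_eqVlt; apply/orP; left; apply/eqP.
by field; rewrite !gt_eqF.
Qed.

End Pos.

(** Every admissible choice of parameters yields a bound, so their infimum does too, attained or
    not. For A = 0 only the noise is left. *)
Theorem hh_le_Cbar (A a : R) : 0 <= A -> 0 <= a -> (forall i, 0 <= xc i <= A) ->
  avg xc <= a * A -> hh sg xc <= hnoise + ln 2 * Cbar sg A a.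
Proof.
move=> A0 a0 xcA xcm; have l2 : 0 < ln 2 :> R by rewrite ln_gt0// ltr1n.
rewrite /Cbar; case: eqVneq => [A00|An0].
  rewrite mulr0 addr0; apply: hh_le_noise => i; have := xcA i.
  by rewrite A00 => h; apply/eqP; rewrite eq_le andbC.
have Ap : 0 < A by rewrite lt_neqAle eq_sym An0.
rewrite -lerBlDl mulrC -ler_pdivrMr//.
case: ifPn => [a2|_].
  apply: lb_le_inf.
    by exists (c1_obj sg A a 1 1), 1, 1; rewrite ltr01.
  move=> _ [mu [xi [mu0 [xi0 ->]]]]; rewrite ler_pdivrMr// mulrC lerBlDl.
  exact: (hh_le_c1_obj Ap xcA xcm).
apply: lb_le_inf; first by exists (c2_obj sg A 1), 1 => //=; exact: ltr01.
move=> _ [xi xi0 <-]; rewrite ler_pdivrMr// mulrC lerBlDl.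
exact: (hh_le_c2_obj Ap xcA xcm).
Qed.

End CbarBound.

(** * Truncated exponential signals *)

Section Signal.
Variable R : realType.

(* The quantile function, on [0, kap], of the law of maximal entropy with mean at most th * kap: a
   truncated exponential, or the uniform law if th >= 1/2. When mu_star th is its junk value 0, rho th
   is 0 and the zero signal is good enough. *)
Definition signal (th kap s : R) : R :=
  if th < 2^-1 then
    let m := mu_star th in
    if 0 < m then kap / m * (- ln (1 - s * (1 - expR (- m)))) else 0
  else kap * s.

Lemma signalZ (th c kap s : R) : signal th (c * kap) s = c * signal th kap s.
Proof.
rewrite /signal; case: ifP => _; last by rewrite mulrA.
by case: ifP => _; rewrite ?mulr0// !mulrA.
Qed.

Section TruncExp.
Variable m : R.
Hypothesis m0 : 0 < m.
(** [V] below is m times the quantile function of the exponential law of rate m truncated to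
    [0, 1]. *)
Let d : R := 1 - expR (- m).
Let w (s : R) : R := 1 - s * d.
Let V (s : R) : R := - ln (w s).
Implicit Types s t u a : R.

Lemma d01 : 0 < d < 1.
Proof.
have e0 := expR_gt0 (- m); have : expR (- m) < 1 by rewrite -expR0 ltr_expR oppr_lt0.
by rewrite /d => h; apply/andP; split; lra.
Qed.

Lemma w_bnd s : 0 <= s <= 1 -> expR (- m) <= w s <= 1.
Proof.
have /andP[d0 d1] := d01; move=> /andP[s0 s1]; rewrite /w.
have h1 : 0 <= s * d by rewrite mulr_ge0// ltW.
have h2 : s * d <= 1 * d by rewrite ler_wpM2r// ltW.
have -> : expR (- m) = 1 - d by rewrite /d; ring.
by apply/andP; split; lra.
Qed.

Lemma w_gt0 s : 0 <= s <= 1 -> 0 < w s.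
Proof. by move=> /w_bnd/andP[h _]; apply: lt_le_trans h; exact: expR_gt0. Qed.

Lemma V_bnd s : 0 <= s <= 1 -> 0 <= V s <= m.
Proof.
move=> hs; have /andP[h1 h2] := w_bnd hs; have w0 := w_gt0 hs; rewrite /V oppr_ge0 ln_le0//=.
by rewrite lerNl -[- m]expRK ler_ln ?posrE ?expR_gt0.
Qed.

Lemma w_derive t : is_derive t 1 w (- d).
Proof.
have -> : w = cst 1 - d *: id by apply/funext => s; rewrite /w mulrC.
by apply: is_derive_eq; rewrite /GRing.scale /= mulr1 sub0r.
Qed.

Lemma lnw_derive t : 0 <= t <= 1 -> is_derive t 1 (@ln R \o w) (- (d / w t)).
Proof.
move=> ht; have h1 := w_derive t; have h2 := is_derive1_ln (w_gt0 ht).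
by rewrite mulrC -mulrN; exact: is_derive1_comp.
Qed.

Lemma V_derive t : 0 <= t <= 1 -> is_derive t 1 V (d / w t).
Proof.
move=> ht; have h := lnw_derive ht.
have -> : V = - (@ln R \o w) by [].
by apply: is_derive_eq; rewrite opprK.
Qed.

Lemma VG_derive t : 0 <= t <= 1 ->
  is_derive t 1 (fun s => d^-1 * (w s * ln (w s) - w s)) (V t).
Proof.
move=> ht; have h := lnw_derive ht; have h2 := w_derive t.
have -> : (fun s => d^-1 * (w s * ln (w s) - w s)) = d^-1 *: (w * (@ln R \o w) - w) by [].
apply: is_derive_eq; rewrite /GRing.scale /= /V.
have /andP[d0 _] := d01; have w0 := w_gt0 ht.
by field; rewrite !gt_eqF.
Qed.

Lemma VG_diff : d^-1 * (w 1 * ln (w 1) - w 1) - d^-1 * (w 0 * ln (w 0) - w 0) =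
  m * (m^-1 - expR (- m) / (1 - expR (- m))).
Proof.
have w1 : w 1 = expR (- m) by rewrite /w /d; ring.
have w00 : w 0 = 1 by rewrite /w; ring.
rewrite w1 w00 ln1 expRK -/d; have /andP[d0 _] := d01.
have -> : expR (- m) = 1 - d by rewrite /d; ring.
by field; rewrite !gt_eqF.
Qed.

Lemma V_le s t : 0 <= s -> s <= t -> t <= 1 -> V s <= V t.
Proof.
move=> s0 st t1; have /andP[d0 _] := d01.
have hs : 0 <= s <= 1 by rewrite s0 (le_trans st).
have ht : 0 <= t <= 1 by rewrite (le_trans s0 st).
by rewrite /V lerN2 ler_ln ?posrE ?w_gt0// /w lerD2l lerN2 ler_wpM2r// ltW.
Qed.

Lemma dV_bnd t : 0 <= t <= 1 -> d <= d / w t <= d * expR m.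
Proof.
move=> ht; have /andP[d0 _] := d01; have w0 := w_gt0 ht; have /andP[h1 h2] := w_bnd ht.
apply/andP; split; first by rewrite ler_pdivlMr// ler_piMr// ltW.
rewrite ler_pM2l// -[expR m]invrK -expRN lef_pV2 ?posrE ?expR_gt0//.
Qed.

Lemma V_lip t u : 0 <= t <= 1 -> 0 <= u <= 1 -> `|V t - V u| <= d * expR m * `|t - u|.
Proof.
wlog tu : t u / t <= u.
  move=> h ht hu; have [tu|ut] := leP t u; first exact: h.
  by rewrite distrC [`|t - u|]distrC; apply: h => //; exact: ltW.
move=> ht hu; move: (tu); rewrite le_eqVlt => /orP[/eqP->|tu'].
  by rewrite !subrr normr0 mulr0.
have /andP[t0 _] := ht; have /andP[_ u1] := hu.
have hin z : z \in `]t, u[ -> 0 <= z <= 1.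
  by rewrite in_itv /= => /andP[? ?]; rewrite (le_trans t0) ?(le_trans _ u1)// ltW.
have [||c ci hc] := MVT tu' (f := V) (df := fun z => d / w z).
- by move=> z /hin; exact: V_derive.
- apply: derivable_within_continuous => z; rewrite in_itv /= => /andP[? ?].
  by have [] : is_derive z 1 V (d / w z) by apply: V_derive; rewrite (le_trans t0)// (le_trans _ u1).
- rewrite distrC hc [`|t - u|]distrC normrM ler_wpM2r//.
  have /andP[b1 b2] := dV_bnd (hin _ ci); rewrite ger0_norm//.
  by apply: le_trans b1; have /andP[/ltW] := d01.
Qed.

(** [V] is nondecreasing, so sums over left endpoints stay below the integral: the discrete signal
    obeys the mean constraint for every N, with no error term. *)
Lemma V_avg (N : nat) : (0 < N)%N ->
  avg (fun j : 'I_N => V (j%:R / N%:R)) <= m * (m^-1 - expR (- m) / (1 - expR (- m))).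
Proof.
move=> N0; rewrite -VG_diff.
have := @riemann_le _ V _ 0 N N0 VG_derive; rewrite mul0r addr0; apply.
by move=> t u t0 tu u1 _; rewrite addr0; exact: V_le.
Qed.

Section E.
Variable sg : R.
Hypothesis sg0 : 0 < sg.
Notation Phi := (cdf1 (gd sg)).

Lemma Phi01' a : 0 <= Phi a <= 1.
Proof. by have /andP[? ?] := Phi01 sg0 a; rewrite !ltW. Qed.

Lemma V_cont t : 0 <= t <= 1 -> {for t, continuous V}.
Proof. by move=> ht; exact: derive_cont (V_derive ht). Qed.

Lemma dV_cont t : 0 <= t <= 1 -> {for t, continuous (fun t => d / w t)}.
Proof.
move=> ht; apply: cvgM; first exact: cvg_cst.
apply: cvgV; first by rewrite gt_eqF// w_gt0.
exact: (derive_cont (w_derive t)).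
Qed.

Lemma V_Phi : E1 sg 0 (fun a => V (Phi a)) = m * (m^-1 - expR (- m) / (1 - expR (- m))).
Proof.
rewrite -VG_diff.
apply: (push_primitive sg0 (g := V) (G := fun s => d^-1 * (w s * ln (w s) - w s)) VG_derive).
- by move=> t /andP[t0 t1]; apply: V_cont; rewrite !ltW.
- by move=> t /andP[t0 t1]; have /andP[] : 0 <= V t <= m by apply: V_bnd; rewrite !ltW.
Qed.

Lemma qg_VPhi : qg (fun a => V (Phi a)).
Proof.
apply: (@qg_bounded _ _ m); last first.
  by move=> a; have /andP[h1 h2] := V_bnd (Phi01' a); rewrite ger0_norm.
apply: continuous_measurable_fun => a.
apply: (continuous_comp (f := Phi) (g := V)); first exact: Phi_cont.
exact: V_cont (Phi01' a).
Qed.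

Lemma epi_truncexp (I : finType) (xc : I -> R) (B k : R) (N : nat) : (0 < #|I|)%N ->
  (forall i, 0 <= xc i <= B) -> 0 < k -> (0 < N)%N ->
  2^-1 * ln (expR (2 * (ln (k * d / m) + m * (m^-1 - expR (- m) / (1 - expR (- m))))) +
             expR (2 * hh sg xc)) -
    (E1 sg 0 (fun y => `|y|) + 2 * B + 3 * k) / sg ^+ 2 * (k / m * (d * expR m)) / N%:R
  <= hh sg (grid xc (fun s => k / m * V s) (N := N)).
Proof.
move=> I0 xcB k0 N0; have /andP[d0 d1] := d01; have km : 0 < k / m by rewrite divr_gt0.
apply: (epi_one sg0 I0 xcB (dT := fun s => k / m * (d / w s)) (l := k / m * d)) => //.
- move=> t /V_bnd/andP[h1 h2]; apply/andP; split; first by apply: mulr_ge0 => //; exact: ltW.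
  by rewrite -ler_pdivlMl// invf_div mulrAC -mulrA divff ?mulr1// gt_eqF.
- move=> t /andP[t0 t1]; have h : is_derive t 1 V (d / w t) by apply: V_derive; rewrite !ltW.
  have -> : (fun s => k / m * V s) = (k / m) *: V by [].
  exact: is_derive_eq.
- move=> t /andP[t0 t1]; apply: cvgM; first exact: cvg_cst.
  by apply: dV_cont; rewrite !ltW.
- move=> t /andP[t0 t1]; have /andP[h1 h2] : d <= d / w t <= d * expR m by apply: dV_bnd; rewrite !ltW.
  by rewrite (ler_pM2l km) h1 (ler_pM2l km) h2.
- exact: mulr_gt0.
- move=> t u ht hu; rewrite -mulrBr normrM (gtr0_norm km) -mulrA ler_pM2l//.
  exact: V_lip.
(* The logarithm of the derivative of the quantile function is a constant plus [V], so the entropy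
   reduces to the mean of [V]. *)
- rewrite -V_Phi -(E1_cst 0 (ln (k * d / m)) sg0) -E1D//; [|exact: qg_cst|exact: qg_VPhi].
  rewrite le_eqVlt; apply/orP; left; apply/eqP; congr E1; apply/funext => a.
  have w0 := w_gt0 (Phi01' a).
  by rewrite /V -lndiv2// ?divr_gt0 ?mulr_gt0//; congr (ln _); field; rewrite !gt_eqF.
Qed.

End E.
End TruncExp.

(** Positivity excludes the default value 0 of [xget], so the defining equation can be read off. *)
Lemma mu_star_spec (a : R) : 0 < mu_star a ->
  a = (mu_star a)^-1 - expR (- mu_star a) / (1 - expR (- mu_star a)).
Proof.
rewrite /mu_star; set P := [set _ | _].
case: (xgetP 0 P) => [y -> [_]//|_]; rewrite ltxx//.
Qed.

Lemma mu_star_ge0 (a : R) : 0 <= mu_star a.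
Proof.
rewrite /mu_star; set P := [set _ | _].
by case: (xgetP 0 P) => [y -> [/ltW]//|_].
Qed.

Lemma signal_bnd (th kap s : R) : 0 <= kap -> 0 <= s <= 1 -> 0 <= signal th kap s <= kap.
Proof.
move=> k0 hs; rewrite /signal; case: ifP => _; last first.
  by have /andP[s0 s1] := hs; rewrite mulr_ge0//= ler_piMr.
case: ifP => [m0|_]; last by rewrite lexx.
have /andP[h1 h2] := V_bnd m0 hs.
rewrite mulr_ge0 ?divr_ge0//= ?(ltW m0)//.
apply: (@le_trans _ _ (kap / mu_star th * mu_star th)); last by rewrite divfK// gt_eqF.
by rewrite ler_wpM2l// divr_ge0// ltW.
Qed.

Lemma signal_avg (th kap : R) (N : nat) : 0 <= kap -> 0 <= th -> (0 < N)%N ->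
  avg (fun j : 'I_N => signal th kap (j%:R / N%:R)) <= th * kap.
Proof.
move=> k0 th0 N0; have cN : (0 < #|'I_N|)%N by rewrite card_ord.
case: (ltP th 2^-1) => th2; last first.
  have sE : signal th kap = fun s => kap * s by apply/funext => s; rewrite /signal ltNge th2.
  rewrite sE avgZ mulrC ler_wpM2r//.
  apply: le_trans th2.
  have hG (t : R) : 0 <= t <= 1 -> is_derive t 1 (fun s : R => 2^-1 * (s * s)) t.
    move=> _; have -> : (fun s : R => 2^-1 * (s * s)) = 2^-1 *: (id * id : R -> R) by [].
    by apply: is_derive_eq; rewrite /GRing.scale /=; field.
  have := @riemann_le _ id _ 0 N N0 hG.
  rewrite mul0r !addr0 !mulr1 !mulr0 subr0; apply.
  by move=> t u _ tu _ _; rewrite addr0.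
case: (ltP 0 (mu_star th)) => m0; last first.
  have sE : signal th kap = fun=> 0 by apply/funext => s; rewrite /signal th2 ltNge m0.
  by rewrite sE avg_cst// mulr_ge0.
have -> : signal th kap = fun s => kap / mu_star th * (- ln (1 - s * (1 - expR (- mu_star th)))).
  by apply/funext => s; rewrite /signal th2 m0.
rewrite avgZ; apply: (@le_trans _ _ (kap / mu_star th * (mu_star th * th))).
  have hv := V_avg m0 N0; rewrite -(mu_star_spec m0) in hv.
  by rewrite ler_wpM2l ?divr_ge0 ?(ltW m0).
by rewrite mulrA divfK ?gt_eqF// mulrC.
Qed.

End Signal.

Section Stage.
Variables (R : realType) (sg : R).
Hypothesis sg0 : 0 < sg.

Lemma hh_grid0 (I : finType) (xc : I -> R) (T : R -> R) (N : nat) : (0 < N)%N ->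
  (forall s, T s = 0) -> hh sg (grid xc T (N := N)) = hh sg xc.
Proof.
move=> N0 T0; have cN : (0 < #|'I_N|)%N by rewrite card_ord.
have pE y : pm sg (grid xc T (N := N)) y = pm sg xc y.
  rewrite /pm avg_pair -[RHS](avg_cst _ cN); apply: eq_avg => j.
  by apply: eq_avg => i; rewrite /grid T0 addr0.
rewrite /hh (_ : (fun y => ln (pm sg (grid xc T (N := N)) y)) = fun y => ln (pm sg xc y)); last first.
  by apply/funext => y; rewrite pE.
congr (- _); rewrite /Emix avg_pair -[RHS](avg_cst _ cN); apply: eq_avg => j.
by apply: eq_avg => i; rewrite /grid T0 addr0.
Qed.

(* The entropy power of the continuous law whose quantile function is [signal th k]. *)
Definition epw (th k : R) : R := pi *+ 2 * expR 1 * (rho th * k ^+ 2).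

(** The constant is chosen before N, I and xc, so the mixture produced by one stage may serve as
    input of the next. Signals that vanish identically, either because k = 0 or because [mu_star]
    has its default value, have entropy power 0 and need no inequality. *)
Lemma stage (th k B : R) : 0 <= k -> exists2 K : R, 0 <= K &
  forall (N : nat) (I : finType) (xc : I -> R), (0 < #|I|)%N -> (0 < N)%N ->
    (forall i, 0 <= xc i <= B) ->
    2^-1 * ln (epw th k + expR (2 * hh sg xc)) - K / N%:R <=
    hh sg (grid xc (signal th k) (N := N)).
Proof.
have p0 := pi_gt0 R.
have triv : (forall s, signal th k s = 0) -> epw th k = 0 ->
   exists2 K : R, 0 <= K &
  forall (N : nat) (I : finType) (xc : I -> R), (0 < #|I|)%N -> (0 < N)%N ->
    (forall i, 0 <= xc i <= B) ->
    2^-1 * ln (epw th k + expR (2 * hh sg xc)) - K / N%:R <=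
    hh sg (grid xc (signal th k) (N := N)).
  move=> T0 e0; exists 0 => // N I xc I0 N0 xcB.
  by rewrite hh_grid0// e0 add0r expRK mul0r subr0; lra.
rewrite le_eqVlt => /orP[/eqP k0|k0].
  apply: triv => [s|]; last by rewrite /epw -k0 expr0n /= !mulr0.
  by rewrite /signal -k0 !mul0r; case: ifP => //; case: ifP.
have e1 : 0 <= E1 sg 0 (fun y : R => `|y|) by apply: E1_ge0.
case: (ltP th 2^-1) => th2; last first.
  have sE : signal th k = fun s => k * s by apply/funext => s; rewrite /signal ltNge th2.
  have eE : epw th k = expR (2 * ln k).
    rewrite /epw /rho ltNge th2 /= mulrA divff ?mul1r; last first.
      by rewrite gt_eqF// mulr_gt0 ?expR_gt0// pmulrn_lgt0.
    by rewrite mulr_natl mulr2n expRD lnK ?posrE// expr2.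
  exists (Num.max 0 ((E1 sg 0 (fun y => `|y|) + 2 * B + 3 * k) / sg ^+ 2 * k)).
    by rewrite le_max lexx.
  move=> N I xc I0 N0 xcB; rewrite sE eE.
  have := epi_one sg0 I0 xcB (T := fun s => k * s) (dT := fun=> k) (Bt := k) (L := k) (l := k)
     (H := ln k) _ _ _ _ k0 _ _ N0.
  move=> h; apply: le_trans (h _ _ _ _ _ _).
  - by rewrite lerD2l lerN2 ler_wpM2r ?invr_ge0// le_max lexx orbT.
  - by move=> t /andP[t0 t1]; rewrite mulr_ge0 ?ler_piMr// ltW.
  - move=> t _; have -> : (fun s => k * s) = k *: (id : R -> R) by [].
    by apply: is_derive_eq; rewrite /GRing.scale /= mulr1.
  - by move=> t _; exact: cvg_cst.
  - by move=> t _; rewrite lexx.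
  - by move=> t u _ _; rewrite -mulrBr normrM gtr0_norm.
  - by rewrite E1_cst.
case: (ltP 0 (mu_star th)) => m0; last first.
  have m00 : mu_star th = 0 by apply/eqP; rewrite eq_le m0 mu_star_ge0.
  apply: triv => [s|]; first by rewrite /signal th2 m00 ltxx.
  by rewrite /epw /rho th2 m00 invr0 !mulr0 expr0n /= !(mulr0,mul0r).
have sE : signal th k = fun s => k / mu_star th * (- ln (1 - s * (1 - expR (- mu_star th)))).
  by apply/funext => s; rewrite /signal th2 m0.
have /andP[d0 d1] := d01 m0.
(* The entropy of the truncated exponential is ln (k d / m) plus the mean of [V], which the equation
   of [mu_star] identifies as m th. Multiplying [rho th * k ^+ 2] by 2 pi e gives exactly its
   entropy power. *)
have eE : epw th k = expR (2 * (ln (k * (1 - expR (- mu_star th)) / mu_star th) +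
     mu_star th * th)).
  set m := mu_star th; set d := 1 - expR (- m); set X := k * d / m.
  have X0 : 0 < X by rewrite divr_gt0 ?mulr_gt0.
  have -> : 2 * (ln X + m * th) = ln X + ln X + 2 * th * m by ring.
  rewrite /epw /rho th2 -/m -/d 2!expRD (lnK X0) [expR (2 * th * m - 1)]expRD expRN /X.
  have e0 := expR_gt0 (1 : R).
  rewrite -mulr_natr; move: (expR (2 * th * m)) (expR 1) e0 (pi : R) p0 => Y e e0 p p0.
  have m0' : 0 < m := m0.
  by field; rewrite !gt_eqF.
exists (Num.max 0 ((E1 sg 0 (fun y => `|y|) + 2 * B + 3 * k) / sg ^+ 2 *
   (k / mu_star th * ((1 - expR (- mu_star th)) * expR (mu_star th))))).
  by rewrite le_max lexx.
move=> N I xc I0 N0 xcB; rewrite sE eE.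
have := epi_truncexp m0 sg0 I0 xcB k0 N0; rewrite -mu_star_spec//; apply: le_trans.
by rewrite lerD2l lerN2 ler_wpM2r ?invr_ge0// le_max lexx orbT.
Qed.

End Stage.

(** * Memoryless blocks *)

Section Memoryless.
Variable R : realType.

(** From e^x <= 1 / (1 - x) and (1 - x)(1 + x + 2 x^2) = 1 + x^2 (1 - 2 x). *)
Lemma expR_le_quad (x : R) : x <= 2^-1 -> expR x <= 1 + x + 2 * x ^+ 2.
Proof.
move=> hx; have h := expR_ge1Dx (- x); have e0 := expR_gt0 x.
have x1 : 0 < 1 - x by lra.
have h2 : expR x * (1 - x) <= 1.
  have := ler_wpM2l (ltW e0) h; rewrite expRN divff// gt_eqF//.
rewrite -(ler_pM2r x1); apply: (le_trans h2).
have : 0 <= x ^+ 2 * (1 - 2 * x) by rewrite mulr_ge0 ?sqr_ge0//; lra.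
by rewrite expr2; nra.
Qed.

Variables (n : nat) (L O : finType) (p : 'I_n -> L -> L -> L -> L -> O -> R).
Hypotheses (L0 : (0 < #|L|)%N).
Hypotheses (p0 : forall t a b c d o, 0 < p t a b c d o)
  (p1 : forall t a b c d, \sum_o p t a b c d o = 1).

Notation X := {ffun 'I_n -> L}.
Notation Y := {ffun 'I_n -> O}.

(** The channel may change with the position t; time sharing between letter laws rests on this. *)
Definition block (u v u' v' : X) (y : Y) : R := \prod_t p t (u t) (v t) (u' t) (v' t) (y t).

Lemma X0 : (0 < #|{: X}|)%N. Proof. by rewrite card_ffun expn_gt0 L0. Qed.

Lemma block_ge0 u v u' v' y : 0 <= block u v u' v' y.
Proof. by apply: prodr_ge0 => t _; exact: ltW. Qed.

Lemma sum_prod (F : 'I_n -> O -> R) : \sum_(y : Y) \prod_t F t (y t) = \prod_t \sum_o F t o.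
Proof. by rewrite bigA_distr_bigA. Qed.

Lemma block_sum u v u' v' : \sum_y block u v u' v' y = 1.
Proof. by rewrite /block (sum_prod (fun t => p t (u t) (v t) (u' t) (v' t))) big1. Qed.

Lemma block_W2 u v u' y : W2 block u v u' y = \prod_t W2 (p t) (u t) (v t) (u' t) (y t).
Proof. exact: (avg_prod (fun t d => p t (u t) (v t) (u' t) d (y t))). Qed.

Lemma block_W1 u u' y : W1 block u u' y = \prod_t W1 (p t) (u t) (u' t) (y t).
Proof.
rewrite /W1; under eq_avg do rewrite block_W2.
exact: (avg_prod (fun t b => W2 (p t) (u t) b (u' t) (y t))).
Qed.

Lemma block_Wa u' y : Wa block u' y = \prod_t Wa (p t) (u' t) (y t).
Proof.
rewrite /Wa; under eq_avg do rewrite block_W1.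
exact: (avg_prod (fun t a => W1 (p t) a (u' t) (y t))).
Qed.

Lemma block_Wb u y : Wb block u y = \prod_t Wb (p t) (u t) (y t).
Proof.
rewrite /Wb; under eq_avg do rewrite block_W1.
exact: (avg_prod (fun t c => W1 (p t) (u t) c (y t))).
Qed.

Lemma block_W0 y : W0 block y = \prod_t W0 (p t) (y t).
Proof.
rewrite /W0; under eq_avg do rewrite block_Wa.
exact: (avg_prod (fun t c => Wa (p t) c (y t))).
Qed.

Lemma E4_prod (F : 'I_n -> L -> L -> L -> L -> R) :
  E4 (fun u v u' v' : X => \prod_t F t (u t) (v t) (u' t) (v' t)) = \prod_t E4 (F t).
Proof.
rewrite /E4.
under eq_avg => u.
  under eq_avg => v.
    under eq_avg => u'.
      rewrite (avg_prod (fun t d => F t (u t) (v t) (u' t) d)); over.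
    rewrite (avg_prod (fun t c => avg (fun d => F t (u t) (v t) c d))); over.
  rewrite (avg_prod (fun t b => avg (fun c => avg (fun d => F t (u t) b c d)))); over.
by rewrite (avg_prod (fun t a => avg (fun b => avg (fun c => avg (fun d => F t a b c d))))).
Qed.

Definition ex t (F : L -> L -> L -> L -> O -> R) : R :=
  E4 (fun a b c d => \sum_o p t a b c d o * F a b c d o).

Lemma le_ex t F F' : (forall a b c d o, F a b c d o <= F' a b c d o) -> ex t F <= ex t F'.
Proof.
by move=> h; apply: le_E4 => a b c d; apply: ler_sum => o _; rewrite ler_wpM2l// ltW.
Qed.

Lemma E4_lin k l (F : L -> L -> L -> L -> R) :
  E4 (fun a b c d => k + l * F a b c d) = k + l * E4 F.
Proof.
have s (F1 : L -> R) : avg (fun a => k + l * F1 a) = k + l * avg F1.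
  by rewrite avgD avg_cst// avgZ.
by rewrite /E4 -s; apply: eq_avg => a; rewrite -s; apply: eq_avg => b; rewrite -s; apply: eq_avg => c.
Qed.

Lemma ex_lin t k l F : ex t (fun a b c d o => k + l * F a b c d o) = k + l * ex t F.
Proof.
rewrite /ex -E4_lin; do 4!(apply: eq_avg => ?).
under eq_bigr do rewrite mulrDr mulrCA.
by rewrite big_split /= -mulr_suml -mulr_sumr p1 mul1r.
Qed.

Section Chernoff.
Variables (S : 'I_n -> L -> L -> L -> L -> O -> R) (B lam : R) (I : 'I_n -> R).
Hypotheses (SB : forall t a b c d o, `|S t a b c d o| <= B) (lam0 : 0 <= lam)
  (lamB : lam * B <= 2^-1) (hI : forall t, I t <= ex t (S t)).

(** Markov's inequality for the exponential of lam (gam - sum of S). The expectation factors over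
    positions, and each factor is bounded by [expR_le_quad], whose second-order term is at most 2
    lam^2 B^2. *)
Lemma chernoff_block (gam : R) :
  E4 (fun u v u' v' => \sum_y block u v u' v' y *
      (\sum_t S t (u t) (v t) (u' t) (v' t) (y t) <= gam)%R%:R) <=
  expR (lam * (gam - \sum_t I t) + n%:R * (2 * lam ^+ 2 * B ^+ 2)).
Proof.
pose F t a b c d o := expR (- lam * S t a b c d o).
apply: (@le_trans _ _ (E4 (fun u v u' v' : X => expR (lam * gam) *
    \prod_t \sum_o p t (u t) (v t) (u' t) (v' t) o * F t (u t) (v t) (u' t) (v' t) o))).
  apply: le_E4 => u v u' v'; rewrite -sum_prod mulr_sumr; apply: ler_sum => y _.
  rewrite big_split /= -/(block u v u' v' y) mulrCA ler_wpM2l ?block_ge0//.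
  rewrite /F -expR_sum -mulr_sumr -expRD.
  case: (leP (\sum_t _) gam) => h /=; last by rewrite ltW// expR_gt0.
  by rewrite -[leLHS]expR0 ler_expR mulNr -mulrBr mulr_ge0// subr_ge0.
have -> : forall k (G : X -> X -> X -> X -> R), E4 (fun u v u' v' => k * G u v u' v') = k * E4 G.
  by move=> k G; rewrite /E4 -avgZ; apply: eq_avg => u; rewrite -avgZ; apply: eq_avg => v;
     rewrite -avgZ; apply: eq_avg => u'; rewrite -avgZ.
rewrite (E4_prod (fun t a b c d => \sum_o p t a b c d o * F t a b c d o)).
apply: (@le_trans _ _ (expR (lam * gam) * \prod_t expR (- lam * I t + 2 * lam ^+ 2 * B ^+ 2))).
  apply: ler_wpM2l; first by rewrite ltW// expR_gt0.
  apply: ler_prod => t _; apply/andP; split.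
    by do 4!(apply: avg_ge0 => ?); apply: sumr_ge0 => o _; rewrite mulr_ge0// ltW// expR_gt0.
  apply: (@le_trans _ _ (ex t (fun a b c d o => (1 + 2 * lam ^+ 2 * B ^+ 2) + (- lam) * S t a b c d o))).
    apply: le_ex => a b c d o.
    have hS := SB t a b c d o; move: (hS); rewrite ler_norml => /andP[h1 h2].
    have hx : - lam * S t a b c d o <= 2^-1.
      by apply: le_trans lamB; rewrite mulNr -mulrN ler_wpM2l//; lra.
    apply: (le_trans (expR_le_quad hx)).
    have : S t a b c d o ^+ 2 <= B ^+ 2.
      rewrite -real_normK ?num_real// lerXn2r ?nnegrE// (le_trans _ hS)//.
    rewrite exprMn sqrrN => h3.
    have := ler_wpM2l (sqr_ge0 lam) h3; lra.
  rewrite ex_lin; apply: le_trans (expR_ge1Dx _).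
  have := ler_wpM2l lam0 (hI t); lra.
rewrite -expR_sum -expRD ler_expR big_split /= -mulr_sumr sumr_const card_ord.
by rewrite -[(_ * _) *+ n]mulr_natl; lra.
Qed.

Lemma chernoff_mean (gam d : R) : \sum_t I t - gam >= n%:R * (2 * lam * B ^+ 2) + d ->
  E4 (fun u v u' v' => \sum_y block u v u' v' y *
      (\sum_t S t (u t) (v t) (u' t) (v' t) (y t) <= gam)%R%:R) <= expR (- (lam * d)).
Proof.
move=> h; apply: (le_trans (chernoff_block gam)); rewrite ler_expR.
have := ler_wpM2l lam0 h; rewrite expr2; lra.
Qed.

End Chernoff.

Lemma prod_test (m d : 'I_n -> R) (gam : R) : (forall t, 0 < m t) -> (forall t, 0 < d t) ->
  ~~ (expR gam * \prod_t d t < \prod_t m t) -> \sum_t ln (m t / d t) <= gam.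
Proof.
move=> m0 d0; rewrite -leNgt => h; rewrite -ler_expR expR_sum.
under eq_bigr => t _ do rewrite lnK ?posrE ?divr_gt0//.
by rewrite big_split /= prodfV ler_pdivrMr ?prodr_gt0.
Qed.

Lemma W2_gt0 t a b c o : 0 < W2 (p t) a b c o. Proof. exact: avg_gt0. Qed.
Lemma W1_gt0 t a c o : 0 < W1 (p t) a c o.
Proof. by apply: avg_gt0 => // b; exact: W2_gt0. Qed.
Lemma Wa_gt0 t c o : 0 < Wa (p t) c o.
Proof. by apply: avg_gt0 => // b; exact: W1_gt0. Qed.
Lemma Wb_gt0 t a o : 0 < Wb (p t) a o.
Proof. by apply: avg_gt0 => // b; exact: W1_gt0. Qed.
Lemma W0_gt0 t o : 0 < W0 (p t) o.
Proof. by apply: avg_gt0 => // b; exact: Wa_gt0. Qed.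

Definition i3 t a b (c d : L) o : R := ln (W2 (p t) a b c o / W1 (p t) a c o).
Definition ia t a (b : L) c (d : L) o : R := ln (W1 (p t) a c o / Wa (p t) c o).
Definition ib t a (b : L) c (d : L) o : R := ln (W1 (p t) a c o / Wb (p t) a o).
Definition i0 t a (b : L) c (d : L) o : R := ln (W1 (p t) a c o / W0 (p t) o).

(** A failed test is a lower deviation of a sum of information densities from the sum of their
    means; the four cases are added. *)
Lemma Pfail_le (B lam d g3 ga gb g0 : R) (I3 Ia Ib I0 : 'I_n -> R) :
  0 <= lam -> lam * B <= 2^-1 ->
  (forall t a b c d o, [/\ `|i3 t a b c d o| <= B, `|ia t a b c d o| <= B,
     `|ib t a b c d o| <= B & `|i0 t a b c d o| <= B]) ->
  (forall t, [/\ I3 t <= ex t (i3 t), Ia t <= ex t (ia t), Ib t <= ex t (ib t) & I0 t <= ex t (i0 t)]) ->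
  let s := n%:R * (2 * lam * B ^+ 2) + d in
  s <= \sum_t I3 t - g3 -> s <= \sum_t Ia t - ga -> s <= \sum_t Ib t - gb -> s <= \sum_t I0 t - g0 ->
  Pfail block (expR g3) (expR ga) (expR gb) (expR g0) <= 4 * expR (- (lam * d)).
Proof.
move=> lam0 lamB hB hI s h3 ha hb h0.
pose T (i : 'I_n -> L -> L -> L -> L -> O -> R) g u v u' v' y : R :=
  block u v u' v' y * (\sum_t i t (u t) (v t) (u' t) (v' t) (y t) <= g)%R%:R.
have c3 := chernoff_mean (S := i3) (fun t a b c d o => let: And4 h _ _ _ := hB t a b c d o in h)
  lam0 lamB (fun t => let: And4 h _ _ _ := hI t in h) h3.
have ca := chernoff_mean (S := ia) (fun t a b c d o => let: And4 _ h _ _ := hB t a b c d o in h)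
  lam0 lamB (fun t => let: And4 _ h _ _ := hI t in h) ha.
have cb := chernoff_mean (S := ib) (fun t a b c d o => let: And4 _ _ h _ := hB t a b c d o in h)
  lam0 lamB (fun t => let: And4 _ _ h _ := hI t in h) hb.
have c0 := chernoff_mean (S := i0) (fun t a b c d o => let: And4 _ _ _ h := hB t a b c d o in h)
  lam0 lamB (fun t => let: And4 _ _ _ h := hI t in h) h0.
have E4D (F G : X -> X -> X -> X -> R) :
    E4 (fun u v u' v' => F u v u' v' + G u v u' v') = E4 F + E4 G.
  rewrite /E4 -avgD; apply: eq_avg => u; rewrite -avgD; apply: eq_avg => v.
  by rewrite -avgD; apply: eq_avg => u'; rewrite -avgD.
have := lerD (lerD (lerD c3 ca) cb) c0; rewrite -!E4D => hh.
have -> : 4 * expR (- (lam * d)) =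
  expR (- (lam * d)) + expR (- (lam * d)) + expR (- (lam * d)) + expR (- (lam * d)) by ring.
apply: le_trans hh; apply: le_E4 => u v u' v'; rewrite -!big_split; apply: ler_sum => y _ /=.
rewrite -!mulrDr ler_wpM2l ?block_ge0// /pass block_W2 block_W1 block_Wa block_Wb block_W0.
have q (b : bool) : 0 <= b%:R :> R by [].
rewrite !negb_and.
have t3 : ~~ (expR g3 * \prod_t W1 (p t) (u t) (u' t) (y t) < \prod_t W2 (p t) (u t) (v t) (u' t) (y t)) ->
   \sum_t i3 t (u t) (v t) (u' t) (v' t) (y t) <= g3.
  by apply: prod_test => t; [exact: W2_gt0|exact: W1_gt0].
have ta : ~~ (expR ga * \prod_t Wa (p t) (u' t) (y t) < \prod_t W1 (p t) (u t) (u' t) (y t)) ->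
   \sum_t ia t (u t) (v t) (u' t) (v' t) (y t) <= ga.
  by apply: prod_test => t; [exact: W1_gt0|exact: Wa_gt0].
have tb : ~~ (expR gb * \prod_t Wb (p t) (u t) (y t) < \prod_t W1 (p t) (u t) (u' t) (y t)) ->
   \sum_t ib t (u t) (v t) (u' t) (v' t) (y t) <= gb.
  by apply: prod_test => t; [exact: W1_gt0|exact: Wb_gt0].
have t0 : ~~ (expR g0 * \prod_t W0 (p t) (y t) < \prod_t W1 (p t) (u t) (u' t) (y t)) ->
   \sum_t i0 t (u t) (v t) (u' t) (v' t) (y t) <= g0.
  by apply: prod_test => t; [exact: W1_gt0|exact: W0_gt0].
case: (~~ (_ < _)) t3 => [->//|_] /=.
  by have := q (\sum_t ia t (u t) (v t) (u' t) (v' t) (y t) <= ga);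
     have := q (\sum_t ib t (u t) (v t) (u' t) (v' t) (y t) <= gb);
     have := q (\sum_t i0 t (u t) (v t) (u' t) (v' t) (y t) <= g0); rewrite mulr1n; lra.
case: (~~ (_ < _)) ta => [->//|_] /=.
  by have := q (\sum_t i3 t (u t) (v t) (u' t) (v' t) (y t) <= g3);
     have := q (\sum_t ib t (u t) (v t) (u' t) (v' t) (y t) <= gb);
     have := q (\sum_t i0 t (u t) (v t) (u' t) (v' t) (y t) <= g0); rewrite mulr1n; lra.
case: (~~ (_ < _)) tb => [->//|_] /=.
  by have := q (\sum_t i3 t (u t) (v t) (u' t) (v' t) (y t) <= g3);
     have := q (\sum_t ia t (u t) (v t) (u' t) (v' t) (y t) <= ga);
     have := q (\sum_t i0 t (u t) (v t) (u' t) (v' t) (y t) <= g0); rewrite mulr1n; lra.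
case: (~~ (_ < _)) t0 => [->//|_] /=.
  by have := q (\sum_t i3 t (u t) (v t) (u' t) (v' t) (y t) <= g3);
     have := q (\sum_t ib t (u t) (v t) (u' t) (v' t) (y t) <= gb);
     have := q (\sum_t ia t (u t) (v t) (u' t) (v' t) (y t) <= ga); rewrite mulr1n; lra.
by rewrite mulr0n !addr_ge0.
Qed.

(** The lower-tail bound [chernoff_mean] applied to the negated cost; the cost does not read the
    output, so the channel sums to one. *)
Lemma cost_le (x : 'I_n -> L -> L -> R) (B lam d K : R) (m : 'I_n -> R) :
  0 <= lam -> lam * B <= 2^-1 -> (forall t a b, `|x t a b| <= B) ->
  (forall t, avg (fun a => avg (fun b => x t a b)) <= m t) ->
  n%:R * (2 * lam * B ^+ 2) + d <= K - \sum_t m t ->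
  avg (fun u : X => avg (fun v : X => (K <= \sum_t x t (u t) (v t))%R%:R)) <= expR (- (lam * d)).
Proof.
move=> lam0 lamB xB xm hK.
have hS t a b (c d' : L) (o : O) : `|- x t a b| <= B by rewrite normrN.
have hI t : - m t <= ex t (fun a b _ _ _ => - x t a b).
  rewrite /ex /E4.
  have -> : avg (fun a => avg (fun b => avg (fun c => avg (fun d' => \sum_o p t a b c d' o * - x t a b)))) =
     - avg (fun a => avg (fun b => x t a b)).
    rewrite -avgN; apply: eq_avg => a; rewrite -avgN; apply: eq_avg => b.
    rewrite -[RHS](avg_cst _ L0); apply: eq_avg => c; rewrite -[RHS](avg_cst _ L0); apply: eq_avg => d'.
    by rewrite -mulr_suml p1 mul1r.
  by rewrite lerN2.
have hK' : \sum_t - m t - - K >= n%:R * (2 * lam * B ^+ 2) + d by rewrite sumrN; lra.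
apply: le_trans (chernoff_mean hS lam0 lamB hI hK').
rewrite le_eqVlt; apply/orP; left; apply/eqP; apply: eq_avg => u; apply: eq_avg => v.
have cst2 (k : R) : k = avg (fun u' : X => avg (fun v' : X => k)) by rewrite !avg_cst// ?X0.
rewrite [LHS]cst2; apply: eq_avg => u'; apply: eq_avg => v'.
by rewrite -mulr_suml block_sum mul1r sumrN lerN2.
Qed.

End Memoryless.

Section Existence.
Variable R : realType.
Variables (U V : finType) (C Q C' Q' : finType).
Hypotheses (U0 : (0 < #|U|)%N) (V0 : (0 < #|V|)%N).

Lemma ffun_card (I J : finType) : (0 < #|J|)%N -> (0 < #|{: {ffun I -> J}}|)%N.
Proof. by move=> J0; rewrite card_ffun expn_gt0 J0. Qed.

Lemma EE_ex (F : {ffun C -> U} -> {ffun Q -> V} -> {ffun C' -> U} -> {ffun Q' -> V} -> R) c :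
  EE F <= c -> exists f g f' g', F f g f' g' <= c.
Proof.
move=> /(avg_le_ex (ffun_card _ U0))[f] /(avg_le_ex (ffun_card _ V0))[g].
move=> /(avg_le_ex (ffun_card _ U0))[f'] /(avg_le_ex (ffun_card _ V0))[g' h].
by exists f, g, f', g'.
Qed.

(** Lets the second receiver be analysed by the same one-receiver bound, with the two users
    exchanged. *)
Lemma EE_swap (F : {ffun C -> U} -> {ffun Q -> V} -> {ffun C' -> U} -> {ffun Q' -> V} -> R) :
  EE F = EE (fun f' g' f g => F f g f' g').
Proof.
rewrite /EE; transitivity (avg (fun f => avg (fun f' => avg (fun g => avg (fun g' => F f g f' g'))))).
  by apply: eq_avg => f; rewrite avg_exch.
rewrite avg_exch; apply: eq_avg => f'.
transitivity (avg (fun f => avg (fun g' => avg (fun g => F f g f' g')))).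
  by apply: eq_avg => f; rewrite avg_exch.
by rewrite avg_exch.
Qed.

Lemma EE_12 (c : C) (p : Q) (F : U -> V -> R) :
  EE (fun f g (f' : {ffun C' -> U}) (g' : {ffun Q' -> V}) => F (f c) (g p)) = avg (fun u => avg (F u)).
Proof.
rewrite /EE; transitivity (avg (fun f : {ffun C -> U} => avg (fun g : {ffun Q -> V} => F (f c) (g p)))).
  by apply: eq_avg => f; apply: eq_avg => g; rewrite !avg_cst//; exact: ffun_card.
rewrite (avg_ev1 c (fun u => avg (fun g : {ffun Q -> V} => F u (g p))))//.
by apply: eq_avg => u; rewrite (avg_ev1 p).
Qed.

End Existence.

(** * Quantized outputs *)

Section Cells.
Variable R : realType.
Notation mu := (@lebesgue_measure R).
Variables (O : finType) (q : R -> O) (sg : R).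
Hypotheses (sg0 : 0 < sg) (mq : forall o, measurable [set y : R | q y = o]).

Definition inq (o : O) (y : R) : R := (q y == o)%:R.

Lemma inqE o : inq o = \1_[set y : R | q y = o].
Proof.
apply/funext => y; rewrite /inq indicE; congr (nat_of_bool _)%:R.
by apply/eqP/idP => [h|]; rewrite inE.
Qed.

Lemma inq_ge0 o y : 0 <= inq o y. Proof. by []. Qed.

Lemma qg_inq o g : qg g -> qg (fun y => inq o y * g y).
Proof. by rewrite inqE; exact: qg_indic (mq o). Qed.

Lemma qg_inq1 o : qg (inq o).
Proof.
have := qg_inq o (qg_cst (1 : R)); congr qg; apply/funext => y; exact: mulr1.
Qed.

Lemma sum_inq y : \sum_o inq o y = 1.
Proof.
rewrite (bigD1 (q y))//= /inq eqxx big1 ?addr0// => o.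
by rewrite eq_sym => /negPf->.
Qed.

Definition cell (x : R) (o : O) : R := E1 sg x (inq o).

Lemma cell_ge0 x o : 0 <= cell x o. Proof. exact: E1_ge0. Qed.

Lemma cell_sum x : \sum_o cell x o = 1.
Proof.
rewrite /cell -(E1_sum (index_enum O) x sg0 qg_inq1) -[RHS](E1_cst x 1 sg0); congr E1.
by apply/funext => y; exact: sum_inq.
Qed.

Lemma cell_shift x o : cell x o = E1 sg 0 (fun z => inq o (x + z)).
Proof.
rewrite /cell -{1}[x]add0r (E1_shift 0 x sg0 (qg_inq1 o)); congr E1.
by apply/funext => z; rewrite addrC.
Qed.

Lemma cell_gt0 x o (a b : R) : a < b -> (forall y, a < y <= b -> q y = o) -> 0 < cell x o.
Proof.
move=> ab h; have ab' : a - x < b - x by rewrite ltrD2r.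
have mI : measurable `](a - x), (b - x)]%classic by exact: measurable_itv.
apply: (@lt_le_trans _ _ (E1 sg 0 (fun y => \1_(`](a - x), (b - x)]%classic) y * 1))).
  rewrite /E1; under eq_Rintegral do rewrite mulr1 subr0.
  rewrite (Rint_indic (S := `](a - x), (b - x)]%classic) _ mI).
  by rewrite (int_mid sg0 ab') subr_gt0; exact: Phi_lt.
rewrite cell_shift; apply: le_E1 => //.
- exact: qg_indic mI (qg_cst 1).
- have := qg_shift x (qg_inq1 o); congr qg; apply/funext => y; by rewrite addrC.
- move=> y; rewrite mulr1 indicE; case: (boolP (y \in _)) => [|_]; last exact: inq_ge0.
  rewrite inE /= in_itv /= => /andP[h1 h2].
  by rewrite /inq h ?eqxx//; apply/andP; split; lra.
Qed.

Local Notation P0 := (normal_prob (0 : R) sg).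

Lemma normal_cell x o : P0 [set z | q (x + z) = o] = (cell x o)%:E.
Proof.
have mV : measurable [set z : R | q (x + z) = o].
  have mx : measurable_fun setT (fun z : R => x + z) by exact: measurable_funD.
  by have := mx measurableT _ (mq o); rewrite setTI.
rewrite cell_shift /normal_prob /E1 /Rintegral fineK; last first.
  have := qg_shift x (qg_inq1 o) => /(intble_qg 0 sg0) h.
  apply: (@integrable_fin_num _ _ _ mu setT) => //; move: h; rewrite /intble.
  by apply: eq_integrable => // z _ /=; rewrite addrC.
rewrite [LHS]integral_mkcond; apply: eq_integral => z _.
rewrite patchE gdE// /inq subr0.
case: (boolP (z \in _)) => [|hz]; first by rewrite inE /= => ->; rewrite eqxx mul1r.
suff /negPf-> : q (x + z) != o by rewrite mul0r.
by apply: contra hz => /eqP h; rewrite inE.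
Qed.

Lemma normal_finite x (H : O -> R) : (forall o, 0 <= H o) ->
  (\int[P0]_z (H (q (x + z)))%:E = (\sum_o cell x o * H o)%:E)%E.
Proof.
move=> H0.
have mV o : measurable [set z : R | q (x + z) = o].
  have mx : measurable_fun setT (fun z : R => x + z) by exact: measurable_funD.
  by have := mx measurableT _ (mq o); rewrite setTI.
transitivity (\int[P0]_z (\sum_o ((H o)%:E * (\1_[set z : R | q (x + z) = o] z)%:E)))%E.
  apply: eq_integral => z _; under eq_bigr do rewrite -EFinM.
  rewrite sumEFin; congr EFin.
  rewrite (bigD1 (q (x + z)))//= indicE mem_set//= mulr1 big1 ?addr0// => o ho.
  rewrite indicE memNset ?mulr0//= => h; move: ho; by rewrite h eqxx.
rewrite ge0_integral_sum//; last 2 first.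
- move=> o; apply/measurable_EFinP; apply: measurable_funM => //.
  by apply: measurable_indic; exact: mV.
- by move=> o z _; rewrite -EFinM lee_fin mulr_ge0.
rewrite -sumEFin; apply: eq_bigr => o _.
rewrite ge0_integralZl//; last 2 first.
- by apply/measurable_EFinP; apply: measurable_indic; exact: mV.
- by rewrite lee_fin.
have -> : (\int[P0]_z (\1_[set z : R | q (x + z) = o] z)%:E = P0 [set z : R | q (x + z) = o])%E.
  transitivity (P0 ([set z : R | q (x + z) = o] `&` setT)); last by rewrite setIT.
  have := @integral_indic _ _ R P0 setT measurableT _ (mV o).
  by [].
by rewrite normal_cell muleC EFinM.
Qed.

Lemma tnth_lift0 (T : Type) n (s : n.+1.-tuple T) (j : 'I_n) :
  tnth s (lift ord0 j) = tnth (behead_tuple s) j.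
Proof. by rewrite !(tnth_nth (thead s)) /= nth_behead. Qed.

(** The recursion mirrors [gauss_expect], so the noise coordinates can be integrated out one at a
    time, each leaving a finite sum over cells. *)
Fixpoint dsum (n : nat) : n.-tuple R -> (n.-tuple O -> R) -> R :=
  match n return n.-tuple R -> (n.-tuple O -> R) -> R with
  | 0 => fun _ G => G [tuple]
  | n'.+1 => fun s G =>
      \sum_o cell (thead s) o * dsum (behead_tuple s) (fun b => G (cons_tuple o b))
  end.

Lemma dsum_ge0 n (s : n.-tuple R) G : (forall b, 0 <= G b) -> 0 <= dsum s G.
Proof.
elim: n s G => [|n ih] s G G0 //=; apply: sumr_ge0 => o _.
by rewrite mulr_ge0 ?cell_ge0// ih.
Qed.

Lemma gauss_dsum n (s : n.-tuple R) (G : n.-tuple O -> R) : (forall b, 0 <= G b) ->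
  gauss_expect sg (fun z : n.-tuple R =>
    (G (mktuple (fun t => q (tnth s t + tnth z t))))%:E) = (dsum s G)%:E.
Proof.
elim: n s G => [|n ih] s G G0 /=; first by congr ((G _)%:E); apply: eq_from_tnth => -[].
transitivity (\int[P0]_z (dsum (behead_tuple s) (fun b => G (cons_tuple (q (thead s + z)) b)))%:E)%E.
  apply: eq_integral => z _; rewrite -ih//; congr gauss_expect; apply/funext => w.
  congr ((G _)%:E); apply: eq_from_tnth => t; rewrite tnth_mktuple.
  case: (unliftP ord0 t) => [j|] ->.
    rewrite !tnthS tnth_mktuple; congr (q (_ + _)).
    exact: tnth_lift0.
  by rewrite !tnth0.
by rewrite (normal_finite (thead s)
  (H := fun o => dsum (behead_tuple s) (fun b => G (cons_tuple o b)))) // => o; exact: dsum_ge0.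
Qed.

Lemma tuple_sum n (F : n.+1.-tuple O -> R) :
  \sum_b F b = \sum_o \sum_(b : n.-tuple O) F (cons_tuple o b).
Proof.
rewrite pair_bigA (reindex (fun z : O * n.-tuple O => cons_tuple z.1 z.2))//.
exists (fun b : n.+1.-tuple O => (thead b, behead_tuple b)) => [[w b] _|b _].
  have -> : thead (cons_tuple w b) = w by rewrite /thead (tnth_nth w).
  by have -> : behead_tuple (cons_tuple w b) = b by exact: val_inj.
by case/tupleP: b => w b; apply/val_inj.
Qed.

Lemma prod_cons n (F : R -> O -> R) (s : n.+1.-tuple R) (w : O) (b : n.-tuple O) :
  \prod_t F (tnth s t) (tnth (cons_tuple w b) t) =
  F (thead s) w * \prod_t F (tnth (behead_tuple s) t) (tnth b t).
Proof.
by rewrite big_ord_recl tnth0; congr (_ * _); apply: eq_bigr => t _; rewrite tnthS tnth_lift0.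
Qed.

Lemma dsum_tuple n (s : n.-tuple R) (G : n.-tuple O -> R) :
  dsum s G = \sum_(b : n.-tuple O) (\prod_t cell (tnth s t) (tnth b t)) * G b.
Proof.
elim: n s G => [|n ih] s G.
  rewrite (big_pred1 [tuple]) => [|b]; first by rewrite big_ord0 mul1r.
  by apply/esym/eqP/eq_from_tnth => -[].
rewrite tuple_sum /=; apply: eq_bigr => o _; rewrite ih mulr_sumr; apply: eq_bigr => b _.
by rewrite (prod_cons (fun x w => cell x w)) mulrA.
Qed.

Lemma dsumE n (s : n.-tuple R) (G : n.-tuple O -> R) :
  dsum s G = \sum_(b : {ffun 'I_n -> O}) (\prod_t cell (tnth s t) (b t)) * G (mktuple b).
Proof.
rewrite dsum_tuple (reindex (fun f : {ffun 'I_n -> O} => mktuple f)) /=; last first.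
  exists (fun b : n.-tuple O => [ffun t => tnth b t]) => [f _|b _].
    by apply/ffunP => t; rewrite ffunE tnth_mktuple.
  by apply: eq_from_tnth => t; rewrite tnth_mktuple ffunE.
by apply: eq_bigr => f _; congr (_ * _); apply: eq_bigr => t _; rewrite tnth_mktuple.
Qed.

Section KL.
Variables (I J : finType) (xc : I -> R) (yc : J -> R).
Hypotheses (I0 : (0 < #|I|)%N) (J0 : (0 < #|J|)%N).
Hypotheses (cx : forall i o, 0 < cell (xc i) o) (cy : forall j o, 0 < cell (yc j) o).

Definition mcell (K : finType) (zc : K -> R) o : R := avg (fun k => cell (zc k) o).

Let P o := mcell xc o.
Let Q o := mcell yc o.
Let r y := ln (pm sg xc y) - ln (pm sg yc y).

Lemma mcellE (K : finType) (zc : K -> R) o : mcell zc o = Emix sg zc (inq o). Proof. by []. Qed.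

Lemma qg_r : qg r. Proof. by apply: qgB; exact: qg_lnpm. Qed.

(** If the log-ratio of the two densities stays within d of r0 on the cell, then its contribution is
    at most (r0 + d) P, while the ratio P / Q of the cell masses is at least e^(r0 - d). *)
Lemma kl_cell o (r0 d : R) : (forall y, q y = o -> `|r y - r0| <= d) ->
  Emix sg xc (fun y => inq o y * r y) <= P o * ln (P o / Q o) + 2 * d * P o.
Proof.
move=> h; have P_0 : 0 < P o by exact: avg_gt0.
have Q_0 : 0 < Q o by exact: avg_gt0.
have h1 : Emix sg xc (fun y => inq o y * r y) <= (r0 + d) * P o.
  rewrite /P mcellE -(EmixZ _ _ _ (qg_inq1 o))//.
  apply: le_EM => //; [exact: qg_inq qg_r|exact: qgZ (qg_inq1 o)|] => y.
  rewrite /inq; case: eqP => [/h|_]; last by rewrite mul0r mulr0.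
  by rewrite mul1r mulr1 ler_norml => /andP[_ ?]; lra.
have h2 : expR (r0 - d) * Q o <= P o.
  rewrite /P /Q !mcellE (Emix_int sg0 xc (qg_inq1 o)) (Emix_int sg0 yc (qg_inq1 o)).
  have ix := intble_pm sg0 xc (qg_inq1 o); have iy := intble_pm sg0 yc (qg_inq1 o).
  rewrite -RintegralZl//; apply: le_Rintegral => //; first by have := integrableZl measurableT (expR (r0 - d)) iy; apply: eq_integrable.
  move=> y _; rewrite /inq; case: eqP => [/h|_]; last by rewrite !mul0r mulr0.
  rewrite !mul1r ler_norml => /andP[hr _].
  rewrite -[leRHS](lnK (pm_gt0 I0 sg0 xc y)) -[X in _ * X](lnK (pm_gt0 J0 sg0 yc y)) -expRD ler_expR.
  by move: hr; rewrite /r; lra.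
have h3 : r0 - d <= ln (P o / Q o).
  by rewrite -ler_expR lnK ?posrE ?divr_gt0// ler_pdivlMr.
have := ler_wpM2l (ltW P_0) h3; lra.
Qed.

(** P ln (P / Q) >= P - Q >= - e, whatever the densities do inside the cell. *)
Lemma kl_tail o (e : R) : Emix sg xc (fun y => inq o y * r y) <= e -> Q o <= e ->
  Emix sg xc (fun y => inq o y * r y) - 2 * e <= P o * ln (P o / Q o).
Proof.
move=> h1 h2; have P_0 : 0 < P o by exact: avg_gt0.
have Q_0 : 0 < Q o by exact: avg_gt0.
have QP : 0 < Q o / P o by rewrite divr_gt0.
have h3 : ln (P o / Q o) = - ln (Q o / P o) by rewrite -lnV ?posrE// invf_div.
have h4 : P o * ln (Q o / P o) <= Q o - P o.
  have -> : Q o - P o = P o * (Q o / P o - 1) by field; rewrite gt_eqF.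
  by rewrite ler_wpM2l ?(ltW P_0)//; have := @le_ln1Dx R (Q o / P o - 1); rewrite [1 + _]addrC subrK; apply; lra.
rewrite h3; lra.
Qed.

End KL.
End Cells.

(** * A quantizer with small information loss *)

Section Quantizer.
Variable R : realType.
Variable K : nat.
Hypothesis K0 : (0 < K)%N.

Let m := (2 * K ^ 3)%N.
Let k : R := K%:R.

Lemma k_gt0 : 0 < k. Proof. by rewrite ltr0n. Qed.
Lemma k_ge1 : 1 <= k. Proof. by rewrite ler1n. Qed.

(** Cells of width 1/K^2 on [-K, K), with [None] for the rest. Inside the window the log-densities
    have slope of order K, so they vary by O(1/K) over a cell. *)
Definition quant (y : R) : option 'I_m :=
  [pick o : 'I_m | (o%:R <= (y + k) * k ^+ 2 < o.+1%:R)].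

Lemma quant_Some y (o : 'I_m) : (quant y == Some o) = (o%:R <= (y + k) * k ^+ 2 < o.+1%:R).
Proof.
rewrite /quant; case: pickP => [i hi|h]; last by rewrite h.
apply/eqP/idP => [[<-]//|/andP[h1 h2]].
move/andP: hi => [h3 h4]; congr Some; apply/val_inj/eqP; rewrite eqn_leq.
have := le_lt_trans h1 h4; have := le_lt_trans h3 h2; rewrite !ltr_nat !ltnS /= => -> ->//.
Qed.

Lemma mE : m%:R = 2 * k * k ^+ 2 :> R.
Proof. by rewrite /m natrM natrX -/k; ring. Qed.

Lemma quant_None y : (quant y == None) = ~~ (- k <= y < k).
Proof.
have k0 := k_gt0; have k2 : 0 < k ^+ 2 by rewrite exprn_gt0.
apply/idP/idP => [hN|]; last first.
  move=> h; case E: (quant y) => [i|//]; move: h.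
  move/eqP: E; rewrite quant_Some => /andP[h1 h2].
  have : 0 <= (y + k) * k ^+ 2 by apply: le_trans h1.
  rewrite pmulr_lge0// => h3.
  have : (y + k) * k ^+ 2 < 2 * k * k ^+ 2.
    by rewrite -mE; apply: (lt_le_trans h2); rewrite ler_nat.
  rewrite ltr_pM2r// => h4.
  by have -> : (- k <= y < k) by apply/andP; split; lra.
apply/negP => /andP[h1 h2].
have h3 : 0 <= (y + k) * k ^+ 2 by rewrite mulr_ge0 ?(ltW k2)//; lra.
have /andP[h4 h5] := truncn_itv h3.
have h6 : (Num.truncn ((y + k) * k ^+ 2) < m)%N.
  rewrite -(ltr_nat R) mE; apply: (le_lt_trans h4); rewrite ltr_pM2r//; lra.
have := quant_Some y (Ordinal h6); rewrite /= h4 h5 (eqP hN) => //.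
Qed.

Lemma quant_meas o : measurable [set y : R | quant y = o].
Proof.
have k0 := k_gt0; have k2 : 0 < k ^+ 2 by rewrite exprn_gt0.
case: o => [i|].
  have -> : [set y : R | quant y = Some i] = `[(i%:R / k ^+ 2 - k), (i.+1%:R / k ^+ 2 - k)[%classic.
    apply/seteqP; split => [y /= /eqP|y /=]; rewrite ?quant_Some in_itv /=.
      by move=> /andP[h1 h2]; rewrite lerBlDr ltrBrDr ler_pdivrMr// ltr_pdivlMr// h1.
    by rewrite lerBlDr ltrBrDr ler_pdivrMr// ltr_pdivlMr// => h; apply/eqP; rewrite quant_Some.
  exact: measurable_itv.
have -> : [set y : R | quant y = None] = ~` `[(- k), k[%classic.
  apply/seteqP; split => [y /= /eqP|y /=]; first by rewrite quant_None in_itv /= => /negP.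
  by rewrite in_itv /= => /negP; rewrite -quant_None => /eqP.
by apply: measurableC; exact: measurable_itv.
Qed.

Section Gauss.
Variable sg : R.
Hypothesis sg0 : 0 < sg.
Notation cell := (cell quant sg).

(** Every cell contains an interval. Positive cell masses make the log-likelihood ratios finite in
    number and in value, hence bounded, as the Chernoff bounds require. *)
Lemma quant_cell_gt0 x o : 0 < cell x o.
Proof.
have k0 := k_gt0; have k2 : 0 < k ^+ 2 by rewrite exprn_gt0.
case: o => [i|].
  apply: (@cell_gt0 _ _ _ _ sg0 quant_meas _ _ (i%:R / k ^+ 2 - k) ((i%:R + 2^-1) / k ^+ 2 - k)).
    by rewrite ltrD2r ltr_pM2r ?invr_gt0//; lra.
  move=> y /andP[h1 h2]; apply/eqP; rewrite quant_Some.
  rewrite ltrBlDr ltr_pdivrMr// in h1; rewrite lerBrDr ler_pdivlMr// in h2.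
  by rewrite -natr1; apply/andP; split; lra.
apply: (@cell_gt0 _ _ _ _ sg0 quant_meas _ _ k (k + 1)); first lra.
by move=> y /andP[h1 h2]; apply/eqP; rewrite quant_None negb_and -[_ < k]negbK -leNgt negbK (ltW h1) orbT.
Qed.

Section Mix.
Variables (B : R).
Hypothesis B0 : 0 <= B.

Lemma Emix_sqr (I : finType) (xc : I -> R) : (0 < #|I|)%N -> (forall i, `|xc i| <= B) ->
  Emix sg xc (fun y => y ^+ 2) <= 2 * E1 sg 0 (fun y => y ^+ 2) + 2 * B ^+ 2.
Proof.
move=> I0 xB; rewrite -[leRHS](avg_cst _ I0); apply: le_avg => i.
rewrite -{1}[xc i]add0r (E1_shift 0 (xc i) sg0 (qg_sqr R)).
rewrite -(E1Z _ _ sg0 (qg_sqr R)) -(E1_cst 0 (2 * B ^+ 2) sg0) -E1D//; [|exact: qgZ (qg_sqr R)|exact: qg_cst].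
apply: le_E1 => //.
- exact: (qg_shift (xc i) (qg_sqr R)).
- by apply: qgD; [exact: qgZ (qg_sqr R)|exact: qg_cst].
- move=> y; have : xc i ^+ 2 <= B ^+ 2 by rewrite -real_normK ?num_real// lerXn2r ?nnegrE.
  have := sqr_ge0 (y - xc i); rewrite !expr2; nra.
Qed.

(** Both mixtures are later compared with the same centred Gaussian; the quadratic parts of their
    logarithms cancel and the log-ratio grows only linearly. *)
Lemma lnpm_gd (I : finType) (xc : I -> R) y : (0 < #|I|)%N -> (forall i, `|xc i| <= B) ->
  `|ln (pm sg xc y) - ln (gd sg y)| <= (`|y| + 2 * B) * B / sg ^+ 2.
Proof.
move=> I0 xB; have s2 : 0 < sg ^+ 2 by rewrite exprn_gt0.
set D := (`|y| + 2 * B) * B / sg ^+ 2.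
have g1 i : gd sg (y - xc i) <= expR D * gd sg y.
  have := gd_ratio sg0 y (- xc i) (B := 0) (x := 0); rewrite normr0 lexx !subr0 addr0 normrN.
  move=> /(_ isT) h; apply: (le_trans h); rewrite ler_wpM2r ?(ltW (gd_gt0 _ _))// ler_expR.
  rewrite ler_wpM2r ?invr_ge0 ?(ltW s2)//.
  by apply: ler_pM; rewrite ?addr_ge0// lerD2l; have B1 := B0; have := xB i; lra.
have g2 i : gd sg y <= expR D * gd sg (y - xc i).
  have := gd_ratio sg0 (y - xc i) (xc i) (B := 0) (x := 0); rewrite normr0 lexx subrK !subr0 addr0.
  move=> /(_ isT) h; apply: (le_trans h); rewrite ler_wpM2r ?(ltW (gd_gt0 _ _))// ler_expR.
  rewrite ler_wpM2r ?invr_ge0 ?(ltW s2)//.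
  apply: ler_pM; rewrite ?addr_ge0//.
  by have := ler_normB y (xc i); have := xB i; lra.
have p0 := pm_gt0 I0 sg0 xc y; have q0 := gd_gt0 y sg0.
have h1 : pm sg xc y <= expR D * gd sg y.
  by rewrite -[leRHS](avg_cst _ I0); apply: le_avg.
have h2 : gd sg y <= expR D * pm sg xc y.
  by rewrite -[leLHS](avg_cst _ I0) /pm -avgZ; apply: le_avg.
have l1 : ln (pm sg xc y) <= D + ln (gd sg y).
  by rewrite -ler_expR expRD !lnK ?posrE.
have l2 : ln (gd sg y) <= D + ln (pm sg xc y).
  by rewrite -ler_expR expRD !lnK ?posrE.
by rewrite ler_norml; apply/andP; split; lra.
Qed.

(** The first term comes from the oscillation within the bounded cells, the second from the tail
    cell. *)
Definition qcost : R := 8 * (B + 2) / sg ^+ 2 +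
  2 * (2 * ((1 + 2 * B) * B / sg ^+ 2) + 1) * (2 * E1 sg 0 (fun y => y ^+ 2) + 2 * B ^+ 2).

Lemma quant_kl (I J : finType) (xc : I -> R) (yc : J -> R) : (0 < #|I|)%N -> (0 < #|J|)%N ->
  (forall i, `|xc i| <= B) -> (forall j, `|yc j| <= B) ->
  Emix sg xc (fun y => ln (pm sg xc y)) - Emix sg xc (fun y => ln (pm sg yc y)) - qcost / k <=
  \sum_o mcell quant sg xc o * ln (mcell quant sg xc o / mcell quant sg yc o).
Proof.
move=> I0 J0 xB yB; have k0 := k_gt0; have k1 := k_ge1.
have B1 := B0; have k2 : 0 < k ^+ 2 by rewrite exprn_gt0.
have s2 : 0 < sg ^+ 2 by rewrite exprn_gt0.
set P := mcell quant sg xc; set Q := mcell quant sg yc.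
pose r y := ln (pm sg xc y) - ln (pm sg yc y).
have qr : qg r by exact: qg_r.
have q1 := qg_lnpm I0 sg0 xc; have q2 := qg_lnpm J0 sg0 yc.
rewrite -EmixB// -/(r).
have -> : Emix sg xc r = \sum_o Emix sg xc (fun y => inq quant o y * r y).
  rewrite /Emix -avg_sumf; apply: eq_avg => i.
  rewrite -(E1_sum (index_enum _) (xc i) sg0 (fun o => qg_inq quant_meas o qr)); congr E1.
  by apply/funext => y; rewrite -mulr_suml sum_inq mul1r.
set M := 2 * E1 sg 0 (fun y => y ^+ 2) + 2 * B ^+ 2.
set d := 4 * (B + 2) / sg ^+ 2 / k.
set e := (2 * ((1 + 2 * B) * B / sg ^+ 2) + 1) * M / k.
have E2 : 0 <= E1 sg 0 (fun y => y ^+ 2) by apply: E1_ge0 => // y; exact: sqr_ge0.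
have M0 : 0 <= M by rewrite addr_ge0 ?mulr_ge0 ?sqr_ge0.
have T0 : 0 <= (1 + 2 * B) * B / sg ^+ 2 by rewrite divr_ge0 ?(ltW s2)// mulr_ge0//; lra.
have hcell (o : 'I_m) : Emix sg xc (fun y => inq quant (Some o) y * r y) <=
    P (Some o) * ln (P (Some o) / Q (Some o)) + 2 * d * P (Some o).
  pose y0 : R := o%:R / k ^+ 2 - k.
  apply: (kl_cell sg0 quant_meas I0 J0 (fun i => quant_cell_gt0 (xc i))
    (fun j => quant_cell_gt0 (yc j)) (r0 := r y0)) => y /eqP.
  have y0c : quant y0 == Some o.
    by rewrite quant_Some /y0 subrK divfK ?gt_eqF// lexx ltr_nat /=.
  have ay z : quant z == Some o -> `|z| <= k.
    move=> hz; have : ~~ (quant z == None) by rewrite (eqP hz).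
    by rewrite quant_None negbK => /andP[? /ltW ?]; rewrite ler_norml; apply/andP.
  move=> hy; have ny := ay _ hy; have ny0 := ay _ y0c.
  move: hy; rewrite quant_Some => /andP[h1 h2].
  have yy0 : `|y - y0| <= (k ^+ 2)^-1.
    rewrite /y0 -(ler_pM2r k2) mulVf ?gt_eqF// -{2}(gtr0_norm k2) -normrM.
    have -> : (y - (o%:R / k ^+ 2 - k)) * k ^+ 2 = (y + k) * k ^+ 2 - o%:R.
      by field; rewrite gt_eqF.
    rewrite -natr1 in h2; rewrite ler_norml; apply/andP; split; lra.
  have kk1 : (k ^+ 2)^-1 <= 1 by rewrite invf_le1// expr_ge1// ltW.
  have osc (H : finType) (zc : H -> R) z w : (0 < #|H|)%N -> (forall i, `|zc i| <= B) ->
      `|z| <= k -> `|w - z| <= (k ^+ 2)^-1 ->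
      ln (pm sg zc w) - ln (pm sg zc z) <= (B + 2) / sg ^+ 2 / k.
    move=> H0 zB hz hw; have := lnpm_diff H0 sg0 z (w - z) zB; rewrite [z + _]addrC subrK.
    move=> h; apply: (le_trans h).
    apply: (@le_trans _ _ ((k + B + 1) * (k ^+ 2)^-1 / sg ^+ 2)).
      rewrite ler_wpM2r ?invr_ge0 ?(ltW s2)//; apply: ler_pM => //; first by rewrite !addr_ge0.
      by rewrite lerD ?lerD// (le_trans hw).
    have -> : (B + 2) / sg ^+ 2 / k = (k * (B + 2)) * (k ^+ 2)^-1 / sg ^+ 2.
      by field; rewrite !gt_eqF.
    by rewrite ler_wpM2r ?invr_ge0 ?(ltW s2)// ler_wpM2r ?invr_ge0 ?(ltW k2)//; nra.
  have yy0' : `|y0 - y| <= (k ^+ 2)^-1 by rewrite distrC.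
  have o1 := osc _ xc _ _ I0 xB ny0 yy0; have o2 := osc _ xc _ _ I0 xB ny yy0'.
  have o3 := osc _ yc _ _ J0 yB ny0 yy0; have o4 := osc _ yc _ _ J0 yB ny yy0'.
  have -> : d = 4 * ((B + 2) / sg ^+ 2 / k) by rewrite /d; field; rewrite !gt_eqF.
  set D := (B + 2) / sg ^+ 2 / k in o1 o2 o3 o4 *.
  have D0 : 0 <= D by rewrite !divr_ge0 ?(ltW s2) ?(ltW k0)//; lra.
  by rewrite ler_norml /r; apply/andP; split; lra.
have tailN y : quant y = None -> k <= `|y|.
  move/eqP; rewrite quant_None; apply: contraR; rewrite -ltNge ltr_norml => /andP[/ltW -> ->]//.
(* In the tail cell |y| >= K >= 1, so y^2 / K is at least one and the second moment bounds the
   mass. *)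
have tail1 y : inq quant None y <= k^-1 * y ^+ 2.
  rewrite /inq; case: eqP => [/tailN h|_] /=; last by rewrite mulr_ge0 ?invr_ge0 ?sqr_ge0 ?(ltW k0).
  rewrite ler_pdivlMl// mulr1 -real_normK ?num_real// expr2; nra.
have tailr y : inq quant None y * r y <= 2 * ((1 + 2 * B) * B / sg ^+ 2) / k * y ^+ 2.
  rewrite /inq; case: eqP => [/tailN h|_] /=; last first.
    by rewrite mul0r mulr_ge0 ?sqr_ge0// divr_ge0 ?(ltW k0)// mulr_ge0.
  have := lnpm_gd y I0 xB; have := lnpm_gd y J0 yB; rewrite !ler_norml => /andP[a1 a2] /andP[a3 a4].
  rewrite mul1r -[y ^+ 2]real_normK ?num_real// /r.
  apply: (@le_trans _ _ (2 * ((`|y| + 2 * B) * B / sg ^+ 2))); first lra.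
  have -> : 2 * ((1 + 2 * B) * B / sg ^+ 2) / k * `|y| ^+ 2 =
    2 * (((1 + 2 * B) * `|y| ^+ 2 / k) * B / sg ^+ 2) by field; rewrite !gt_eqF.
  rewrite ler_pM2l// ler_wpM2r ?invr_ge0 ?(ltW s2)// ler_wpM2r// ler_pdivlMr// expr2.
  have h2 : `|y| * k <= `|y| * `|y| by rewrite ler_wpM2l.
  have h3 : k <= `|y| * `|y| by apply: le_trans h2; rewrite ler_peMl ?(ltW k0)// (le_trans k1).
  have := ler_wpM2l B0 h3; lra.
have hE (c : R) : 0 <= c -> Emix sg xc (fun y => c * y ^+ 2) <= c * M.
  by move=> c0; rewrite (EmixZ sg0 xc c (qg_sqr R)) ler_wpM2l//; exact: Emix_sqr.
have hN : Emix sg xc (fun y => inq quant None y * r y) - 2 * e <= P None * ln (P None / Q None).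
  apply: (kl_tail I0 J0 (fun i => quant_cell_gt0 (xc i)) (fun j => quant_cell_gt0 (yc j))).
    apply: (@le_trans _ _ (2 * ((1 + 2 * B) * B / sg ^+ 2) / k * M)).
      apply: (le_trans _ (hE _ _)); last by rewrite divr_ge0 ?(ltW k0)// mulr_ge0.
      exact: (le_EM sg0 xc (qg_inq quant_meas None qr) (qgZ _ (qg_sqr R)) tailr).
    rewrite /e [leLHS]mulrAC; apply: ler_wpM2r; first by rewrite invr_ge0 ltW.
    by rewrite ler_wpM2r//; lra.
  apply: (@le_trans _ _ (k^-1 * M)).
    rewrite mcellE.
    apply: (@le_trans _ _ (Emix sg yc (fun y => k^-1 * y ^+ 2))).
      exact: (le_EM sg0 yc (qg_inq1 quant_meas None) (qgZ _ (qg_sqr R)) tail1).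
    by rewrite (EmixZ sg0 yc k^-1 (qg_sqr R)) ler_wpM2l ?invr_ge0 ?(ltW k0)//; exact: Emix_sqr.
  rewrite /e mulrC; apply: ler_wpM2r; first by rewrite invr_ge0 ltW.
  by rewrite ler_peMl//; lra.
have -> : qcost / k = 2 * d + 2 * e by rewrite /qcost -/M /d /e; field; rewrite !gt_eqF.
have sP : \sum_o P o = 1.
  rewrite -avg_sumf -[RHS](avg_cst _ I0); by apply: eq_avg => i; rewrite (cell_sum sg0 quant_meas).
apply: (@le_trans _ _ (\sum_o (P o * ln (P o / Q o) + 2 * d * P o + (if o == None then 2 * e else 0)) -
   (2 * d + 2 * e))).
  rewrite lerD2r; apply: ler_sum => -[i|] _ /=; first by rewrite addr0; exact: hcell.
  have d0 : 0 <= d by rewrite !divr_ge0 ?(ltW s2) ?(ltW k0)// mulr_ge0//; lra.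
  have P0 : 0 <= P None by apply: avg_ge0 => i; exact: cell_ge0.
  have := mulr_ge0 d0 P0; lra.
by rewrite !big_split /= -mulr_sumr sP -big_mkcond big_pred1_eq mulr1; lra.
Qed.

End Mix.
End Gauss.
End Quantizer.

(** * Information bounds for one letter *)

Section Marginals.
Variable R : realType.
Variables (L O : finType) (p : L -> L -> L -> L -> O -> R).
Hypothesis L0 : (0 < #|L|)%N.

Lemma E4_W2 (g : L -> L -> L -> O -> R) :
  E4 (fun a b c d => \sum_o p a b c d o * g a b c o) =
  avg (fun a => avg (fun c => avg (fun b => \sum_o W2 p a b c o * g a b c o))).
Proof.
apply: eq_avg => a; rewrite avg_exch; apply: eq_avg => c; apply: eq_avg => b.
by rewrite avg_sumf; apply: eq_bigr => o _; rewrite avgZr.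
Qed.

Lemma E4_W1 (g : L -> L -> O -> R) :
  E4 (fun a b c d => \sum_o p a b c d o * g a c o) =
  avg (fun a => avg (fun c => \sum_o W1 p a c o * g a c o)).
Proof.
rewrite (E4_W2 (fun a _ c o => g a c o)); apply: eq_avg => a; apply: eq_avg => c.
by rewrite avg_sumf; apply: eq_bigr => o _; rewrite avgZr.
Qed.

End Marginals.

Section Info.
Variables (R : realType) (sg : R).
Hypothesis sg0 : 0 < sg.

(** The right-hand side is the mutual information between x and the quantized output, written as a
    mean of divergences; [quant_kl] is applied to each x. *)
Lemma mi_lower (K : nat) (X I : finType) (xc : X -> I -> R) (B : R) :
  (0 < K)%N -> (0 < #|X|)%N -> (0 < #|I|)%N -> 0 <= B -> (forall x i, `|xc x i| <= B) ->
  hh sg (fun z : X * I => xc z.1 z.2) - avg (fun x => hh sg (xc x)) - qcost sg B / K%:R <=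
  avg (fun x => \sum_o mcell (@quant R K) sg (xc x) o *
    ln (mcell (@quant R K) sg (xc x) o / mcell (@quant R K) sg (fun z : X * I => xc z.1 z.2) o)).
Proof.
move=> K0 X0 I0 B0 xB; set yc := fun z : X * I => xc z.1 z.2.
have XI0 : (0 < #|{: X * I}|)%N by rewrite card_prod muln_gt0 X0.
have yB z : `|yc z| <= B by exact: xB.
have -> : hh sg yc = - avg (fun x => Emix sg (xc x) (fun y => ln (pm sg yc y))).
  by rewrite /hh /Emix avg_pair.
rewrite -[qcost sg B / _](avg_cst _ X0) -avgN -!avgB; apply: le_avg => x.
have := quant_kl K0 sg0 B0 I0 XI0 (xB x) yB; rewrite /hh opprK; lra.
Qed.

Section Letter.
Variables (gs go ks es ths phs ko eo tho pho th' : R).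
Hypotheses (gs0 : 0 <= gs) (go0 : 0 <= go) (ks0 : 0 <= ks) (es0 : 0 <= es) (ko0 : 0 <= ko)
  (eo0 : 0 <= eo) (ths0 : 0 <= ths) (tho0 : 0 <= tho) (th'0 : 0 <= th').
Hypothesis th'E : ths * (gs * ks) + tho * (go * ko) <= th' * (gs * ks + go * ko).

Section N.
Variables (N K : nat).
Hypotheses (N0 : (0 < N)%N) (K0 : (0 < K)%N).
Notation L := 'I_N.

Definition pt (j : L) : R := j%:R / N%:R.
Definition pvs (j : L) : R := signal ths (gs * ks) (pt j).
Definition cms (j : L) : R := signal phs (gs * es) (pt j).
Definition pvo (j : L) : R := signal tho (go * ko) (pt j).
Definition cmo (j : L) : R := signal pho (go * eo) (pt j).

Definition centre a b c d : R := cms a + pvs b + (cmo c + pvo d).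
Definition lp a b c d o : R := cell (@quant R K) sg (centre a b c d) o.

(** Mixtures of what remains unknown at the receiver: both private signals, then with the own common
    signal ([na]), the other's common signal ([nb]), or both ([n0]). Nesting them through [grid]
    lets [stage] add one signal at a time. *)
Definition n1 : L * L -> R := grid pvo (signal ths (gs * ks)) (N := N).
Definition na : L * (L * L) -> R := grid n1 (signal phs (gs * es)) (N := N).
Definition nb : L * (L * L) -> R := grid n1 (signal pho (go * eo)) (N := N).
Definition n0 : L * (L * (L * L)) -> R := grid na (signal pho (go * eo)) (N := N).

Let cL : (0 < #|L|)%N. Proof. by rewrite card_ord. Qed.
Let cLL : (0 < #|{: L * L}|)%N. Proof. by rewrite card_prod muln_gt0 cL. Qed.
Let cLLL : (0 < #|{: L * (L * L)}|)%N. Proof. by rewrite card_prod muln_gt0 cL cLL. Qed.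

Definition bnd : R := gs * ks + gs * es + (go * ko + go * eo).

Let gks : 0 <= gs * ks. Proof. exact: mulr_ge0. Qed.
Let ges : 0 <= gs * es. Proof. exact: mulr_ge0. Qed.
Let gko : 0 <= go * ko. Proof. exact: mulr_ge0. Qed.
Let geo : 0 <= go * eo. Proof. exact: mulr_ge0. Qed.

Lemma bnd_ge0 : 0 <= bnd.
Proof. by rewrite /bnd !addr_ge0. Qed.

Lemma pt01 j : 0 <= pt j <= 1. Proof. exact: grid_in (ltnW (ltn_ord j)). Qed.

Lemma centre_bnd a b c d : `|centre a b c d| <= bnd.
Proof.
have /andP[h1 h2] := signal_bnd phs ges (pt01 a); have /andP[h3 h4] := signal_bnd ths gks (pt01 b).
have /andP[h5 h6] := signal_bnd pho geo (pt01 c); have /andP[h7 h8] := signal_bnd tho gko (pt01 d).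
rewrite /centre /cms /pvs /cmo /pvo /bnd ger0_norm; last by rewrite !addr_ge0.
lra.
Qed.

Lemma W1_mcell a c o : W1 lp a c o =
  mcell (@quant R K) sg (fun z : L * L => centre a z.1 c z.2) o.
Proof. by rewrite /mcell avg_pair. Qed.

Lemma Wa_mcell c o : Wa lp c o =
  mcell (@quant R K) sg (fun z : L * (L * L) => centre z.1 z.2.1 c z.2.2) o.
Proof. by rewrite /mcell avg_pair; apply: eq_avg => a; rewrite avg_pair. Qed.

Lemma Wb_mcell a o : Wb lp a o =
  mcell (@quant R K) sg (fun z : L * (L * L) => centre a z.2.1 z.1 z.2.2) o.
Proof. by rewrite /mcell avg_pair; apply: eq_avg => c; rewrite avg_pair. Qed.

Lemma W0_mcell o : W0 lp o =
  mcell (@quant R K) sg (fun z : (L * L) * (L * L) => centre z.1.2 z.2.1 z.1.1 z.2.2) o.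
Proof.
rewrite /mcell avg_pair avg_pair; apply: eq_avg => c; apply: eq_avg => a.
by rewrite avg_pair.
Qed.

(** Known codewords only translate the mixture, so its entropy does not depend on them. *)
Lemma hh_W2 a b c : hh sg (fun d => centre a b c d) = hh sg pvo.
Proof.
rewrite -(hh_shift cL sg0 pvo (cms a + pvs b + cmo c)); congr hh; apply/funext => d.
by rewrite /centre; ring.
Qed.

Lemma hh_W1 a c : hh sg (fun z : L * L => centre a z.1 c z.2) = hh sg n1.
Proof.
rewrite -(hh_shift cLL sg0 n1 (cms a + cmo c)); congr hh; apply/funext => z.
by rewrite /centre /n1 /grid /pvs /pt; ring.
Qed.

Lemma hh_Wa c : hh sg (fun z : L * (L * L) => centre z.1 z.2.1 c z.2.2) = hh sg na.
Proof.
rewrite -(hh_shift cLLL sg0 na (cmo c)); congr hh; apply/funext => z.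
by rewrite /centre /na /n1 /grid /pvs /cms /pt; ring.
Qed.

Lemma hh_Wb a : hh sg (fun z : L * (L * L) => centre a z.2.1 z.1 z.2.2) = hh sg nb.
Proof.
rewrite -(hh_shift cLLL sg0 nb (cms a)); congr hh; apply/funext => z.
by rewrite /centre /nb /n1 /grid /pvs /cmo /pt; ring.
Qed.

Lemma hh_W0 : hh sg (fun z : (L * L) * (L * L) => centre z.1.2 z.2.1 z.1.1 z.2.2) = hh sg n0.
Proof.
pose w (z : (L * L) * (L * L)) := centre z.1.2 z.2.1 z.1.1 z.2.2.
have av (F : R -> R) : avg (fun z => F (w z)) = avg (fun z => F (n0 z)).
  rewrite [LHS]avg_pair avg_pair [RHS]avg_pair; apply: eq_avg => c.
  rewrite avg_pair; apply: eq_avg => a; apply: eq_avg => z; congr (F _).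
  by rewrite /w /centre /n0 /na /n1 /grid /pvs /cms /cmo /pt /=; ring.
have pE y : pm sg w y = pm sg n0 y by exact: (av (fun x => gd sg (y - x))).
rewrite /hh (_ : (fun y => ln (pm sg w y)) = fun y => ln (pm sg n0 y)).
  by congr (- _); exact: (av (fun x => E1 sg x (fun y => ln (pm sg n0 y)))).
by apply/funext => y; rewrite pE.
Qed.

Let qe : R := qcost sg bnd / K%:R.

Lemma info3 : hh sg n1 - hh sg pvo - qe <=
  E4 (fun a b c d => \sum_o lp a b c d o * ln (W2 lp a b c o / W1 lp a c o)).
Proof.
rewrite (E4_W2 lp (fun a b c o => ln (W2 lp a b c o / W1 lp a c o))).
rewrite -[leLHS](avg_cst _ cL); apply: le_avg => a.
rewrite -[leLHS](avg_cst _ cL); apply: le_avg => c.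
have := mi_lower K0 cL cL bnd_ge0 (fun b d => centre_bnd a b c d) => /=.
rewrite hh_W1 (_ : avg _ = hh sg pvo); last first.
  by rewrite -[RHS](avg_cst _ cL); apply: eq_avg => b; exact: hh_W2.
move=> h; apply: (le_trans h); rewrite le_eqVlt; apply/orP; left; apply/eqP.
by apply: eq_avg => b; apply: eq_bigr => o _; rewrite W1_mcell.
Qed.

Lemma infoa : hh sg na - hh sg n1 - qe <=
  E4 (fun a b c d => \sum_o lp a b c d o * ln (W1 lp a c o / Wa lp c o)).
Proof.
rewrite (E4_W1 lp (fun a c o => ln (W1 lp a c o / Wa lp c o))) avg_exch.
rewrite -[leLHS](avg_cst _ cL); apply: le_avg => c.
have := mi_lower K0 cL cLL bnd_ge0 (fun a (z : L * L) => centre_bnd a z.1 c z.2) => /=.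
rewrite hh_Wa (_ : avg _ = hh sg n1); last first.
  by rewrite -[RHS](avg_cst _ cL); apply: eq_avg => b; exact: hh_W1.
move=> h; apply: (le_trans h); rewrite le_eqVlt; apply/orP; left; apply/eqP.
by apply: eq_avg => b; apply: eq_bigr => o _; rewrite W1_mcell Wa_mcell.
Qed.

Lemma infob : hh sg nb - hh sg n1 - qe <=
  E4 (fun a b c d => \sum_o lp a b c d o * ln (W1 lp a c o / Wb lp a o)).
Proof.
rewrite (E4_W1 lp (fun a c o => ln (W1 lp a c o / Wb lp a o))).
rewrite -[leLHS](avg_cst _ cL); apply: le_avg => a.
have := mi_lower K0 cL cLL bnd_ge0 (fun c (z : L * L) => centre_bnd a z.1 c z.2) => /=.
rewrite hh_Wb (_ : avg _ = hh sg n1); last first.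
  by rewrite -[RHS](avg_cst _ cL); apply: eq_avg => b; exact: hh_W1.
move=> h; apply: (le_trans h); rewrite le_eqVlt; apply/orP; left; apply/eqP.
by apply: eq_avg => b; apply: eq_bigr => o _; rewrite W1_mcell Wb_mcell.
Qed.

Lemma info0 : hh sg n0 - hh sg n1 - qe <=
  E4 (fun a b c d => \sum_o lp a b c d o * ln (W1 lp a c o / W0 lp o)).
Proof.
rewrite (E4_W1 lp (fun a c o => ln (W1 lp a c o / W0 lp o))) avg_exch.
have := mi_lower K0 cLL cLL bnd_ge0 (fun (x : L * L) (z : L * L) => centre_bnd x.2 z.1 x.1 z.2) => /=.
rewrite hh_W0 (_ : avg _ = hh sg n1); last first.
  by rewrite -[RHS](avg_cst _ cLL); apply: eq_avg => b; exact: hh_W1.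
move=> h; apply: (le_trans h); rewrite le_eqVlt; apply/orP; left; apply/eqP.
rewrite avg_pair; apply: eq_avg => c; apply: eq_avg => a.
by apply: eq_bigr => o _; rewrite W1_mcell W0_mcell.
Qed.

Lemma pvo_bnd d : 0 <= pvo d <= go * ko. Proof. exact: signal_bnd (pt01 d). Qed.

Lemma n1_bnd z : 0 <= n1 z <= gs * ks + go * ko.
Proof.
have /andP[h1 h2] := pvo_bnd z.2; have /andP[h3 h4] := signal_bnd ths gks (pt01 z.1).
by rewrite /n1 /grid -/(pt z.1) addr_ge0//= [leRHS]addrC lerD.
Qed.

Lemma na_bnd z : 0 <= na z <= gs * ks + go * ko + gs * es.
Proof.
have /andP[h1 h2] := n1_bnd z.2; have /andP[h3 h4] := signal_bnd phs ges (pt01 z.1).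
by rewrite /na /grid -/(pt z.1) addr_ge0//= lerD.
Qed.

Lemma hh_pvo : hh sg pvo <= hnoise sg + ln 2 * Cbar sg (go * ko) tho.
Proof. by apply: hh_le_Cbar => //; [exact: pvo_bnd|exact: signal_avg]. Qed.

Lemma hh_n1 : hh sg n1 <= hnoise sg + ln 2 * Cbar sg (gs * ks + go * ko) th'.
Proof.
apply: hh_le_Cbar => //; [exact: addr_ge0|exact: n1_bnd|].
apply: le_trans th'E; rewrite /n1 /grid avg_pair.
under eq_avg do rewrite avgD /= avg_cst//.
rewrite avgD avg_cst// addrC lerD//; exact: signal_avg.
Qed.

End N.

(** The right-hand side is ln (1 + S / e^(2v)) / 2 with S the sum of the entropy powers; it
    decreases in v, so the upper bound on the interference entropy v can be inserted. *)
Lemma Ffun_ln (a1 a2 a3 t1 t2 t3 v : R) : v <= hnoise sg + ln 2 * Cbar sg a3 t3 ->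
  0 <= rho t1 -> 0 <= rho t2 ->
  ln 2 * Ffun sg a1 a2 a3 t1 t2 t3 <=
  2^-1 * ln (epw t1 a1 + epw t2 a2 + expR (2 * v)) - v.
Proof.
move=> hv r1 r2.
have p0 : 0 < pi *+ 2 * expR 1 :> R by rewrite mulr_gt0 ?expR_gt0// pmulrn_lgt0// pi_gt0.
have s2 : 0 < sg ^+ 2 by rewrite exprn_gt0.
have ev := expR_gt0 (2 * v).
rewrite /Ffun mulrCA log2_mul_ln2.
set S := rho t1 * a1 ^+ 2 + rho t2 * a2 ^+ 2.
have S0 : 0 <= S by rewrite addr_ge0// mulr_ge0// sqr_ge0.
have -> : epw t1 a1 + epw t2 a2 = pi *+ 2 * expR 1 * S by rewrite /epw -mulrDr.
have -> : 2^-1 * ln (pi *+ 2 * expR 1 * S + expR (2 * v)) - v =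
   2^-1 * ln (1 + pi *+ 2 * expR 1 * S / expR (2 * v)).
  have -> : 1 + pi *+ 2 * expR 1 * S / expR (2 * v) = (pi *+ 2 * expR 1 * S + expR (2 * v)) / expR (2 * v).
    by move: (pi *+ 2 * expR 1 * S) => Z; field; rewrite gt_eqF.
  have Z0 : 0 < pi *+ 2 * expR 1 * S + expR (2 * v).
    by rewrite ltr_wpDl// mulr_ge0// ltW.
  have -> : ln ((pi *+ 2 * expR 1 * S + expR (2 * v)) / expR (2 * v)) =
      ln (pi *+ 2 * expR 1 * S + expR (2 * v)) - 2 * v by rewrite lndiv2// expRK.
  by field.
rewrite ler_pM2l ?invr_gt0// ler_ln ?posrE; last 2 first.
- by rewrite ltr_pwDl// divr_ge0// mulr_ge0 ?(ltW s2) ?powR_ge0.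
- by rewrite ltr_pwDl// divr_ge0 ?(ltW ev)// mulr_ge0 ?(ltW p0).
rewrite lerD2l.
have hn : expR (2 * hnoise sg) = pi *+ 2 * expR 1 * sg ^+ 2.
  by rewrite /hnoise mulrA divff// mul1r lnK// posrE mulr_gt0.
have pw : 2 `^ (2 * Cbar sg a3 t3) = expR (2 * (ln 2 * Cbar sg a3 t3)).
  by rewrite /powR pnatr_eq0 /=; congr expR; ring.
rewrite pw; set w := expR (2 * (ln 2 * _)); have w0 : 0 < w by exact: expR_gt0.
have key : expR (2 * v) <= pi *+ 2 * expR 1 * (sg ^+ 2 * w).
  by rewrite mulrA -hn -expRD ler_expR; lra.
rewrite ler_pdivrMr ?mulr_gt0// mulrAC ler_pdivlMr//.
by rewrite [leRHS]mulrAC mulrC ler_wpM2r.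
Qed.

Lemma rho_ge0 t : 0 <= rho t :> R.
Proof.
have p0 : 0 < pi *+ 2 :> R by rewrite pmulrn_lgt0// pi_gt0.
rewrite /rho; case: ifP => _; last by rewrite invr_ge0 mulr_ge0 ?expR_ge0// ltW.
by rewrite mulr_ge0 ?sqr_ge0// divr_ge0 ?expR_ge0// ltW.
Qed.

Lemma epw_ge0 t k : 0 <= epw t k :> R.
Proof.
apply: mulr_ge0; last by rewrite mulr_ge0 ?rho_ge0 ?sqr_ge0.
by rewrite mulr_ge0 ?expR_ge0// pmulrn_lge0// pi_ge0.
Qed.

Lemma epw0 t : epw t 0 = 0 :> R.
Proof. by rewrite /epw expr0n /= !mulr0. Qed.

(** Chains two stages for the two common signals. Multiplying by e^(-2c) <= 1 carries the first
    error out of the inner entropy power at no extra loss. *)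
Lemma epi_twice (e1 e2 X c v : R) : 0 <= e1 -> 0 <= e2 -> 0 < X -> 0 <= c ->
  2^-1 * ln (e1 + X) - c <= v -> 2^-1 * ln (e1 + e2 + X) - c <= 2^-1 * ln (e2 + expR (2 * v)).
Proof.
move=> e10 e20 X0 c0 h; have y0 : 0 < e1 + X by lra.
have y1 : expR (- (2 * c)) * (e1 + X) <= expR (2 * v).
  rewrite -{1}[e1 + X]lnK ?posrE// -expRD ler_expR; lra.
have y2 : expR (- (2 * c)) <= 1 by rewrite -[leRHS]expR0 ler_expR; lra.
have y3 : expR (- (2 * c)) * (e1 + e2 + X) <= e2 + expR (2 * v).
  have := ler_wpM2r e20 y2; lra.
have y4 : 0 < e1 + e2 + X by lra.
have y5 : 0 < expR (- (2 * c)) * (e1 + e2 + X) by rewrite mulr_gt0 ?expR_gt0.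
have : ln (expR (- (2 * c)) * (e1 + e2 + X)) <= ln (e2 + expR (2 * v)).
  by rewrite ler_ln ?posrE// (lt_le_trans y5).
rewrite lnM2 ?expR_gt0// expRK; lra.
Qed.

Lemma chain (f x v c n q y e : R) :
  f <= x - v -> x - c <= n -> n - v - q <= y -> c + q <= e -> f - e <= y.
Proof. lra. Qed.

Lemma chain2 (f x x' v c c' n q y e : R) :
  f <= x - v -> x - c <= x' -> x' - c' <= n -> n - v - q <= y -> c + c' + q <= e -> f - e <= y.
Proof. lra. Qed.

Lemma budget (a b c d q e : R) : 0 <= a -> 0 <= b -> 0 <= c -> 0 <= d ->
  a + b + c + d + q <= e -> [/\ a + q <= e, b + q <= e, c + q <= e & b + d + q <= e].
Proof. by move=> *; split; lra. Qed.

Lemma letter_info : exists2 C : R, 0 <= C & forall N K : nat, (0 < N)%N -> (0 < K)%N ->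
  let p := @lp N K in
  let e := C / N%:R + C / K%:R in
  [/\ ln 2 * Ffun sg 0 (gs * ks) (go * ko) 1 ths tho - e <=
        E4 (fun a b c d => \sum_o p a b c d o * ln (W2 p a b c o / W1 p a c o)),
      ln 2 * Ffun sg 0 (gs * es) (gs * ks + go * ko) 1 phs th' - e <=
        E4 (fun a b c d => \sum_o p a b c d o * ln (W1 p a c o / Wa p c o)),
      ln 2 * Ffun sg 0 (go * eo) (gs * ks + go * ko) 1 pho th' - e <=
        E4 (fun a b c d => \sum_o p a b c d o * ln (W1 p a c o / Wb p a o)) &
      ln 2 * Ffun sg (gs * es) (go * eo) (gs * ks + go * ko) phs pho th' - e <=
        E4 (fun a b c d => \sum_o p a b c d o * ln (W1 p a c o / W0 p o))].
Proof.
have gks : 0 <= gs * ks by exact: mulr_ge0.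
have ges : 0 <= gs * es by exact: mulr_ge0.
have gko : 0 <= go * ko by exact: mulr_ge0.
have geo : 0 <= go * eo by exact: mulr_ge0.
have [C1 C10 h1] := stage sg0 ths (go * ko) gks.
have [C2 C20 h2] := stage sg0 phs (gs * ks + go * ko) ges.
have [C3 C30 h3] := stage sg0 pho (gs * ks + go * ko) geo.
have [C4 C40 h4] := stage sg0 pho (gs * ks + go * ko + gs * es) geo.
set qc := qcost sg bnd.
have q0 : 0 <= qc.
  have b0 := bnd_ge0.
  have e0 : 0 <= E1 sg 0 (fun y => y ^+ 2) by apply: E1_ge0 => // y; exact: sqr_ge0.
  have i0 : 0 <= (sg ^+ 2)^-1 by rewrite invr_ge0 sqr_ge0.
  have t1 : 0 <= 8 * (bnd + 2) by lra.
  have t2 : 0 <= (1 + 2 * bnd) * bnd by apply: mulr_ge0 => //; lra.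
  have t3 := mulr_ge0 t2 i0.
  have t4 : 0 <= 2 * E1 sg 0 (fun y => y ^+ 2) + 2 * bnd ^+ 2.
    by have := sqr_ge0 bnd; lra.
  have t5 : 0 <= 2 * (2 * ((1 + 2 * bnd) * bnd / sg ^+ 2) + 1) by lra.
  by have := mulr_ge0 t1 i0; have := mulr_ge0 t5 t4; rewrite /qc /qcost; lra.
pose C := C1 + C2 + C3 + C4 + qc.
exists C; first by rewrite /C; lra.
move=> N K N0 K0 p e; have N0' : 0 < N%:R :> R by rewrite ltr0n.
have K0' : 0 < K%:R :> R by rewrite ltr0n.
have cL : (0 < #|'I_N|)%N by rewrite card_ord.
have cLL : (0 < #|{: 'I_N * 'I_N}|)%N by rewrite card_prod muln_gt0 cL.
have cLLL : (0 < #|{: 'I_N * ('I_N * 'I_N)}|)%N by rewrite card_prod muln_gt0 cL cLL.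
have iN : 0 <= N%:R^-1 :> R by rewrite invr_ge0 ltW.
have iK : 0 <= K%:R^-1 :> R by rewrite invr_ge0 ltW.
have [m1 m2 m3 m4] : [/\ 0 <= C1 / N%:R, 0 <= C2 / N%:R, 0 <= C3 / N%:R & 0 <= C4 / N%:R].
  by split; exact: mulr_ge0.
have m5 : 0 <= qc / N%:R by exact: mulr_ge0.
have eE : C1 / N%:R + C2 / N%:R + C3 / N%:R + C4 / N%:R + qc / K%:R <= e.
  rewrite -subr_ge0 (_ : e - _ = qc / N%:R + (C1 + C2 + C3 + C4) / K%:R); last by rewrite /e /C; ring.
  by rewrite addr_ge0// mulr_ge0//; lra.
have [d1 d2 d3 d4] := budget m1 m2 m3 m4 eE.
have e0 := epw0.
have s1 := h1 N _ (@pvo N) cL N0 (@pvo_bnd N).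
have s2 := h2 N _ (@n1 N) cLL N0 (@n1_bnd N).
have s3 := h3 N _ (@n1 N) cLL N0 (@n1_bnd N).
have s4 := h4 N _ (@na N) cLLL N0 (@na_bnd N).
have f1 := Ffun_ln 0 (gs * ks) (t1 := 1) (t2 := ths) (hh_pvo N0) (rho_ge0 1) (rho_ge0 ths).
have hn := hh_n1 N0.
have f2 := Ffun_ln 0 (gs * es) (t1 := 1) (t2 := phs) hn (rho_ge0 1) (rho_ge0 phs).
have f3 := Ffun_ln 0 (go * eo) (t1 := 1) (t2 := pho) hn (rho_ge0 1) (rho_ge0 pho).
have f4 := Ffun_ln (gs * es) (go * eo) hn (rho_ge0 phs) (rho_ge0 pho).
rewrite !e0 !add0r in f1 f2 f3.
have i3' := info3 N0 K0; have ia' := infoa N0 K0; have ib' := infob N0 K0; have i0' := info0 N0 K0.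
rewrite -/p -/qc in i3' ia' ib' i0'.
have s5 : 2^-1 * ln (epw phs (gs * es) + epw pho (go * eo) + expR (2 * hh sg (@n1 N))) - C2 / N%:R <=
    2^-1 * ln (epw pho (go * eo) + expR (2 * hh sg (@na N))).
  exact: epi_twice (epw_ge0 _ _) (epw_ge0 _ _) (expR_gt0 _) m2 s2.
split.
- exact: (chain f1 s1 i3' d1).
- exact: (chain f2 s2 ia' d2).
- exact: (chain f3 s3 ib' d3).
- exact: (chain2 f4 s5 s4 i0' d4).
Qed.

End Letter.
End Info.

(** * Codes from random codebooks *)

Section TypeSequence.
Variable R : realType.

(* Each letter k is used about n (1 - e) w_k times; the remaining positions hold the idle letter None,
   which leaves room in the average cost constraint. *)
Lemma type_sequence (m : nat) (w : 'I_m -> R) (e : R) (n : nat) :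
  (forall k, 0 <= w k) -> \sum_k w k = 1 -> 0 <= e -> e <= 1 ->
  exists tau : 'I_n -> option 'I_m, forall F : option 'I_m -> R,
    F None = 0 -> (forall k, 0 <= F (Some k)) ->
    n%:R * ((1 - e) * \sum_k w k * F (Some k)) - \sum_k F (Some k) <= \sum_t F (tau t) <=
    n%:R * ((1 - e) * \sum_k w k * F (Some k)).
Proof.
move=> w0 w1 e0 e1.
pose nk (k : 'I_m) := Num.truncn (n%:R * ((1 - e) * w k)).
have nkP k : (nk k)%:R <= n%:R * ((1 - e) * w k) < (nk k).+1%:R.
  by apply: truncn_itv; rewrite !mulr_ge0// subr_ge0.
pose s := flatten [seq nseq (nk k) (Some k) | k <- enum 'I_m].
have sE (F : option 'I_m -> R) : \sum_(x <- s) F x = \sum_k (nk k)%:R * F (Some k).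
  rewrite big_flatten big_map big_enum; apply: eq_bigr => k _.
  by rewrite big_nseq iter_addr_0 mulr_natl.
have szs : (size s <= n)%N.
  have := sE (fun=> 1); rewrite big_const_seq count_predT iter_addr_0 => szE.
  rewrite -(ler_nat R) szE; apply: (@le_trans _ _ (\sum_k n%:R * ((1 - e) * w k))).
    by apply: ler_sum => k _; rewrite mulr1; have /andP[] := nkP k.
  by rewrite -!mulr_sumr w1 mulr1 ler_piMr//; lra.
exists (fun t => nth None s t) => F F0 Fp.
have -> : \sum_(t < n) F (nth None s t) = \sum_k (nk k)%:R * F (Some k).
  rewrite -sE (big_nth None) -(big_mkord predT (fun t => F (nth None s t))).
  rewrite (big_cat_nat (leq0n _) szs)//= [X in _ + X]big_nat_cond [X in _ + X]big1 ?addr0//.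
  by move=> i /andP[/andP[h _] _]; rewrite nth_default.
rewrite !mulr_sumr -sumrB; apply/andP; split; apply: ler_sum => k _.
  have /andP[_ h] := nkP k; rewrite -natr1 in h.
  have := ler_wpM2r (Fp k) (ltW h); lra.
have /andP[h _] := nkP k; have := ler_wpM2r (Fp k) h; lra.
Qed.

Lemma fin_bounded (Z : finType) (F : Z -> R) : exists2 B : R, 0 <= B & forall z, `|F z| <= B.
Proof.
exists (\sum_z `|F z|); first exact: sumr_ge0.
by move=> z; rewrite (bigD1 z)//= lerDl sumr_ge0.
Qed.

End TypeSequence.

Section CodeN.
Variable R : realType.
Variables (sg A : R) (h : 'I_2 -> 'I_2 -> R) (alpha : 'I_2 -> R).
Variables (n : nat) (L O : finType) (q : R -> O) (xl : 'I_2 -> 'I_n -> L -> L -> R).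
Hypotheses (sg0 : 0 < sg) (A0 : 0 <= A) (al0 : forall i, 0 <= alpha i).
Hypotheses (mq : forall o, measurable [set y : R | q y = o]).
Hypotheses (cp : forall x o, 0 < cell q sg x o) (L0 : (0 < #|L|)%N).
Hypothesis xlA : forall i t a b, 0 <= xl i t a b <= A.
Notation X := {ffun 'I_n -> L}.
Notation Y := {ffun 'I_n -> O}.

Definition pch i t a b c d o : R :=
  cell q sg (h i i * xl i t a b + h (oth i) i * xl (oth i) t c d) o.

(** Strict, so that its negation is the event that [cost_le] bounds. *)
Definition okw i (u v : X) : bool := \sum_t xl i t (u t) (v t) < n%:R * (alpha i * A).

Definition word i (u v : X) : n.-tuple R :=
  mktuple (fun t => if okw i u v then xl i t (u t) (v t) else 0).

Lemma word_ok i u v : codeword_ok A (alpha i) (word i u v).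
Proof.
rewrite /codeword_ok; split => [t|].
  by rewrite tnth_mktuple; case: ifP => // _; rewrite lexx.
under eq_bigr do rewrite tnth_mktuple.
case: (boolP (okw i u v)) => [/ltW//|_]; rewrite big1// mulr_ge0// mulr_ge0//.
Qed.

Definition out i (x x' z : n.-tuple R) : n.-tuple R :=
  mktuple (fun t => h i i * tnth x t + h (oth i) i * tnth x' t + tnth z t).

Definition qz (y : n.-tuple R) : Y := [ffun t => q (tnth y t)].

Lemma out_expect i (x x' : n.-tuple R) (E : pred Y) :
  gauss_expect sg (fun z => ((E (qz (out i x x' z)))%:R)%:E) =
  (\sum_(y : Y) (\prod_t cell q sg (h i i * tnth x t + h (oth i) i * tnth x' t) (y t)) * (E y)%:R)%:E.
Proof.
pose s : n.-tuple R := mktuple (fun t => h i i * tnth x t + h (oth i) i * tnth x' t).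
pose G (b : n.-tuple O) : R := (E [ffun t => tnth b t])%:R.
transitivity (gauss_expect sg (fun z : n.-tuple R =>
    (G (mktuple (fun t => q (tnth s t + tnth z t))))%:E)).
  congr gauss_expect; apply/funext => z; congr ((nat_of_bool (E _))%:R%:E).
  by apply/ffunP => t; rewrite !ffunE !tnth_mktuple.
rewrite (gauss_dsum sg0 mq) ?dsumE; last by move=> b; rewrite /G.
congr EFin; apply: eq_bigr => y _.
have -> : G (mktuple y) = (E y)%:R.
  by congr (nat_of_bool (E _))%:R; apply/ffunP => t; rewrite !ffunE tnth_mktuple.
have -> : \prod_t cell q sg (tnth s t) (y t) =
    \prod_t cell q sg (h i i * tnth x t + h (oth i) i * tnth x' t) (y t); last by [].
by apply: eq_bigr => t _; rewrite tnth_mktuple.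
Qed.

(** When both words are admissible the expectation is the block sum; otherwise it is at most one,
    which an indicator pays for. *)
Lemma recv_bound i u v u' v' (E : pred Y) :
  (gauss_expect sg (fun z => ((E (qz (out i (word i u v) (word (oth i) u' v') z)))%:R)%:E) <=
  (\sum_y block (pch i) u v u' v' y * (E y)%:R + (~~ okw i u v)%:R + (~~ okw (oth i) u' v')%:R)%:E)%E.
Proof.
rewrite out_expect lee_fin.
have p0 (s : 'I_n -> R) (y : Y) : 0 <= \prod_t cell q sg (s t) (y t).
  by apply: prodr_ge0 => t _; exact/ltW.
have b0 : 0 <= \sum_y block (pch i) u v u' v' y * (E y)%:R.
  by apply: sumr_ge0 => y _; rewrite mulr_ge0// p0.
have le1 (s : 'I_n -> R) : \sum_(y : Y) (\prod_t cell q sg (s t) (y t)) * (E y)%:R <= 1.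
  apply: (@le_trans _ _ (\sum_(y : Y) \prod_t cell q sg (s t) (y t))).
    by apply: ler_sum => y _; rewrite ler_piMr// lern1 leq_b1.
  rewrite (sum_prod (fun t o => cell q sg (s t) o)) big1// => t _.
  exact: (cell_sum sg0 mq).
have [k1|n1] := boolP (okw i u v); last first.
  by apply: (le_trans (le1 _)); rewrite /= mulr1n addrAC lerDr addr_ge0.
have [k2|n2] := boolP (okw (oth i) u' v'); last first.
  by apply: (le_trans (le1 _)); rewrite /= mulr1n lerDr addr_ge0.
rewrite /= !addr0 le_eqVlt; apply/orP; left; apply/eqP; apply: eq_bigr => y _.
have -> : \prod_t cell q sg (h i i * tnth (word i u v) t + h (oth i) i * tnth (word (oth i) u' v') t) (y t)
    = block (pch i) u v u' v' y; last by [].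
by apply: eq_bigr => t _; rewrite !tnth_mktuple k1 k2.
Qed.

Lemma qz_meas (E : set Y) : measurable [set y : n.-tuple R | E (qz y)].
Proof.
have -> : [set y : n.-tuple R | E (qz y)] =
    \bigcup_(b in E) \bigcap_(t in [set: 'I_n]) [set y : n.-tuple R | q (tnth y t) = b t].
  apply/seteqP; split => [y /= Ey|y [b Eb hb] /=].
    by exists (qz y) => // t _ /=; rewrite ffunE.
  suff -> : qz y = b by [].
  by apply/ffunP => t; rewrite ffunE; exact: hb.
apply: fin_bigcup_measurable; first exact: finite_finset.
move=> b _; apply: fin_bigcap_measurable; first exact: finite_finset.
move=> t _; have mt : measurable_fun (setT : set (n.-tuple R)) (fun y : n.-tuple R => tnth y t).
  exact: measurable_tnth.
by have := mt measurableT _ (mq (b t)); rewrite setTI.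
Qed.

Section Codes.
Variables (C Q M : 'I_2 -> nat) (spl : forall i, 'I_(M i) -> 'I_(C i) * 'I_(Q i)).
Arguments spl : clear implicits.
Hypothesis spl_inj : forall i, injective (spl i).
Variable m0 : forall i, 'I_(M i).
Variables (g3 ga gb g0 : 'I_2 -> R).

(** Messages occupy only part of the index pairs; a pair carrying no message, like a failed search,
    is decoded to the default [m0]. *)
Definition deco i (f : {ffun 'I_(C i) -> X}) (g : {ffun 'I_(Q i) -> X})
    (f' : {ffun 'I_(C (oth i)) -> X}) (y : Y) : 'I_(M i) :=
  if joint_decode (block (pch i)) (expR (g3 i)) (expR (ga i)) (expR (gb i)) (expR (g0 i)) f g f' y is Some z
  then odflt (m0 i) [pick m | spl i m == z] else m0 i.

Lemma deco_err i f g f' y m : (deco f g f' y != m) ->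
  joint_decode (block (pch i)) (expR (g3 i)) (expR (ga i)) (expR (gb i)) (expR (g0 i)) f g f' y
    != Some ((spl i m).1, (spl i m).2).
Proof.
apply: contra => /eqP; rewrite /deco => ->; rewrite -surjective_pairing.
case: pickP => [m' /eqP/spl_inj ->//|/(_ m)]; by rewrite eqxx.
Qed.

Notation perr i := (Perr (block (pch i)) (expR (g3 i)) (expR (ga i)) (expR (gb i)) (expR (g0 i))).

Definition enc i (f : {ffun 'I_(C i) -> X}) (g : {ffun 'I_(Q i) -> X}) (m : 'I_(M i)) : n.-tuple R :=
  word i (f (spl i m).1) (g (spl i m).2).

Lemma user_err i f g f' g' m m' :
  (gauss_expect sg (fun z => ((deco f g f' (qz (out i (enc f g m) (@enc (oth i) f' g' m') z)) != m)%:R)%:E) <=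
   (perr i (spl i m).1 (spl i m).2 (spl (oth i) m').1 (spl (oth i) m').2 f g f' g' +
     (~~ okw i (f (spl i m).1) (g (spl i m).2))%:R +
     (~~ okw (oth i) (f' (spl (oth i) m').1) (g' (spl (oth i) m').2))%:R)%:E)%E.
Proof.
apply: (le_trans (recv_bound i _ _ _ _ (fun y => deco f g f' y != m))).
rewrite lee_fin -!addrA lerD2r; apply: ler_sum => y _; apply: ler_wpM2l.
  by apply: block_ge0 => *; exact: cp.
by rewrite ler_nat; case: (boolP (_ != m)) => // /deco_err ->.
Qed.

Lemma EE_other12 (c : 'I_(C ord_max)) (p : 'I_(Q ord_max)) (F : X -> X -> R) :
  EE (fun (f : {ffun 'I_(C ord0) -> X}) (g : {ffun 'I_(Q ord0) -> X}) f' g' => F (f' c) (g' p)) =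
  avg (fun u => avg (F u)).
Proof. by rewrite EE_swap EE_12//; exact: X0. Qed.

(** One set of codebooks must serve both receivers and all message pairs, so the sum of all these
    errors is averaged; its terms being nonnegative, each receiver's error is then bounded by the
    total. The factor 2 arises because either user's violation may harm either receiver. *)
Lemma code_exists (b d : 'I_2 -> R) :
  (forall i c p c' p', EE (@Perr _ _ _ _ (block (pch i)) (expR (g3 i)) (expR (ga i)) (expR (gb i))
     (expR (g0 i)) 'I_(C i) 'I_(Q i) 'I_(C (oth i)) 'I_(Q (oth i)) c p c' p') <= b i) ->
  (forall i, avg (fun u : X => avg (fun v : X => (~~ okw i u v)%:R)) <= d i) ->
  let e := b ord0 + b ord_max + 2 * (d ord0 + d ord_max) in
  exists D  : Defs.code R n (M ord0) (M ord_max),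
    [/\ code_ok A alpha D, (Perr1 sg h D <= e%:E)%E & (Perr2 sg h D <= e%:E)%E].
Proof.
move=> hb hd e.
pose nok i (f : {ffun 'I_(C i) -> X}) (g : {ffun 'I_(Q i) -> X}) m : R :=
  (~~ okw i (f (spl i m).1) (g (spl i m).2))%:R.
pose e0 (m : 'I_(M ord0)) (m' : 'I_(M ord_max)) f g f' g' :=
  perr ord0 (spl ord0 m).1 (spl ord0 m).2 (spl ord_max m').1 (spl ord_max m').2 f g f' g'.
pose e1 (m : 'I_(M ord0)) (m' : 'I_(M ord_max)) f g f' g' :=
  perr ord_max (spl ord_max m').1 (spl ord_max m').2 (spl ord0 m).1 (spl ord0 m).2 f' g' f g.
pose tot m m' f g f' g' := e0 m m' f g f' g' + e1 m m' f g f' g' +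
  (@nok ord0 f g m + @nok ord_max f' g' m') + (@nok ord0 f g m + @nok ord_max f' g' m').
have Etot m m' : EE (tot m m') <= e.
  rewrite /tot !EED.
  have h0 : EE (e0 m m') <= b ord0 by exact: (hb ord0).
  have h1 : EE (e1 m m') <= b ord_max by rewrite EE_swap; exact: (hb ord_max).
  have h2 : EE (fun f g (f' : {ffun 'I_(C ord_max) -> X}) (g' : {ffun 'I_(Q ord_max) -> X}) => @nok ord0 f g m) <= d ord0.
    by rewrite (EE_12 _ _ (X0 n L0) (X0 n L0) (spl ord0 m).1 (spl ord0 m).2 (fun u v => (~~ okw ord0 u v)%:R)).
  have h3 : EE (fun (f : {ffun 'I_(C ord0) -> X}) (g : {ffun 'I_(Q ord0) -> X}) f' g' => @nok ord_max f' g' m') <= d ord_max.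
    by rewrite (EE_other12 (spl ord_max m').1 (spl ord_max m').2 (fun u v => (~~ okw ord_max u v)%:R)).
  by rewrite /e; lra.
have : EE (fun f g f' g' => \sum_m \sum_m' tot m m' f g f' g') <= \sum_(m < M ord0) \sum_(m' < M ord_max) e.
  rewrite (EE_sum xpredT); apply: ler_sum => m _.
  by rewrite (EE_sum xpredT); apply: ler_sum => m' _.
move=> /(EE_ex (X0 n L0) (X0 n L0))[f [g [f' [g' hs]]]].
pose D  : Defs.code R n (M ord0) (M ord_max) := Code (@enc ord0 f g) (@enc ord_max f' g')
  (fun y => @deco ord0 f g f' (qz y)) (fun y => @deco ord_max f' g' f (qz y)).
have Mp : 0 < (M ord0 * M ord_max)%:R :> R.
  by rewrite ltr0n muln_gt0 (leq_ltn_trans (leq0n _) (ltn_ord (m0 ord0)))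
    (leq_ltn_trans (leq0n _) (ltn_ord (m0 ord_max))).
have sumE : \sum_(m < M ord0) \sum_(m' < M ord_max) e = (M ord0 * M ord_max)%:R * e.
  by rewrite !sumr_const !card_ord -mulrnA mulr_natl mulnC.
have pe0 m m' : 0 <= e0 m m' f g f' g'.
  by apply: sumr_ge0 => y _; rewrite mulr_ge0//; apply: block_ge0 => *; exact: cp.
have pe1 m m' : 0 <= e1 m m' f g f' g'.
  by apply: sumr_ge0 => y _; rewrite mulr_ge0//; apply: block_ge0 => *; exact: cp.
have pn0 m : 0 <= @nok ord0 f g m by [].
have pn1 m : 0 <= @nok ord_max f' g' m by [].
have fin (H : 'I_(M ord0) -> 'I_(M ord_max) -> \bar R) :
    (forall m m', (H m m' <= (tot m m' f g f' g')%:E)%E) ->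
    ((((M ord0 * M ord_max)%:R)^-1%:E * \sum_m \sum_m' H m m' <= e%:E)%E).
  move=> hH; rewrite lee_pdivrMl// -EFinM -sumE.
  apply: (@le_trans _ _ (\sum_m \sum_m' (tot m m' f g f' g')%:E)%E).
    by apply: lee_sum => m _; apply: lee_sum => m' _.
  by under eq_bigr do rewrite sumEFin; rewrite sumEFin lee_fin.
exists D; split.
- split; first by move=> m; exact: word_ok.
  split; first by move=> m; exact: word_ok.
  split=> m.
    exact: (qz_meas [set y | @deco ord0 f g f' y = m]).
  exact: (qz_meas [set y | @deco ord_max f' g' f y = m]).
- apply: fin => m m'; have h1 := @user_err ord0 f g f' g' m m'.
  apply: (le_trans h1); rewrite lee_fin /tot.
  have := pe1 m m'; have := pn0 m; have := pn1 m'.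
  rewrite -/(e0 m m' f g f' g') -/(@nok ord0 f g m) -/(@nok ord_max f' g' m'); lra.
- apply: fin => m m'; have h1 := @user_err ord_max f' g' f g m' m.
  apply: (le_trans h1); rewrite lee_fin /tot.
  have := pe0 m m'; have := pn0 m; have := pn1 m'.
  rewrite -/(e1 m m' f g f' g') -/(@nok ord0 f g m) -/(@nok ord_max f' g' m'); lra.
Qed.

End Codes.
End CodeN.

(** * Achievable rates *)

Section Rates.
Variables (R : realType) (sg : R) (h : 'I_2 -> 'I_2 -> R).
Hypotheses (sg0 : 0 < sg) (h0 : forall k l, 0 <= h k l).

Lemma ord2P (i : 'I_2) : i = ord0 \/ i = ord_max.
Proof.
case: i => [[|[|//]]] hi; [left|right]; exact: val_inj.
Qed.

Lemma othK : involutive oth.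
Proof. by move=> i; case: (ord2P i) => ->. Qed.

Lemma oth_neq i : i != oth i.
Proof. by case: (ord2P i) => ->. Qed.

Lemma Ffun_le (a1 a2 b1 b2 a3 t1 t2 u1 u2 t3 : R) :
  0 <= rho t1 * a1 ^+ 2 + rho t2 * a2 ^+ 2 <= rho u1 * b1 ^+ 2 + rho u2 * b2 ^+ 2 ->
  Ffun sg a1 a2 a3 t1 t2 t3 <= Ffun sg b1 b2 a3 u1 u2 t3.
Proof.
move=> /andP[x0 xy]; rewrite /Ffun ler_pM2l ?invr_gt0// /log2.
have l2 : 0 < ln 2 :> R by rewrite ln_gt0// ltr1n.
rewrite ler_pM2r ?invr_gt0//.
set den := sg ^+ 2 * _; have d0 : 0 < den by rewrite mulr_gt0 ?exprn_gt0// powR_gt0.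
rewrite ler_ln ?posrE ?ltr_pwDl ?divr_ge0 ?(ltW d0)//; last exact: le_trans xy.
by rewrite lerD2l ler_wpM2r// invr_ge0 ltW.
Qed.

Lemma Ffun_ge0 (a1 a2 a3 t1 t2 t3 : R) : 0 <= Ffun sg a1 a2 a3 t1 t2 t3.
Proof.
have -> : 0 = Ffun sg 0 0 a3 t1 t2 t3.
  by rewrite /Ffun expr0n /= !mulr0 addr0 mul0r addr0 /log2 ln1 mul0r mulr0.
by apply: Ffun_le; rewrite expr0n /= !mulr0 addr0 lexx addr_ge0// mulr_ge0 ?rho_ge0 ?sqr_ge0.
Qed.

Definition inter (kap : 'I_2 -> R) i : R := h i i * kap i + h (oth i) i * kap (oth i).

(** For each receiver, the conditions of the four tests: private codeword, own common one, other
    common one, both common ones. *)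
Definition good_rates (kap eta th ph c pr : 'I_2 -> R) : Prop := forall i,
  [/\ pr i <= Ffun sg 0 (h i i * kap i) (h (oth i) i * kap (oth i)) 1 (th i) (th (oth i)),
      c i <= Ffun sg 0 (h i i * eta i) (inter kap i) 1 (ph i) (theta' h kap th i),
      c (oth i) <= Ffun sg 0 (h (oth i) i * eta (oth i)) (inter kap i) 1 (ph (oth i)) (theta' h kap th i) &
      c i + c (oth i) <= Ffun sg (h i i * eta i) (h (oth i) i * eta (oth i)) (inter kap i)
        (ph i) (ph (oth i)) (theta' h kap th i)].

Lemma sub_add_le (r1 r2 x1 x2 y : R) : r1 + r2 <= x1 + x2 + y -> r1 - x1 + (r2 - x2) <= y.
Proof. lra. Qed.

Lemma max_add_le (x1 x2 y : R) : Num.max 0 x1 <= y -> Num.max 0 x2 <= y -> x1 + x2 <= y ->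
  Num.max 0 x1 + Num.max 0 x2 <= y.
Proof.
by move=> h1 h2 h3; move: h1 h2; rewrite /Num.max; case: ifP => _; case: ifP => _; lra.
Qed.

(* The private rate absorbs as much as it can; only the excess over the private bound is common. *)
Lemma split_rates (kap eta th ph : 'I_2 -> R) (r : R * R) : RHK' sg h kap eta th ph r ->
  exists c pr : 'I_2 -> R, [/\ forall i, 0 <= c i, forall i, 0 <= pr i,
    forall i, rate r i = c i + pr i & good_rates kap eta th ph c pr].
Proof.
move=> [r10 [r20 [hr hs]]].
have min1 (x y : R) : Num.min x y <= x by rewrite ge_min lexx.
have min2 (x y : R) : Num.min x y <= y by rewrite ge_min lexx orbT.
have r0 i : 0 <= rate r i by case: (ord2P i) => ->.
pose a i := Ffun sg 0 (h i i * kap i) (h (oth i) i * kap (oth i)) 1 (th i) (th (oth i)).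
have a0 i : 0 <= a i by exact: Ffun_ge0.
pose c i := Num.max 0 (rate r i - a i); pose pr i := rate r i - c i.
have c0 i : 0 <= c i by rewrite le_max lexx.
have cr i : c i <= rate r i by rewrite ge_max r0 gerBl a0.
have ca i : rate r i - a i <= c i by rewrite le_max lexx orbT.
pose X i k := Ffun sg 0 (h i k * eta i) (h i k * kap i + h (oth i) k * kap (oth i)) 1 (ph i) (theta' h kap th k).
have cX i k : c i <= X i k.
  rewrite ge_max Ffun_ge0 /= lerBlDl.
  have := hr i (oth i) (oth_neq i); rewrite -/(a i) => /le_trans; apply.
  by rewrite lerD2l; case: (ord2P k) => ->; [exact: min1|exact: min2].
have XE i : X (oth i) i = Ffun sg 0 (h (oth i) i * eta (oth i)) (inter kap i) 1 (ph (oth i)) (theta' h kap th i).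
  by rewrite /X othK /inter addrC.
pose Y i := Ffun sg (h i i * eta i) (h (oth i) i * eta (oth i)) (inter kap i)
        (ph i) (ph (oth i)) (theta' h kap th i).
have XY1 i : X i i <= Y i.
  apply: Ffun_le; rewrite expr0n /= mulr0 add0r mulr_ge0 ?rho_ge0 ?sqr_ge0//= lerDl.
  by rewrite mulr_ge0 ?rho_ge0 ?sqr_ge0.
have XY2 i : X (oth i) i <= Y i.
  rewrite XE; apply: Ffun_le; rewrite expr0n /= mulr0 add0r mulr_ge0 ?rho_ge0 ?sqr_ge0//= lerDr.
  by rewrite mulr_ge0 ?rho_ge0 ?sqr_ge0.
have sumY i : rate r ord0 - a ord0 + (rate r ord_max - a ord_max) <= Y i.
  move: hs; rewrite big_ord_recl big_ord1 (_ : lift ord0 ord0 = ord_max :> 'I_2); last exact: val_inj.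
  rewrite -/(a ord0) -/(a ord_max) => hs.
  have : r.1 + r.2 <= a ord0 + a ord_max + Y i.
    apply: (le_trans hs); rewrite lerD2l; by case: (ord2P i) => ->; [exact: min1|exact: min2].
  exact: sub_add_le.
exists c, pr; split => //.
- by move=> i; rewrite subr_ge0.
- by move=> i; rewrite /pr addrC subrK.
move=> i; split.
- by rewrite /pr lerBlDr addrC -lerBlDr; exact: ca.
- exact: cX.
- by rewrite -XE; exact: cX.
(* A sum of positive parts is zero, one excess or the sum of both. A single excess is covered
   because removing a signal from the numerator of F lowers it. *)
apply: max_add_le; [exact: le_trans (cX i i) (XY1 i)|exact: le_trans (cX (oth i) i) (XY2 i)|].
apply: le_trans (sumY i).
have o0 : oth ord0 = ord_max by [].
have o1 : oth ord_max = ord0 by [].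
pose F j := rate r j - a j.
rewrite -/(F i) -/(F (oth i)) -/(F ord0) -/(F ord_max); move: F => F.
by case: (ord2P i) => ->; [rewrite o0|rewrite o1 [leLHS]addrC].
Qed.

Lemma theta'_ge0 (kap th : 'I_2 -> R) i : (forall j, 0 <= kap j) -> (forall j, 0 <= th j) ->
  0 <= theta' h kap th i.
Proof.
move=> k0 t0; rewrite /theta'; case: ifP => [s0|_//].
by rewrite divr_ge0 ?(ltW s0)// addr_ge0// !mulr_ge0.
Qed.

(** [theta'] is the relative mean of the combined private signals at receiver i. If their total
    amplitude vanishes then both terms do, so the convention [theta'] = 0 is consistent. *)
Lemma theta'_mul (kap th : 'I_2 -> R) i : (forall j, 0 <= kap j) ->
  th i * (h i i * kap i) + th (oth i) * (h (oth i) i * kap (oth i)) =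
  theta' h kap th i * inter kap i.
Proof.
move=> k0; rewrite /theta' -/(inter kap i).
have x0 j : 0 <= h j i * kap j by rewrite mulr_ge0.
have := x0 i; have := x0 (oth i).
case: ltP => [s0|s0] y1 y2; first by rewrite divfK ?gt_eqF//; ring.
have -> : h i i * kap i = 0 by rewrite /inter in s0; lra.
have -> : h (oth i) i * kap (oth i) = 0 by rewrite /inter in s0; lra.
by rewrite !mulr0 add0r mul0r.
Qed.

End Rates.

(** * Counting messages *)

Section MessageCount.
Variable R : realType.
Implicit Types (n k : nat) (r : R).

Lemma pow2E (y : R) : 2 `^ y = expR (y * ln 2).
Proof. by rewrite /powR pnatr_eq0. Qed.

Lemma nmsgE n r : (nmsg n r)%:R = (Num.ceil (2 `^ (n%:R * r)))%:~R :> R.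
Proof.
by rewrite /nmsg natr_absz ger0_norm// ltW// ceil_gt0 powR_gt0.
Qed.

Lemma nmsg_gt0 n r : (0 < nmsg n r)%N.
Proof.
rewrite -(ltr0n R) nmsgE ltr0z ceil_gt0; exact: powR_gt0.
Qed.

(** The union bounds run over the wrong messages, one less than all of them, so the rounding up
    costs nothing; this holds for negative r too. *)
Lemma nmsg_pred n r : (nmsg n r).-1%:R <= expR (n%:R * r * ln 2).
Proof.
have := ceilB1_lt (2 `^ (n%:R * r)); rewrite -pow2E intrD -nmsgE => /ltW.
by rewrite -[in X in X -> _](prednK (nmsg_gt0 n r)) -natr1 addrK.
Qed.

Lemma nmsg_ge n r : expR (n%:R * r * ln 2) <= (nmsg n r)%:R.
Proof. by rewrite -pow2E nmsgE; exact: ceil_ge. Qed.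

Lemma nmsg_le n r k : expR (n%:R * r * ln 2) <= k%:R -> (nmsg n r <= k)%N.
Proof.
rewrite -pow2E => hk; rewrite -(ler_nat R) nmsgE -[k%:R]/((k%:Z)%:~R) ler_int.
by rewrite ceil_le_int.
Qed.

(** Hence the messages inject into pairs of a common and a private index, although the rounded
    counts do not multiply exactly. *)
Lemma nmsg_mul n r s : (nmsg n (r + s) <= nmsg n r * nmsg n s)%N.
Proof.
apply: nmsg_le; rewrite mulrDr mulrDl expRD natrM.
by rewrite ler_pM ?expR_ge0// nmsg_ge.
Qed.

Lemma split_messages (M C Q : nat) : (M <= C * Q)%N ->
  exists s : 'I_M -> 'I_C * 'I_Q, injective s.
Proof.
move=> le; have le' : (M <= #|{: 'I_C * 'I_Q}|)%N by rewrite card_prod !card_ord.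
exists (fun m => enum_val (widen_ord le' m)) => m m' /enum_val_inj e.
by apply/val_inj; have := congr1 val e.
Qed.

Lemma gauss_expect_ge0 (sg : R) n (f : n.-tuple R -> \bar R) : (forall z, (0 <= f z)%E) ->
  (0 <= gauss_expect sg f)%E.
Proof.
elim: n f => [|n ih] f f0 /=; first exact: f0.
by apply: integral_ge0 => z _; exact: ih.
Qed.

End MessageCount.

(** * The time-shared coding scheme *)

Section Scheme.
Variables (R : realType) (sg A : R) (alpha : 'I_2 -> R) (h : 'I_2 -> 'I_2 -> R).
Hypotheses (sg0 : 0 < sg) (A0 : 0 < A) (al0 : forall i, 0 < alpha i)
  (h0 : forall k l, 0 <= h k l).
Variables (m : nat) (w : 'I_m -> R).
Hypotheses (w0 : forall k, 0 <= w k) (w1 : \sum_k w k = 1).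
Notation T := (option 'I_m).
Variables kap eta th ph c pr : T -> 'I_2 -> R.
Hypotheses (kap0 : forall t i, 0 <= kap t i) (eta0 : forall t i, 0 <= eta t i)
  (th0 : forall t i, 0 <= th t i) (ph0 : forall t i, 0 <= ph t i)
  (peak : forall t i, kap t i + eta t i <= A)
  (meanS : forall k i, th (Some k) i * kap (Some k) i + ph (Some k) i * eta (Some k) i <= alpha i * A)
  (meanN : forall i, th None i * kap None i + ph None i * eta None i <= 0)
  (c0 : forall t i, 0 <= c t i) (pr0 : forall t i, 0 <= pr t i)
  (cN : forall i, c None i = 0) (prN : forall i, pr None i = 0)
  (good : forall t, good_rates sg h (kap t) (eta t) (th t) (ph t) (c t) (pr t)).

Definition letter N t i (a b : 'I_N) : R :=
  signal (ph t i) (eta t i) (pt R a) + signal (th t i) (kap t i) (pt R b).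

Definition letter_channel N K t i (a b a' b' : 'I_N) : option 'I_(2 * K ^ 3) -> R :=
  cell (@quant R K) sg (h i i * letter t i a b + h (oth i) i * letter t (oth i) a' b').

Lemma letter_channelE N K t i : @letter_channel N K t i =
  @lp R sg (h i i) (h (oth i) i) (kap t i) (eta t i) (th t i) (ph t i)
    (kap t (oth i)) (eta t (oth i)) (th t (oth i)) (ph t (oth i)) N K.
Proof.
apply/funext => a; apply/funext => b; apply/funext => a'; apply/funext => b'; apply/funext => o.
have e : h i i * letter t i a b + h (oth i) i * letter t (oth i) a' b' =
    centre (h i i) (h (oth i) i) (kap t i) (eta t i) (th t i) (ph t i)
      (kap t (oth i)) (eta t (oth i)) (th t (oth i)) (ph t (oth i)) a b a' b'.
  by rewrite /letter /centre /cms /pvs /cmo /pvo !signalZ; ring.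
by rewrite /letter_channel e /lp.
Qed.

Lemma letter_bnd N t i (a b : 'I_N) : 0 <= letter t i a b <= A.
Proof.
have /andP[h1 h2] := signal_bnd (ph t i) (eta0 t i) (pt01 R a).
have /andP[h3 h4] := signal_bnd (th t i) (kap0 t i) (pt01 R b).
have := peak t i; rewrite /letter => h5; apply/andP; split; lra.
Qed.

Lemma letter_avg N t i : (0 < N)%N ->
  avg (fun a : 'I_N => avg (fun b => letter t i a b)) <= if t is Some _ then alpha i * A else 0.
Proof.
move=> N0; have cL : (0 < #|'I_N|)%N by rewrite card_ord.
apply: (@le_trans _ _ (th t i * kap t i + ph t i * eta t i)).
  rewrite /letter; under eq_avg do rewrite avgD avg_cst//.
  by rewrite avgD avg_cst// addrC lerD// signal_avg.
by case: t => [k|]; [exact: meanS|exact: meanN].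
Qed.

Definition info_bound N K (d : R) t i : Prop :=
  let p := @letter_channel N K t i in
  [/\ ln 2 * pr t i - d <= E4 (fun a b a' b' => \sum_o p a b a' b' o * ln (W2 p a b a' o / W1 p a a' o)),
      ln 2 * c t i - d <= E4 (fun a b a' b' => \sum_o p a b a' b' o * ln (W1 p a a' o / Wa p a' o)),
      ln 2 * c t (oth i) - d <= E4 (fun a b a' b' => \sum_o p a b a' b' o * ln (W1 p a a' o / Wb p a o)) &
      ln 2 * (c t i + c t (oth i)) - d <=
        E4 (fun a b a' b' => \sum_o p a b a' b' o * ln (W1 p a a' o / W0 p o))].

Lemma ln2_gt0 : 0 < ln 2 :> R.
Proof. by rewrite ln_gt0// ltr1n. Qed.

Lemma info_step (f g y e d x : R) : f <= g -> x * g - e <= y -> 0 <= x -> e <= d -> x * f - d <= y.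
Proof. by move=> fg h1 x1 ed; have := ler_wpM2l x1 fg; lra. Qed.

Lemma info_one t i : exists2 C : R, 0 <= C & forall N K d, (0 < N)%N -> (0 < K)%N ->
  C / N%:R + C / K%:R <= d -> info_bound N K d t i.
Proof.
have hE : th t i * (h i i * kap t i) + th t (oth i) * (h (oth i) i * kap t (oth i)) <=
    theta' h (kap t) (th t) i * (h i i * kap t i + h (oth i) i * kap t (oth i)).
  by rewrite theta'_mul.
have [C C0 hC] := letter_info sg0 (ph t i) (ph t (oth i)) (h0 i i) (h0 (oth i) i) (kap0 t i) (eta0 t i)
  (kap0 t (oth i)) (eta0 t (oth i)) (th0 t i) (th0 t (oth i))
  (theta'_ge0 h0 i (kap0 t) (th0 t)) hE.
exists C => // N K d N0 K0 hd; have l2 := ltW ln2_gt0.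
have [g3 ga gb g0] := good t i.
have [i3' ia' ib' i0'] := hC N K N0 K0.
rewrite /info_bound letter_channelE; split.
- exact: info_step g3 i3' l2 hd.
- exact: info_step ga ia' l2 hd.
- exact: info_step gb ib' l2 hd.
- exact: info_step g0 i0' l2 hd.
Qed.

Lemma info_all (d : R) : 0 < d -> exists2 N : nat, (0 < N)%N & forall t i, info_bound N N d t i.
Proof.
move=> d0.
have ex (z : T * 'I_2) : exists C : R, 0 <= C /\
    forall N K d, (0 < N)%N -> (0 < K)%N -> C / N%:R + C / K%:R <= d -> info_bound N K d z.1 z.2.
  by have [C C0 hC] := info_one z.1 z.2; exists C.
have [C hC] := choice ex.
pose S := \sum_z C z.
have CS z : C z <= S.
  by rewrite /S (bigD1 z)//= lerDl sumr_ge0// => z' _; have [] := hC z'.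
(* Quantiles and quantizer get the same resolution N, whence the factor 2; S dominates the constants
   of the finitely many letters and of both users. *)
pose N := (Num.truncn (2 * S / d)).+1.
have N0 : 0 < N%:R :> R by rewrite ltr0n.
have SN : 2 * S / N%:R <= d.
  by rewrite ler_pdivrMr// [d * _]mulrC -ler_pdivrMr// ltW// truncnS_gt.
exists N => // t i; have [_ H] := hC (t, i); apply: (H N N d) => //.
apply: le_trans SN; rewrite -mulrDl ler_pM2r ?invr_gt0//.
by have := CS (t, i); lra.
Qed.


Lemma rate_margin (n l e f s S y et D d x : R) : n * ((1 - e) * f) - s <= S -> 0 <= n -> 0 <= l ->
  l * s <= D -> y <= et -> 2 * et + d <= l * e / 4 -> x = l * S - n * d ->
  n * y + (n * et - D) <= x - n * (l * ((1 - e) * f - e / 4)).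
Proof.
move=> h1 n1 l1 h2 h3 h4 ->.
have := ler_wpM2l l1 h1; have := ler_wpM2l n1 h3; have := ler_wpM2l n1 h4; lra.
Qed.

Lemma ratio_le (r g x : R) (n : nat) : n%:R * r * ln 2 - g <= x ->
  (nmsg n r).-1%:R / expR g <= expR x.
Proof.
move=> le; rewrite ler_pdivrMr ?expR_gt0// -expRD; apply: (le_trans (nmsg_pred _ _)).
rewrite ler_expR; lra.
Qed.

Lemma ratio2_le (r s g x : R) (n : nat) : n%:R * r * ln 2 + n%:R * s * ln 2 - g <= x ->
  (nmsg n r).-1%:R * (nmsg n s).-1%:R / expR g <= expR x.
Proof.
move=> le; rewrite ler_pdivrMr ?expR_gt0// -expRD.
apply: (@le_trans _ _ (expR (n%:R * r * ln 2) * expR (n%:R * s * ln 2))).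
  by apply: ler_pM => //; exact: nmsg_pred.
rewrite -expRD ler_expR; lra.
Qed.

Section Coding.
Variables (N : nat) (e B lam et D : R).
Hypotheses (N0 : (0 < N)%N) (e0 : 0 < e) (lam0 : 0 <= lam) (lamB : lam * B <= 2^-1)
  (lamE : 2 * lam * B ^+ 2 <= et) (D0 : 0 <= D).
Let del := ln 2 * e / 8.
Hypothesis etE : 2 * et + del <= ln 2 * e / 4.
Hypothesis infoN : forall t i, info_bound N N del t i.
Notation L := 'I_N.
Notation lc := (@letter_channel N N).
Hypothesis infoB : forall t i (a b a' b' : L) o,
  [/\ `|ln (W2 (lc t i) a b a' o / W1 (lc t i) a a' o)| <= B,
      `|ln (W1 (lc t i) a a' o / Wa (lc t i) a' o)| <= B,
      `|ln (W1 (lc t i) a a' o / Wb (lc t i) a o)| <= B &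
      `|ln (W1 (lc t i) a a' o / W0 (lc t i) o)| <= B].

Definition mean (F : T -> R) : R := \sum_k w k * F (Some k).
(** Placed e/4 below the time-shared information and at least e/4 above the rates. The upper gap
    absorbs the information loss [del] and the Chernoff deviation, the lower one makes the union
    bound decay exponentially. *)
Definition threshold n (F : T -> R) : R := n%:R * (ln 2 * ((1 - e) * mean F - e / 4)).
(** May be negative, in which case there is a single message and [nmsg_pred] still applies. *)
Definition crate i : R := (1 - e) * mean (c^~ i) - e / 2.
Definition prate i : R := (1 - e) * mean (pr^~ i) - e / 2.

Hypothesis DE : forall i, ln 2 * \sum_k (c (Some k) i + c (Some k) (oth i) + pr (Some k) i) <= D.

Lemma meanD F G : mean (fun t => F t + G t) = mean F + mean G.
Proof. by rewrite /mean -big_split; apply: eq_bigr => k _; rewrite mulrDr. Qed.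

Section Length.
Variables (n : nat) (tau : 'I_n -> T).
Hypothesis tauP : forall F : T -> R, F None = 0 -> (forall k, 0 <= F (Some k)) ->
  n%:R * ((1 - e) * mean F) - \sum_k F (Some k) <= \sum_t F (tau t) <= n%:R * ((1 - e) * mean F).

(** D pays for the rounding of the letter counts to integers, a loss that does not grow with n. *)
Lemma tau_margin F : F None = 0 -> (forall k, 0 <= F (Some k)) ->
  ln 2 * \sum_k F (Some k) <= D ->
  n%:R * (2 * lam * B ^+ 2) + (n%:R * et - D) <= \sum_t (ln 2 * F (tau t) - del) - threshold n F.
Proof.
move=> FN F0 FD; have /andP[lb _] := tauP FN F0.
have L2 := ln2_gt0; have E := etE; have LE := lamE.
apply: (rate_margin lb (ler0n _ n) (ltW L2) FD LE E).
by rewrite big_split /= -mulr_sumr sumr_const card_ord mulNrn mulr_natl.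
Qed.

Lemma receiver_error i (c1 : 'I_(nmsg n (crate i))) (p1 : 'I_(nmsg n (prate i)))
    (c2 : 'I_(nmsg n (crate (oth i)))) (p2 : 'I_(nmsg n (prate (oth i)))) :
  EE (Perr (block (fun t => lc (tau t) i)) (expR (threshold n (pr^~ i))) (expR (threshold n (c^~ i)))
     (expR (threshold n (c^~ (oth i)))) (expR (threshold n (fun t => c t i + c t (oth i)))) c1 p1 c2 p2)
  <= 4 * expR (- (lam * (n%:R * et - D))) + 4 * expR (- (n%:R * (ln 2 * e / 4))).
Proof.
have cL : (0 < #|L|)%N by rewrite card_ord.
pose p (t : 'I_n) := lc (tau t) i.
have pp t a b a' b' o : 0 < p t a b a' b' o by exact: quant_cell_gt0.
have ps t a b a' b' : \sum_o p t a b a' b' o = 1 by exact: (cell_sum sg0 (quant_meas N0)).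
have X1 := X0 n cL.
have bs u v u' v' : \sum_y block p u v u' v' y = 1 by exact: block_sum.
have bg u v u' v' y : 0 <= block p u v u' v' y by exact: block_ge0.
have eg x : 0 < expR x :> R by exact: expR_gt0.
apply: (le_trans (random_coding X1 X1 bg bs (eg _) (eg _) (eg _) (eg _) c1 p1 c2 p2)).
apply: lerD.
  have L2 := ltW ln2_gt0.
  have ssum (F : 'I_m -> R) G : (forall k, F k <= G k) -> ln 2 * \sum_k G k <= D -> ln 2 * \sum_k F k <= D.
    by move=> FG; apply: le_trans; rewrite ler_wpM2l// ler_sum.
  have q1 k := c0 (Some k) i; have q2 k := c0 (Some k) (oth i); have q3 k := pr0 (Some k) i.
  apply: (Pfail_le cL pp ps lam0 lamB (I3 := fun t => ln 2 * pr (tau t) i - del)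
    (Ia := fun t => ln 2 * c (tau t) i - del) (Ib := fun t => ln 2 * c (tau t) (oth i) - del)
    (I0 := fun t => ln 2 * (c (tau t) i + c (tau t) (oth i)) - del)).
  - by move=> t a b a' b' o; exact: infoB.
  - by move=> t; exact: infoN.
  - apply: (@tau_margin (pr^~ i)) => //; apply: ssum (DE i) => k.
    by have := q1 k; have := q2 k; lra.
  - apply: (@tau_margin (c^~ i)) => //; apply: ssum (DE i) => k.
    by have := q3 k; have := q2 k; lra.
  - apply: (@tau_margin (c^~ (oth i))) => //; apply: ssum (DE i) => k.
    by have := q1 k; have := q3 k; lra.
  - apply: (@tau_margin (fun t => c t i + c t (oth i))) => //.
    + by rewrite !cN addr0.
    + by move=> k; rewrite addr_ge0.
    + by apply: ssum (DE i) => k; have := q3 k; lra.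
rewrite !card_ord.
have x0 : 0 <= n%:R * (ln 2 * e) by rewrite mulr_ge0// mulr_ge0 ?(ltW ln2_gt0)// ltW.
set z := - _.
have r1 (r : R) F : r = (1 - e) * mean F - e / 2 -> n%:R * r * ln 2 - threshold n F <= z.
  by move=> ->; rewrite /threshold /z; lra.
have -> : 4 * expR z = expR z + expR z + expR z + expR z by ring.
rewrite !lerD ?ratio_le ?ratio2_le ?r1//.
by rewrite /threshold meanD /crate /z; lra.
Qed.

(** Idle positions cost nothing, so the mean total cost lies n e alpha A below the limit, enough
    room for the Chernoff bound. *)
Lemma cost_error i :
  B >= A -> 2 * et <= e * (alpha i * A) ->
  avg (fun u : {ffun 'I_n -> L} => avg (fun v : {ffun 'I_n -> L} =>
    (~~ okw A alpha (fun j t => @letter N (tau t) j) i u v)%:R)) <= expR (- (lam * (n%:R * et - D))).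
Proof.
move=> BA etA; have cL : (0 < #|L|)%N by rewrite card_ord.
pose p (t : 'I_n) := lc (tau t) i.
have pp t a b a' b' o : 0 < p t a b a' b' o by exact: quant_cell_gt0.
have ps t a b a' b' : \sum_o p t a b a' b' o = 1 by exact: (cell_sum sg0 (quant_meas N0)).
pose F (t : T) := if t is Some _ then alpha i * A else 0.
have aA : 0 <= alpha i * A by rewrite mulr_ge0// ltW.
have xB t a b : `|@letter N (tau t) i a b| <= B.
  by have /andP[h1 h2] := letter_bnd (tau t) i a b; rewrite ger0_norm// (le_trans h2).
have mF : mean F = alpha i * A by rewrite /mean -mulr_suml w1 mul1r.
have /andP[_ hF] := @tauP F erefl (fun k => aA).
rewrite /okw; under eq_avg do under eq_avg do rewrite -leNgt.
apply: (cost_le cL pp ps lam0 lamB xB (m := fun t => F (tau t))).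
  by move=> t; exact: letter_avg.
rewrite mF in hF; have LE := lamE; have D0' := D0; have n0 : 0 <= n%:R :> R by [].
have := ler_wpM2l n0 LE; have := ler_wpM2l n0 etA; lra.
Qed.

End Length.
End Coding.

Lemma exp_decay (x y : R) : 0 < x -> (fun n : nat => expR (y - n%:R * x)) @ \oo --> (0 : R).
Proof.
move=> x0; rewrite -(mulr0 (expR y)).
rewrite (_ : (fun n => _) = fun n : nat => expR y * expR (- x) ^+ n); last first.
  by apply/funext => n; rewrite -expRM_natl -expRD mulrN.
by apply: cvgMr; apply: cvg_expr; rewrite ger0_norm ?expR_ge0// expR_lt1 oppr_lt0.
Qed.

Lemma small_params (e : R) (B D : R) : 0 < e -> 0 <= B -> exists et lam : R,
  [/\ 0 < et, 0 < lam, 2 * et + ln 2 * e / 8 <= ln 2 * e / 4,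
    forall i, 2 * et <= e * (alpha i * A) & lam * B <= 2^-1 /\ 2 * lam * B ^+ 2 <= et].
Proof.
move=> e0 B0; have L2 := ln2_gt0.
have a0 i : 0 < e * (alpha i * A) / 2 by rewrite divr_gt0// mulr_gt0// mulr_gt0.
have l0 : 0 < ln 2 * e / 16 by rewrite divr_gt0// mulr_gt0.
pose et := Num.min (ln 2 * e / 16) (Num.min (e * (alpha ord0 * A) / 2) (e * (alpha ord_max * A) / 2)).
have et0 : 0 < et by rewrite !lt_min l0 !a0.
(* [lam] is the inverse of a sum of two terms, and each of the two conditions on it needs only one
   of them. *)
pose S := 2 * (B + 1) + 2 * (B + 1) ^+ 2 / et.
have B1 : 0 < B + 1 by rewrite ltr_wpDl.
have u0 : 0 < 2 * (B + 1) by rewrite mulr_gt0.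
have v0 : 0 < 2 * (B + 1) ^+ 2 / et by rewrite divr_gt0// mulr_gt0// exprn_gt0.
have S0 : 0 < S by rewrite addr_gt0.
exists et, S^-1; split => //.
- by rewrite invr_gt0.
- have : et <= ln 2 * e / 16 by rewrite ge_min lexx.
  by lra.
- move=> i; have : et <= e * (alpha i * A) / 2.
    by case: (ord2P i) => ->; rewrite !ge_min lexx ?orbT.
  by lra.
split.
  rewrite mulrC ler_pdivrMr// /S; lra.
rewrite mulrAC ler_pdivrMr// /S.
apply: (@le_trans _ _ (2 * (B + 1) ^+ 2)).
  by rewrite ler_pM2l// lerXn2r ?nnegrE ?(ltW B1)// lerDl.
by rewrite mulrDr [et * (_ / _)]mulrC divfK ?gt_eqF// lerDr; apply: mulr_ge0; exact: ltW.
Qed.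

Lemma scheme_achievable (e : R) : 0 < e -> e < 1 ->
  achievable A sg alpha h (crate e ord0 + prate e ord0, crate e ord_max + prate e ord_max).
Proof.
move=> e0 e1; have L2 := ln2_gt0.
have del0 : 0 < ln 2 * e / 8 by rewrite divr_gt0// mulr_gt0.
have [N N0 infoN] := info_all del0.
pose lc := @letter_channel N N.
pose f3 t i (a b a' b' : 'I_N) o := `|ln (W2 (lc t i) a b a' o / W1 (lc t i) a a' o)|.
pose fa t i (a b a' b' : 'I_N) o := `|ln (W1 (lc t i) a a' o / Wa (lc t i) a' o)|.
pose fb t i (a b a' b' : 'I_N) o := `|ln (W1 (lc t i) a a' o / Wb (lc t i) a o)|.
pose f0 t i (a b a' b' : 'I_N) o := `|ln (W1 (lc t i) a a' o / W0 (lc t i) o)|.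
have [B0 B00 hB0] := fin_bounded (fun z : T * 'I_2 * ('I_N * 'I_N) * ('I_N * 'I_N) * option 'I_(2 * N ^ 3) =>
  let: (t, i, (a, b), (a', b'), o) := z in
  f3 t i a b a' b' o + fa t i a b a' b' o + fb t i a b a' b' o + f0 t i a b a' b' o).
(* A common bound for log-likelihood ratios and letters, so that one [lam] serves the decoding and
   the cost estimates. *)
pose B := B0 + A.
have B1 : 0 <= B by rewrite addr_ge0// ltW.
have infoB t i a b a' b' o :
    [/\ f3 t i a b a' b' o <= B, fa t i a b a' b' o <= B, fb t i a b a' b' o <= B & f0 t i a b a' b' o <= B].
  have := hB0 (t, i, (a, b), (a', b'), o).
  have : 0 <= f3 t i a b a' b' o by exact: normr_ge0.
  have : 0 <= fa t i a b a' b' o by exact: normr_ge0.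
  have : 0 <= fb t i a b a' b' o by exact: normr_ge0.
  have : 0 <= f0 t i a b a' b' o by exact: normr_ge0.
  move: (f3 _ _ _ _ _ _ _) (fa _ _ _ _ _ _ _) (fb _ _ _ _ _ _ _) (f0 _ _ _ _ _ _ _) => x1 x2 x3 x4.
  move=> y4 y3 y2 y1; rewrite ger0_norm ?addr_ge0// => le; have A0' := A0.
  by rewrite /B; split; lra.
pose D := ln 2 * \sum_i \sum_k (c (Some k) i + c (Some k) (oth i) + pr (Some k) i).
have s0 i : 0 <= \sum_k (c (Some k) i + c (Some k) (oth i) + pr (Some k) i).
  by apply: sumr_ge0 => k _; rewrite !addr_ge0.
have D0 : 0 <= D by rewrite mulr_ge0 ?(ltW L2)// sumr_ge0.
have DE i : ln 2 * \sum_k (c (Some k) i + c (Some k) (oth i) + pr (Some k) i) <= D.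
  by rewrite ler_pM2l// (bigD1 i)//= lerDl sumr_ge0.
have [et [lam [et0 lam0 etE etA [lamB lamE]]]] := small_params D e0 B1.
pose E1 (n : nat) := expR (- (lam * (n%:R * et - D))).
pose E2 (n : nat) := expR (- (n%:R * (ln 2 * e / 4))).
pose b n := 4 * E1 n + 4 * E2 n.
pose beta n := b n + b n + 2 * (E1 n + E1 n).
have codes n : exists K : Defs.code R n (nmsg n (crate e ord0 + prate e ord0))
    (nmsg n (crate e ord_max + prate e ord_max)),
    [/\ code_ok A alpha K, (Perr1 sg h K <= (beta n)%:E)%E & (Perr2 sg h K <= (beta n)%:E)%E].
  have [tau tauP] := type_sequence n w0 w1 (ltW e0) (ltW e1).
  pose spl i := projT1 (cid (split_messages (nmsg_mul n (crate e i) (prate e i)))).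
  have spl_inj i : injective (spl i) by rewrite /spl; case: cid.
  have cL : (0 < #|'I_N|)%N by rewrite card_ord.
  apply: (code_exists sg0 (ltW A0) (fun i => ltW (al0 i)) (quant_meas N0) (quant_cell_gt0 N0 sg0) cL
    (xl := fun i t => @letter N (tau t) i) (fun i t => letter_bnd (tau t) i)
    (M := fun i => nmsg n (crate e i + prate e i)) spl_inj
    (fun i => Ordinal (nmsg_gt0 n (crate e i + prate e i)))
    (g3 := fun i => threshold e n (pr^~ i)) (ga := fun i => threshold e n (c^~ i))
    (gb := fun i => threshold e n (c^~ (oth i)))
    (g0 := fun i => threshold e n (fun t => c t i + c t (oth i)))
    (b := fun=> b n) (d := fun=> E1 n)).
    move=> i c1 p1 c2 p2.
    exact: (receiver_error N0 e0 (ltW lam0) lamB lamE etE infoN infoB DE tauP).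
  move=> i; apply: (cost_error N0 (ltW lam0) lamB lamE D0 tauP _ (etA i)).
  by rewrite /B lerDr.
pose K n := projT1 (cid (codes n)).
have KP n : [/\ code_ok A alpha (K n), (Perr1 sg h (K n) <= (beta n)%:E)%E &
    (Perr2 sg h (K n) <= (beta n)%:E)%E] by rewrite /K; case: cid.
have beta0 : (fun n => (beta n)%:E) @ \oo --> 0%E.
  apply: cvg_EFin; first exact: nearW.
  have c1 : E1 @ \oo --> (0 : R).
    rewrite (_ : E1 = fun n => expR (lam * D - n%:R * (lam * et))).
      by apply: exp_decay; rewrite mulr_gt0.
    by apply/funext => n; rewrite /E1; congr expR; ring.
  have c2 : E2 @ \oo --> (0 : R).
    rewrite (_ : E2 = fun n => expR (0 - n%:R * (ln 2 * e / 4))).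
      by apply: exp_decay; rewrite divr_gt0// mulr_gt0.
    by apply/funext => n; rewrite /E2 sub0r.
  rewrite (_ : _ \o _ = fun n => 12 * E1 n + 8 * E2 n); last first.
    by apply/funext => n /=; rewrite /beta /b; ring.
  rewrite (_ : 0 = 12 * 0 + 8 * 0 :> R); last by rewrite !mulr0 addr0.
  by apply: cvgD; apply: cvgMr.
have cvg0 (F : nat -> \bar R) : (forall n, (0 <= F n <= (beta n)%:E)%E) -> F @ \oo --> 0%E.
  by move=> hF; apply: (squeeze_cvge _ (cvg_cst 0%E) beta0); exact: nearW.
exists K; split; first by move=> n; have [] := KP n.
split; apply: cvg0 => n; have [_ k1 k2] := KP n.
  rewrite k1 andbT mule_ge0//; do 2!(apply: sume_ge0 => ? _).
  by apply: gauss_expect_ge0 => z; rewrite lee_fin.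
rewrite k2 andbT mule_ge0//; do 2!(apply: sume_ge0 => ? _).
by apply: gauss_expect_ge0 => z; rewrite lee_fin.
Qed.

End Scheme.

Lemma cvg_backoff (R : realType) (x : R) : (1 - e) * x - e @[e --> 0^'+] --> x.
Proof.
apply: cvg_at_right_filter; rewrite -[X in _ --> X]subr0 -[X in X - _]mul1r -[X in X * _]subr0.
apply: cvgB; last exact: cvg_id.
by apply: cvgMl; apply: cvgB; [exact: cvg_cst|exact: cvg_id].
Qed.

Theorem theorem2 (R : realType) (A sigma : R) (alpha : 'I_2 -> R)
  (h : 'I_2 -> 'I_2 -> R) :
  0 < A -> 0 < sigma ->
  (forall i, 0 < alpha i <= 1) ->
  (forall k l, 0 <= h k l) ->
  GHK' A sigma alpha h `<=` capacity_region A sigma alpha h.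
Proof.
move=> A0 sg0 al01 h0 p [m [w [q [w0 [w1 [hq pE]]]]]].
have al0 i : 0 < alpha i by have /andP[] := al01 i.
pose good k (s : ('I_2 -> R) * ('I_2 -> R) * ('I_2 -> R) * ('I_2 -> R) * ('I_2 -> R) * ('I_2 -> R)) :=
  let: (kap, eta, th, ph, c, pr) := s in
  [/\ forall i, [/\ 0 <= kap i, 0 <= eta i, 0 <= th i & 0 <= ph i],
      forall i, kap i + eta i <= A /\ th i * kap i + ph i * eta i <= alpha i * A,
      forall i, 0 <= c i /\ 0 <= pr i,
      forall i, rate (q k) i = c i + pr i & good_rates sigma h kap eta th ph c pr].
have ex k : exists s, good k s.
  have [[[[kap eta] th] ph] /= hx hr] := hq k.
  have [c [pr [c0 pr0 rE gr]]] := split_rates sg0 hr.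
  exists (kap, eta, th, ph, c, pr); split => // i.
    by have [/andP[/ltW ? _] [/andP[/ltW ? _] [/andP[? _] [/andP[? _] _]]]] := hx i.
  by have [_ [_ [_ [_ []]]]] := hx i.
have [s hs] := choice ex.
(* The idle letter [None] gets zero amplitudes and zero rates; its mean parameters are 1, and its
   cost vanishes with the amplitudes. *)
pose F (x : R) (pj : _ -> 'I_2 -> R) (t : option 'I_m) : 'I_2 -> R :=
  if t is Some k then pj (s k) else fun=> x.
pose kap := F 0 (fun s => s.1.1.1.1.1); pose eta := F 0 (fun s => s.1.1.1.1.2).
pose th := F 1 (fun s => s.1.1.1.2); pose ph := F 1 (fun s => s.1.1.2).
pose c := F 0 (fun s => s.1.2); pose pr := F 0 (fun s => s.2).
have hsE k : good k (kap (Some k), eta (Some k), th (Some k), ph (Some k), c (Some k), pr (Some k)).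
  by move: (hs k); rewrite /kap /eta /th /ph /c /pr /F; case: (s k) => [[[[[? ?] ?] ?] ?] ?].
have pos t i : [/\ 0 <= kap t i, 0 <= eta t i, 0 <= th t i & 0 <= ph t i].
  by case: t => [k|]; [have [] := hsE k|split; rewrite /= ?ler01].
have kap0 t i : 0 <= kap t i by have [] := pos t i.
have eta0 t i : 0 <= eta t i by have [] := pos t i.
have th0 t i : 0 <= th t i by have [] := pos t i.
have ph0 t i : 0 <= ph t i by have [] := pos t i.
have peak t i : kap t i + eta t i <= A.
  by case: t => [k|]; [have [_ /(_ i)[]] := hsE k|rewrite /= addr0 ltW].
have meanS k i : th (Some k) i * kap (Some k) i + ph (Some k) i * eta (Some k) i <= alpha i * A.
  by have [_ /(_ i)[]] := hsE k.
have meanN i : th None i * kap None i + ph None i * eta None i <= 0 by rewrite /= !mulr0 addr0.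
have c0 t i : 0 <= c t i by case: t => [k|//]; have [_ _ /(_ i)[]] := hsE k.
have pr0 t i : 0 <= pr t i by case: t => [k|//]; have [_ _ /(_ i)[]] := hsE k.
have gr t : good_rates sigma h (kap t) (eta t) (th t) (ph t) (c t) (pr t).
  case: t => [k|]; first by have [] := hsE k.
  by move=> i; rewrite /= addr0; split; exact: Ffun_ge0.
have ach := scheme_achievable sg0 A0 al0 h0 w0 w1 kap0 eta0 th0 ph0 peak meanS meanN c0 pr0
  (fun=> erefl) (fun=> erefl) gr.
(* The back-offs e/2 of the common and the private rate add up to e, and the splitting disappears
   from the total. *)
have rateE e i : crate w c e i + prate w pr e i = (1 - e) * (\sum_k w k * rate (q k) i) - e.
  have -> : \sum_k w k * rate (q k) i = mean w (c^~ i) + mean w (pr^~ i).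
    rewrite /mean -big_split; apply: eq_bigr => k _ /=.
    by have [_ _ _ -> _] := hsE k; rewrite mulrDr.
  by rewrite /crate /prate; field.
(* For e in (0, 1) the backed-off point is achievable, and it enters the neighbourhood B of p as e
   tends to 0. *)
move=> B Bp.
have cvg_p : ((1 - e) * p.1 - e, (1 - e) * p.2 - e) @[e --> 0^'+] --> p.
  have := cvg_pair (cvg_backoff (x := p.1)) (cvg_backoff (x := p.2)).
  by case: (p) => p1 p2; apply.
near (0 : R)^'+ => e.
exists ((1 - e) * p.1 - e, (1 - e) * p.2 - e); split; last by near: e; exact: cvg_p.
have := ach e; rewrite !rateE pE; apply; near: e; [exact: nbhs_right_gt|exact: nbhs_right_lt].
Unshelve. all: end_near. Qed.
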